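(* Let $\pi\colon H\twoheadrightarrow G$ be a fundamental epimorphism of profinite groups and let $\eta_I\colon\prod_{G,\ i\in I}H_i\twoheadrightarrow G$ be the structure map of the fiber product of a family $(\eta_i\colon H_i\twoheadrightarrow G)_{i\in I}$ of indecomposable epimorphisms. Denote $I_\zeta=\{i\in I : \eta_i\cong_G\zeta\}$ for every $\zeta\in\Lambda_{\mathrm{na}}(G)$, and $I_A=\{i\in I : \operatorname{Ker}\eta_i\cong_G A\}$ for every $A\in\Lambda_{\mathrm{ab}}(G)$. Then $\pi\cong_G\eta_I$ if and only if (a) $|I_\zeta|=\operatorname{mult}_\zeta(\pi)$ for every $\zeta\in\Lambda_{\mathrm{na}}(G)$; (b) $\operatorname{Span}(\eta_i)_{i\in I_A}=\operatorname{supp}_A(\pi)$ for every $A\in\Lambda_{\mathrm{ab}}(G)$; and (c) $\operatorname{mult}_A(\pi)$ is the relation dimension of $(\eta_i)_{i\in I_A}$ for every $A\in\Lambda_{\mathrm{ab}}(G)$.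
   Context: All groups are profinite, homomorphisms are continuous, subgroups are closed; $\twoheadrightarrow$ denotes an epimorphism. Epimorphisms $\eta\colon H\twoheadrightarrow G$, $\pi\colon E\twoheadrightarrow G$ are isomorphic, $\eta\cong_G\pi$, if there is an isomorphism $\psi\colon H\to E$ with $\eta=\pi\circ\psi$. An epimorphism is indecomposable if it is not an isomorphism and is not a composition of two epimorphisms neither of which is an isomorphism. For $M\triangleleft H$, $\mathcal{N}_M(H)$ is the set of maximal elements among the normal subgroups of $H$ strictly contained in $M$. The fundament kernel is $\mathcal{M}(\pi)=\bigcap_{N\in\mathcal{N}_{\operatorname{Ker}\pi}(H)}N$ (equal to $\operatorname{Ker}\pi$ if the latter is $1$); $\pi$ is fundamental if $\mathcal{M}(\pi)=1$. The fiber product of $(\eta_i\colon H_i\twoheadrightarrow G)_{i\in I}$ is $\prod_{G,\ i\in I}H_i=\{(h_i)\in\prod_{i\in I}H_i : \eta_i(h_i)=\eta_j(h_j)\ \forall i,j\}$ with structure map $\eta_I\colon(h_i)_i\mapsto\eta_j(h_j)$; for $I=\emptyset$ it is $G$ with $\eta_\emptyset=\mathrm{id}_G$. $\Lambda_{\mathrm{ab}}(G)$ is the set of isomorphism classes of finite simple $G$-modules; $\Lambda_{\mathrm{na}}(G)$ is a set of representatives of the isomorphism classes of indecomposable epimorphisms onto $G$ with non-abelian kernel. An abelian kernel of an epimorphism onto $G$ is a $G$-module via conjugation. For $A\in\Lambda_{\mathrm{ab}}(G)$, $F_A=\operatorname{End}_G(A)$ is a finite field and $H^2(G,A)$ (continuous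 cohomology) is an $F_A$-vector space. An epimorphism $\eta_i$ onto $G$ with kernel $\cong_G A$ is identified (after choosing an isomorphism of its kernel with $A$; the choice changes the class only by a factor in $F_A^\times$) with its class in $H^2(G,A)$. The relation dimension of a family $(v_i)_{i\in J}$ of vectors in an $F$-vector space $V$ is $\dim\operatorname{Ker}T$, where $T$ is the linear map from the $F$-vector space with basis $J$ to $V$ with $j\mapsto v_j$. Multiplicities and supports: for $\zeta\in\Lambda_{\mathrm{na}}(G)$, $\operatorname{mult}_\zeta(\pi)=|\{N\triangleleft H : N\le\operatorname{Ker}\pi,\ (H/N\twoheadrightarrow G)\cong_G\zeta\}|$. For $A\in\Lambda_{\mathrm{ab}}(G)$, let $\mathcal{C}_A=\{N\triangleleft H : N\le\operatorname{Ker}\pi,\ \operatorname{Ker}\pi/N\cong_G A\}$ (in particular $\operatorname{Ker}\pi/N$ is abelian), $N_A=\bigcap_{N\in\mathcal{C}_A}N$ ($=\operatorname{Ker}\pi$ if $\mathcal{C}_A=\emptyset$), $H_A=H/N_A$, $B_A=\operatorname{Ker}(H_A\twoheadrightarrow G)=\operatorname{Ker}\pi/N_A$ (a profinite $G$-module), $f_A\in H^2(G,B_A)$ the class of $1\to B_A\to H_A\to G\to1$, $B_A^*=\operatorname{Hom}_G(B_A,A)$ (continuous homomorphisms; an $F_A$-vector space), and $S_A\colon B_A^*\to H^2(G,A)$, $\phi\mapsto\phi_*(f_A)$. Then $\operatorname{mult}_A(\pi)=\dim_{F_A}\operatorname{Ker}S_A$ and $\operatorname{supp}_A(\pi)=\operatorname{Im}S_A$.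 *)

(* Defs.v *)
From HB Require Import structures.
From mathcomp Require Import all_boot all_order all_algebra.
From mathcomp Require Import generic_quotient ring_quotient.
From mathcomp Require Import all_classical topology tvs.
Set Implicit Arguments.
Unset Strict Implicit.
Unset Printing Implicit Defensive.

Import GRing.Theory.
Local Open Scope classical_set_scope.
Local Open Scope quotient_scope.
Local Open Scope group_scope.

HB.mixin Record isTopGroup G of Group G & Topological G := {
  mulg_continuous : continuous (fun x : G * G => x.1 * x.2) ;
  invg_continuous : continuous (fun x : G => x^-1) ;
}.

#[short(type="topGroupType")]
HB.structure Definition TopGroup :=
  {G of isTopGroup G & Group G & Topological G}.

HB.mixin Record isProfinite G of TopGroup G := {
  profinite_compact : compact [set: G] ;
  profinite_hausdorff : hausdorff_space G ;
  profinite_disconnected : totally_disconnected [set: G] ;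
}.

#[short(type="profGroupType")]
HB.structure Definition ProfGroup := {G of isProfinite G & TopGroup G}.

Lemma pair_continuous (X Y Z : topologicalType) (f : X -> Y) (g : X -> Z) :
  continuous f -> continuous g -> continuous (fun x => (f x, g x)).
Proof. by move=> fc gc x; apply: cvg_pair; [exact: fc | exact: gc]. Qed.

Lemma mulg_comp_continuous (X : topologicalType) (G : topGroupType)
    (f g : X -> G) :
  continuous f -> continuous g -> continuous (fun x => f x * g x).
Proof.
move=> fc gc x.
apply: (@continuous_comp _ _ _ (fun x => (f x, g x)) (fun z : G * G => z.1 * z.2)).
  exact: pair_continuous.
exact: mulg_continuous.
Qed.

Lemma invg_comp_continuous (X : topologicalType) (G : topGroupType)
    (f : X -> G) : continuous f -> continuous (fun x => (f x)^-1).
Proof.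
move=> fc x; apply: (@continuous_comp _ _ _ f (fun z : G => z^-1)).
  exact: fc.
exact: invg_continuous.
Qed.

Record nsubgroup (H : topGroupType) := NSubgroup {
  nset :> set H ;
  nset1 : nset 1 ;
  nsetM : forall x y, nset x -> nset y -> nset (x * y) ;
  nsetV : forall x, nset x -> nset x^-1 ;
  nsetJ : forall x y, nset x -> nset (x ^ y) ;
  nset_closed : closed nset ;
}.

Record epi (H G : topGroupType) := Epi {
  epi_fun :> H -> G ;
  epiM : {morph epi_fun : x y / x * y} ;
  epi_continuous : continuous epi_fun ;
  epi_surj : forall g, exists h, epi_fun h = g ;
}.

Definition top_group_iso (H E : topGroupType) (f : H -> E) : Prop :=
  [/\ {morph f : x y / x * y}, continuous f &
      exists2 f' : E -> H, continuous f' & cancel f f' /\ cancel f' f].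

Definition epi_iso (H E G : topGroupType) (eta : epi H G) (p : epi E G) : Prop :=
  exists2 psi : H -> E, top_group_iso psi & forall h, eta h = p (psi h).

Definition ker (H G : topGroupType) (p : H -> G) : set H := [set h | p h = 1].

Definition indecomposable (H G : profGroupType) (p : epi H G) : Prop :=
  ~ top_group_iso p /\
  forall (E : profGroupType) (q : epi H E) (r : epi E G),
    (forall h, p h = r (q h)) -> top_group_iso q \/ top_group_iso r.

Definition abelian_ker (H G : topGroupType) (p : epi H G) : Prop :=
  forall x y, ker p x -> ker p y -> x * y = y * x.

Definition maximal_normal_in (H : topGroupType) (M : set H) :
    set (nsubgroup H) :=
  [set N | N `<` M /\
    forall N' : nsubgroup H, N' `<` M -> N `<=` N' -> N' `<=` N].

(* If ker p = 1 then no N occurs, and the value is ker p. *)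
Definition fundament_kernel (H G : topGroupType) (p : epi H G) : set H :=
  ker p `&` \bigcap_(N in maximal_normal_in (ker p)) N.

Definition fundamental (H G : topGroupType) (p : epi H G) : Prop :=
  fundament_kernel p = [set 1].

Section Quotient.
Variables (H : topGroupType) (N : nsubgroup H).

Definition coset_rel : rel H := fun x y => `[< nset N (x^-1 * y) >].

Fact coset_equiv : equiv_class_of coset_rel.
Proof.
split=> [x|x y|y x z].
- by apply/asboolP; rewrite mulVg; exact: nset1.
- by apply/asboolP/asboolP => /nsetV; rewrite invgM invgK.
- move=> /asboolP Nxy /asboolP Nyz; apply/asboolP.
  have -> : x^-1 * z = (x^-1 * y) * (y^-1 * z) by rewrite -!mulgA mulVKg.
  exact: nsetM.
Qed.

Canonical coset_equiv_rel := EquivRelPack coset_equiv.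

Definition quot : Type := quotient_topology {eq_quot coset_rel}.

HB.instance Definition _ := Topological.on quot.
HB.instance Definition _ := Quotient.on quot.

Definition coset (x : H) : quot := (\pi_quot x)%qT.

Lemma coset_eq x y : coset x = coset y <-> nset N (x^-1 * y).
Proof.
split=> [xy|Nxy]; last by apply/eqmodP/asboolP.
by move/eqmodP: xy => /asboolP.
Qed.

Lemma cosetK (q : quot) : coset (repr q) = q.
Proof. exact: reprK. Qed.

Lemma repr_coset x : nset N (x^-1 * repr (coset x)).
Proof. by apply/coset_eq; rewrite cosetK. Qed.

Definition quot_one : quot := coset 1.
Definition quot_mul (a b : quot) : quot := coset (repr a * repr b).
Definition quot_inv (a : quot) : quot := coset (repr a)^-1.

Lemma quot_mulE x y : quot_mul (coset x) (coset y) = coset (x * y).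
Proof.
apply/esym/coset_eq; rewrite invgM.
have -> : y^-1 * x^-1 * (repr (coset x) * repr (coset y)) =
    (x^-1 * repr (coset x)) ^ y * (y^-1 * repr (coset y)).
  by rewrite /conjg -!mulgA mulVKg.
by apply: nsetM; [apply: nsetJ|]; exact: repr_coset.
Qed.

Lemma quot_invE x : quot_inv (coset x) = coset x^-1.
Proof.
apply/coset_eq; rewrite invgK.
have -> : repr (coset x) * x^-1 = (x^-1 * repr (coset x)) ^ x^-1.
  by rewrite /conjg invgK -!mulgA mulVKg.
by apply: nsetJ; exact: repr_coset.
Qed.

Fact quot_mulA : associative quot_mul.
Proof.
move=> a b c; rewrite -(cosetK a) -(cosetK b) -(cosetK c).
by rewrite !quot_mulE mulgA.
Qed.

Fact quot_mul1 : left_id quot_one quot_mul.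
Proof. by move=> a; rewrite -(cosetK a) quot_mulE mul1g. Qed.

Fact quot_1mul : right_id quot_one quot_mul.
Proof. by move=> a; rewrite -(cosetK a) quot_mulE mulg1. Qed.

Fact quot_mulV : left_inverse quot_one quot_inv quot_mul.
Proof. by move=> a; rewrite -(cosetK a) quot_invE quot_mulE mulVg. Qed.

Fact quot_Vmul : right_inverse quot_one quot_inv quot_mul.
Proof. by move=> a; rewrite -(cosetK a) quot_invE quot_mulE mulgV. Qed.

HB.instance Definition _ := isGroup.Build quot
  quot_mulA quot_mul1 quot_1mul quot_mulV quot_Vmul.

Lemma cosetM : {morph coset : x y / x * y}.
Proof. by move=> x y; rewrite -quot_mulE. Qed.

Lemma coset_continuous : continuous coset.
Proof. exact: pi_continuous. Qed.

Lemma coset_open (x : H) (U : set H) : nbhs x U -> nbhs (coset x) (coset @` U).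
Proof.
rewrite nbhsE => -[V [oV Vx] VU]; apply: (@filterS _ _ _ (coset @` V)).
  by move=> _ [v /VU Uv <-]; exists v.
apply: open_nbhs_nbhs; split; last by exists x.
rewrite /open /= /quotient_open (_ : _ @^-1` _ =
    \bigcup_(n in nset N) ((fun y => y * n) @^-1` V)).
  apply: bigcup_open => n _; apply: open_comp => // y _.
  apply: mulg_comp_continuous => [z|]; first exact: cvg_id.
  by move=> z; exact: cvg_cst.
apply/seteqP; split=> y /=.
  move=> [v Vv /esym/coset_eq Nyv]; exists (y^-1 * v) => //=.
  by rewrite mulVKg.
move=> [n Nn /= Vyn]; exists (y * n) => //.
by apply/esym/coset_eq; rewrite mulKg.
Qed.

Fact quot_mulg_continuous : continuous (fun x : quot * quot => x.1 * x.2).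
Proof.
move=> [a b] U /=; rewrite -(cosetK a) -(cosetK b) -cosetM.
move=> /coset_continuous; rewrite nbhs_filterE.
move=> /(@mulg_continuous H (repr a, repr b)) [[V W] [/= nV nW] VWU].
exists (coset @` V, coset @` W) => /=; first by split; exact: coset_open.
move=> [_ _] [/= [v Vv <-] [w Ww <-]].
by rewrite -cosetM; exact: (VWU (v, w)).
Qed.

Fact quot_invg_continuous : continuous (fun x : quot => x^-1).
Proof.
apply/quotient_continuous.
have -> : (fun x : quot => x^-1) \o \pi_quot%qT = coset \o (fun x => x^-1).
  by apply/funext => x /=; rewrite -quot_invE.
by move=> x; apply: continuous_comp;
  [exact: invg_continuous | exact: coset_continuous].
Qed.

HB.instance Definition _ :=
  isTopGroup.Build quot quot_mulg_continuous quot_invg_continuous.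

End Quotient.

Section QuotientEpi.
Variables (H G : topGroupType) (p : epi H G) (N : nsubgroup H).
Hypothesis Np : N `<=` ker p.

Definition quot_fun (q : quot N) : G := p (repr q).

Lemma epi1 : p 1 = 1.
Proof. by apply: (mulgI (p 1)); rewrite -epiM !mulg1. Qed.

Lemma epiV x : p x^-1 = (p x)^-1.
Proof. by apply: (mulgI (p x)); rewrite -epiM !mulgV epi1. Qed.

Lemma quot_fun_coset x : quot_fun (coset N x) = p x.
Proof.
have := Np (repr_coset N x); rewrite /ker /= epiM epiV => e.
by rewrite /quot_fun -[RHS]mulg1 -e mulVKg.
Qed.

Fact quot_funM : {morph quot_fun : x y / x * y}.
Proof.
move=> a b; rewrite -(cosetK a) -(cosetK b) -cosetM.
by rewrite !quot_fun_coset epiM.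
Qed.

Fact quot_fun_continuous : continuous quot_fun.
Proof.
apply/quotient_continuous; have -> : quot_fun \o \pi_(quot N) = p.
  by apply/funext => x; exact: quot_fun_coset.
exact: epi_continuous.
Qed.

Fact quot_fun_surj g : exists q, quot_fun q = g.
Proof. by have [h <-] := epi_surj p g; exists (coset N h); exact: quot_fun_coset. Qed.

Definition quot_epi : epi (quot N) G :=
  Epi quot_funM quot_fun_continuous quot_fun_surj.

End QuotientEpi.

Local Open Scope ring_scope.

(* The continuity of the action is not part of this structure; it is required
   in [simpleModule] below. *)
HB.mixin Record isGModule (G : topGroupType) A of TopologicalZmodule A := {
  gact : G -> A -> A ;
  gact1 : forall a, gact 1%g a = a ;
  gactM : forall g h a, gact (g * h)%g a = gact g (gact h a) ;
  gactD : forall g a b, gact g (a + b) = gact g a + gact g b ;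
}.

#[short(type="gmodType")]
HB.structure Definition GModule (G : topGroupType) :=
  {A of isGModule G A & TopologicalZmodule A}.

Section GmodTheory.
Variables (G : topGroupType) (A : gmodType G).

Lemma gact0 (g : G) : gact g (0 : A) = 0.
Proof. by apply: (addrI (gact g 0)); rewrite -gactD !addr0. Qed.

Lemma gactN (g : G) (a : A) : gact g (- a) = - gact g a.
Proof. by apply: (addrI (gact g a)); rewrite -gactD !subrr gact0. Qed.

Lemma addr_comp_continuous (X : topologicalType) (f g : X -> A) :
  continuous f -> continuous g -> continuous (f + g).
Proof.
move=> fc gc x.
apply: (@continuous_comp _ _ _ (fun x => (f x, g x)) (fun z : A * A => z.1 + z.2)).
  exact: pair_continuous.
exact: add_continuous.
Qed.

Lemma oppr_comp_continuous (X : topologicalType) (f : X -> A) :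
  continuous f -> continuous (- f).
Proof.
move=> fc x; apply: (@continuous_comp _ _ _ f (fun z : A => - z)).
  exact: fc.
exact: opp_continuous.
Qed.

Lemma cst0_continuous (X : topologicalType) : continuous (0 : X -> A).
Proof. by move=> x; exact: cvg_cst. Qed.

End GmodTheory.

Section Hom.
Variables (G : topGroupType) (B A : gmodType G).

Definition is_ghom : set (B -> A) :=
  [set f | [/\ forall x y, f (x + y) = f x + f y,
               forall g x, f (gact g x) = gact g (f x) & continuous f]].

Definition ghom : Type := set_type is_ghom.

HB.instance Definition _ := SubChoice.on ghom.

Fact is_ghom_zmod : zmod_closed (mem is_ghom).
Proof.
split=> [|f1 f2 /set_mem[D1 a1 c1] /set_mem[D2 a2 c2]]; apply/mem_set; split.
- by move=> x y; rewrite /= addr0.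
- by move=> g x; rewrite /= gact0.
- exact: cst0_continuous.
- by move=> x y; rewrite !fctE D1 D2 opprD addrACA.
- by move=> g x; rewrite !fctE a1 a2 gactD gactN.
- by apply: addr_comp_continuous => //; exact: oppr_comp_continuous.
Qed.

HB.instance Definition _ :=
  GRing.SubChoice_isSubZmodule.Build (B -> A) _ ghom is_ghom_zmod.

Definition ghom_fun (f : ghom) : B -> A := set_val f.

Lemma ghomP (f : ghom) : is_ghom (ghom_fun f).
Proof. exact: set_valP. Qed.

Definition Ghom f (hf : is_ghom f) : ghom := SigSub (mem_set hf).
End Hom.
Coercion ghom_fun : ghom >-> Funclass.

Section HomTheory.
Variable G : topGroupType.

Lemma ghom_eqP (B A : gmodType G) (f g : ghom B A) : f =1 g -> f = g.
Proof. by move=> fg; apply: val_inj; apply/funext => x; exact: fg. Qed.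

Lemma ghom0E (B A : gmodType G) (x : B) : ghom_fun (0 : ghom B A) x = 0.
Proof. by []. Qed.

Lemma ghomDE (B A : gmodType G) (f g : ghom B A) x : ghom_fun (f + g) x = f x + g x.
Proof. by []. Qed.

Lemma ghomD (B A : gmodType G) (f : ghom B A) x y : f (x + y) = f x + f y.
Proof. by have [] := ghomP f. Qed.

Lemma ghom_act (B A : gmodType G) (f : ghom B A) g x :
  f (gact g x) = gact g (f x).
Proof. by have [] := ghomP f. Qed.

Lemma ghom_continuous (B A : gmodType G) (f : ghom B A) : continuous f.
Proof. by have [] := ghomP f. Qed.

Lemma ghom0 (B A : gmodType G) (f : ghom B A) : f 0 = 0.
Proof. by apply: (addrI (f 0)); rewrite -ghomD !addr0. Qed.

Lemma ghomN (B A : gmodType G) (f : ghom B A) x : f (- x) = - f x.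
Proof. by apply: (addrI (f x)); rewrite -ghomD !subrr ghom0. Qed.

Fact ghom_id_subproof (A : gmodType G) : is_ghom (@id A).
Proof. by split=> // x; exact: cvg_id. Qed.

Definition ghom_id (A : gmodType G) : ghom A A := Ghom (ghom_id_subproof A).

Fact ghom_comp_subproof (C B A : gmodType G) (f : ghom B A) (g : ghom C B) :
  is_ghom (f \o g).
Proof.
split=> [x y|h x|x] /=; first by rewrite !ghomD.
  by rewrite !ghom_act.
by apply: continuous_comp; exact: ghom_continuous.
Qed.

Definition ghom_comp (C B A : gmodType G) (f : ghom B A) (g : ghom C B) :
  ghom C A := Ghom (ghom_comp_subproof f g).

(* For A finite and simple this is the finite field F_A, by the theorems of
   Schur and Wedderburn; only the ring structure is needed to define the
   vector spaces below. *)
Definition gend (A : gmodType G) : Type := ghom A A.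
HB.instance Definition _ (A : gmodType G) := GRing.Zmodule.on (gend A).

Section Ring.
Variable A : gmodType G.

Fact gend_mulA : associative (@ghom_comp A A A).
Proof. by move=> f g h; exact: ghom_eqP. Qed.
Fact gend_mul1 : left_id (ghom_id A) (@ghom_comp A A A).
Proof. by move=> f; exact: ghom_eqP. Qed.
Fact gend_1mul : right_id (ghom_id A) (@ghom_comp A A A).
Proof. by move=> f; exact: ghom_eqP. Qed.
Fact gend_mulDl : left_distributive (@ghom_comp A A A) +%R.
Proof. by move=> f g h; exact: ghom_eqP. Qed.
Fact gend_mulDr : right_distributive (@ghom_comp A A A) +%R.
Proof. by move=> f g h; apply: ghom_eqP => x; exact: ghomD. Qed.

HB.instance Definition _ := GRing.Zmodule_isPzRing.Build (gend A)
  gend_mulA gend_mul1 gend_1mul gend_mulDl gend_mulDr.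
End Ring.

Section Lmod.
Variables B A : gmodType G.

Fact ghom_scaleA (a b : gend A) (f : ghom B A) :
  ghom_comp a (ghom_comp b f) = ghom_comp (a * b) f.
Proof. exact: ghom_eqP. Qed.
Fact ghom_scale1 : left_id (1 : gend A) (@ghom_comp B A A).
Proof. by move=> f; exact: ghom_eqP. Qed.
Fact ghom_scaleDr :
  right_distributive (@ghom_comp B A A : gend A -> ghom B A -> ghom B A) +%R.
Proof. by move=> a f g; apply: ghom_eqP => x; exact: ghomD. Qed.
Fact ghom_scaleDl (f : ghom B A) :
  {morph ((@ghom_comp B A A)^~ f : gend A -> ghom B A) : a b / a + b}.
Proof. by move=> a b; exact: ghom_eqP. Qed.

HB.instance Definition _ := GRing.Zmodule_isLmodule.Build (gend A) (ghom B A)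
  ghom_scaleA ghom_scale1 ghom_scaleDr ghom_scaleDl.
End Lmod.

Definition giso (B A : gmodType G) (f : ghom B A) : Prop :=
  exists f' : ghom A B, cancel f f' /\ cancel f' f.

End HomTheory.

Lemma alt4_subr (V : zmodType) (a b c d a' b' c' d' : V) :
  (a - a') - (b - b') + (c - c') - (d - d') =
  (a - b + c - d) - (a' - b' + c' - d').
Proof. by rewrite !opprD !opprK (addrACA a) (addrACA (a - b)) (addrACA (a - b + c)). Qed.

Section Cohomology.
Variable G : topGroupType.

(* H^2(G, A) is defined by continuous inhomogeneous cochains. *)
Section H2def.
Variable A : gmodType G.

Definition is_cocycle : set (G * G -> A) :=
  [set c | continuous c /\ forall s t u : G,
     gact s (c (t, u)) - c ((s * t)%g, u) + c (s, (t * u)%g) - c (s, t) = 0].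

Definition cocycle : Type := set_type is_cocycle.

HB.instance Definition _ := SubChoice.on cocycle.

Fact is_cocycle_zmod : zmod_closed (mem is_cocycle).
Proof.
split=> [|f1 f2 /set_mem[c1 e1] /set_mem[c2 e2]]; apply/mem_set; split.
- exact: cst0_continuous.
- by move=> s t u; rewrite -[LHS]/(gact s (0 : A) - 0 + 0 - 0) gact0 !subr0 addr0.
- by apply: addr_comp_continuous => //; exact: oppr_comp_continuous.
- move=> s t u; rewrite !fctE gactD gactN alt4_subr (e1 s t u) (e2 s t u).
  exact: subrr.
Qed.

HB.instance Definition _ :=
  GRing.SubChoice_isSubZmodule.Build (G * G -> A) _ cocycle is_cocycle_zmod.

Definition cocycle_fun (c : cocycle) : G * G -> A := set_val c.

Lemma cocycleP (c : cocycle) : is_cocycle (cocycle_fun c).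
Proof. exact: set_valP. Qed.

Definition Cocycle c (hc : is_cocycle c) : cocycle := SigSub (mem_set hc).

Definition coboundary : {pred cocycle} :=
  fun c => `[< exists2 u : G -> A, continuous u &
    forall s t : G, cocycle_fun c (s, t) = gact s (u t) - u (s * t)%g + u s >].

Fact coboundary_zmod : zmod_closed coboundary.
Proof.
split=> [|c1 c2 /asboolP[u cu e] /asboolP[v cv f]]; apply/asboolP.
  exists 0; first exact: cst0_continuous.
  by move=> s t; rewrite -[RHS]/(gact s (0 : A) - 0 + 0) gact0 subrr addr0.
exists (u - v).
  by apply: addr_comp_continuous => //; exact: oppr_comp_continuous.
move=> s t; rewrite -[LHS]/(cocycle_fun c1 (s, t) - cocycle_fun c2 (s, t)).
rewrite e f !fctE gactD gactN !opprD !opprK.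
by rewrite (addrACA (gact s (u t))) (addrACA (gact s (u t) - u (s * t)%g)).
Qed.

HB.instance Definition _ :=
  GRing.isZmodClosed.Build cocycle coboundary coboundary_zmod.

Definition H2 : Type := {ideal_quot coboundary}.
HB.instance Definition _ := GRing.Zmodule.on H2.
HB.instance Definition _ := Quotient.on H2.

Definition H2class (c : cocycle) : H2 := \pi_H2 c.

Lemma H2class_eq c d : H2class c = H2class d <-> c - d \in coboundary.
Proof. by split=> [/eqmodP|cd] //; apply/eqmodP. Qed.

Lemma H2classK (x : H2) : H2class (repr x) = x.
Proof. exact: reprK. Qed.

Lemma H2classD c d : H2class (c + d) = H2class c + H2class d.
Proof. exact: raddfD. Qed.

End H2def.

Section Functoriality.
Variables B A : gmodType G.

Fact cocycle_map_subproof (f : ghom B A) (c : cocycle B) :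
  is_cocycle (f \o cocycle_fun c).
Proof.
have [cc ec] := cocycleP c; split.
  by move=> x; apply: continuous_comp; [exact: cc | exact: ghom_continuous].
by move=> s t u; rewrite /= -ghom_act -!ghomN -!ghomD ec ghom0.
Qed.

Definition cocycle_map f c : cocycle A := Cocycle (cocycle_map_subproof f c).

Definition H2_map (f : ghom B A) (x : H2 B) : H2 A :=
  H2class (cocycle_map f (repr x)).

Lemma H2_map_class f c : H2_map f (H2class c) = H2class (cocycle_map f c).
Proof.
have /H2class_eq/asboolP[u cu e] := H2classK (H2class c).
apply/H2class_eq/asboolP; exists (f \o u).
  by move=> x; apply: continuous_comp; [exact: cu | exact: ghom_continuous].
move=> s t; rewrite /= -ghom_act -ghomN -!ghomD -e.
by rewrite -[RHS]/(f (_ - _)) ghomD ghomN.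
Qed.
End Functoriality.

Lemma cocycle_eqP (A : gmodType G) (c d : cocycle A) :
  cocycle_fun c =1 cocycle_fun d -> c = d.
Proof. by move=> cd; apply: val_inj; apply/funext => x; exact: cd. Qed.

Section H2Lmod.
Variable A : gmodType G.

Fact H2_scaleA (a b : gend A) (x : H2 A) :
  H2_map a (H2_map b x) = H2_map (a * b) x.
Proof.
rewrite -(H2classK x) !H2_map_class; congr H2class; exact: cocycle_eqP.
Qed.

Fact H2_scale1 : left_id (1 : gend A) (@H2_map A A).
Proof.
move=> x; rewrite -(H2classK x) H2_map_class; congr H2class.
exact: cocycle_eqP.
Qed.

Fact H2_scaleDr :
  right_distributive (@H2_map A A : gend A -> H2 A -> H2 A) +%R.
Proof.
move=> a x y; rewrite -(H2classK x) -(H2classK y) -H2classD !H2_map_class.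
rewrite -H2classD; congr H2class; apply: cocycle_eqP => z.
exact: ghomD.
Qed.

Fact H2_scaleDl (x : H2 A) :
  {morph ((@H2_map A A)^~ x : gend A -> H2 A) : a b / a + b}.
Proof.
move=> a b; rewrite -(H2classK x) !H2_map_class -H2classD; congr H2class.
exact: cocycle_eqP.
Qed.

HB.instance Definition _ := GRing.Zmodule_isLmodule.Build (gend A) (H2 A)
  H2_scaleA H2_scale1 H2_scaleDr H2_scaleDl.
End H2Lmod.

End Cohomology.

Section KernelModule.
Variables (E G : topGroupType) (p : epi E G).

Definition kmod of abelian_ker p : Type := set_type (ker p).

Variable ab : abelian_ker p.
Local Notation K := (kmod ab).

HB.instance Definition _ := Topological.on K.

Definition kval (x : K) : E := set_val x.

Lemma kvalP (x : K) : p (kval x) = 1%g.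
Proof. exact: (@set_valP _ (ker p) x). Qed.

Lemma kval_inj : injective kval.
Proof. exact: val_inj. Qed.

Lemma kval_continuous : continuous kval.
Proof. exact: initial_continuous. Qed.

Definition Kmod (x : E) (px : p x = 1%g) : K := SigSub (mem_set px).

Lemma KmodK (x : E) (px : p x = 1%g) : kval (Kmod px) = x.
Proof. by rewrite /kval set_valE. Qed.

Fact kmod_zero_subproof : p 1%g = 1%g. Proof. exact: epi1. Qed.
Fact kmod_add_subproof (x y : K) : p (kval x * kval y)%g = 1%g.
Proof. by rewrite epiM !kvalP mulg1. Qed.
Fact kmod_opp_subproof (x : K) : p (kval x)^-1%g = 1%g.
Proof. by rewrite epiV kvalP invg1. Qed.

Definition kmod_zero : K := Kmod kmod_zero_subproof.
Definition kmod_add x y : K := Kmod (kmod_add_subproof x y).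
Definition kmod_opp x : K := Kmod (kmod_opp_subproof x).

Fact kmod_addA : associative kmod_add.
Proof. by move=> x y z; apply: kval_inj; rewrite !KmodK mulgA. Qed.
Fact kmod_addC : commutative kmod_add.
Proof.
by move=> x y; apply: kval_inj; rewrite !KmodK; apply: ab; exact: kvalP.
Qed.
Fact kmod_add0 : left_id kmod_zero kmod_add.
Proof. by move=> x; apply: kval_inj; rewrite !KmodK mul1g. Qed.
Fact kmod_addN : left_inverse kmod_zero kmod_opp kmod_add.
Proof. by move=> x; apply: kval_inj; rewrite !KmodK mulVg. Qed.

HB.instance Definition _ := GRing.isZmodule.Build K
  kmod_addA kmod_addC kmod_add0 kmod_addN.

Lemma kval_comp_continuous (X : topologicalType) (f : X -> K) :
  continuous (kval \o f) -> continuous f.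
Proof. exact: (@continuous_comp_initial K X E kval). Qed.

Fact kmod_sub_continuous : continuous (fun x : K * K => x.1 - x.2).
Proof.
apply: kval_comp_continuous.
have -> : kval \o (fun x : K * K => x.1 - x.2) =
    (fun x => kval x.1 * (kval x.2)^-1)%g by apply/funext => x /=; rewrite !KmodK.
apply: (@mulg_comp_continuous _ _ (fun x => kval x.1)
          (fun x : K * K => (kval x.2)^-1%g)).
  by move=> x; apply: continuous_comp; [exact: cvg_fst | exact: kval_continuous].
apply: invg_comp_continuous => x.
by apply: continuous_comp; [exact: cvg_snd | exact: kval_continuous].
Qed.

HB.instance Definition _ :=
  PreTopologicalNmodule_isTopologicalZmodule.Build K kmod_sub_continuous.

(* Kernel elements commute, so the choice of the lift of g does not matter:
   see kactE. *)
Definition epi_lift (g : G) : E := projT1 (cid (epi_surj p g)).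

Lemma epi_liftK g : p (epi_lift g) = g.
Proof. by rewrite /epi_lift; case: cid. Qed.

Fact kact_subproof (g : G) (x : K) :
  p (epi_lift g * kval x * (epi_lift g)^-1)%g = 1%g.
Proof. by rewrite !epiM epiV kvalP mulg1 mulgV. Qed.

Definition kact (g : G) (x : K) : K := Kmod (kact_subproof g x).

Lemma kactE (h : E) (x : K) : kval (kact (p h) x) = (h * kval x * h^-1)%g.
Proof.
rewrite KmodK; set l := epi_lift _; have lh : ker p (h^-1 * l)%g.
  by rewrite /ker /= epiM epiV epi_liftK mulVg.
have -> : (l * kval x = h * (h^-1 * l * kval x))%g by rewrite -!mulgA mulVKg.
by rewrite (ab lh (kvalP x)) !mulgA mulgK.
Qed.

Fact kact1 x : kact 1%g x = x.
Proof. by apply: kval_inj; rewrite -(epi1 p) kactE invg1 mulg1 mul1g. Qed.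
Fact kactM g h x : kact (g * h)%g x = kact g (kact h x).
Proof.
apply: kval_inj; rewrite -{1}(epi_liftK g) -{1}(epi_liftK h) -epiM kactE.
by rewrite invgM !KmodK !mulgA.
Qed.
Fact kactD g x y : kact g (x + y) = kact g x + kact g y.
Proof. by apply: kval_inj; rewrite !KmodK !mulgA mulgVK. Qed.

HB.instance Definition _ := isGModule.Build G K kact1 kactM kactD.

(* The elements of this set form a single class, and there is one whenever E is
   profinite, since p then has a continuous section; the default value of
   [xget] is then irrelevant. *)
Definition ext_classes : set (H2 K) :=
  [set x | exists s : G -> E, exists c : cocycle K,
    [/\ continuous s, cancel s p, x = H2class c &
        forall a b : G,
          kval (cocycle_fun c (a, b)) = (s a * s b * (s (a * b))^-1)%g]].

Definition ext_class : H2 K := xget 0 ext_classes.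

End KernelModule.

Record kiso (E G : topGroupType) (p : epi E G) (A : gmodType G) := KIso {
  kiso_abelian : abelian_ker p ;
  kiso_hom : ghom (kmod kiso_abelian) A ;
  kiso_iso : giso kiso_hom ;
}.

Definition ker_iso (E G : topGroupType) (p : epi E G) (A : gmodType G) : Prop :=
  inhabited (kiso p A).

Definition kiso_class (E G : topGroupType) (p : epi E G) (A : gmodType G)
  (k : kiso p A) : H2 A := H2_map (kiso_hom k) (ext_class (kiso_abelian k)).

Record simpleModule (G : topGroupType) := SimpleModule {
  smod :> gmodType G ;
  smod_finite : finite_set [set: smod] ;
  smod_discrete : forall U : set smod, open U ;
  smod_continuous : continuous (fun x : G * smod => gact x.1 x.2) ;
  smod_neq0 : exists a : smod, a != 0 ;
  smod_simple : forall U : set smod,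
    U 0 -> (forall a b, U a -> U b -> U (a - b)) ->
    (forall g a, U a -> U (gact g a)) -> U = [set 0] \/ U = setT ;
}.

Section FinSupp.
Variables (R : pzRingType) (J : Type).

Definition is_finsupp : set (J -> R^o) :=
  [set f | finite_set [set j | f j != 0]].

Definition finsupp : Type := set_type is_finsupp.

HB.instance Definition _ := SubChoice.on finsupp.

Fact is_finsupp_submod : submod_closed (mem is_finsupp).
Proof.
split=> [|a f g /set_mem ff /set_mem fg]; apply/mem_set.
  rewrite /is_finsupp /= (_ : [set j | _] = set0); first exact: finite_set0.
  by apply/seteqP; split=> // j /=; rewrite eqxx.
apply: (@sub_finite_set _ _ ([set j | f j != 0] `|` [set j | g j != 0])).
  move=> j /=; have [fj0|] := eqVneq (f j) 0; last by left.
  have [gj0|] := eqVneq (g j) 0; last by right.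
  by rewrite !fctE fj0 gj0 scaler0 addr0 eqxx.
by rewrite finite_setU.
Qed.

HB.instance Definition _ :=
  GRing.SubChoice_isSubLmodule.Build R (J -> R^o) _ finsupp is_finsupp_submod.

Definition finsupp_fun (f : finsupp) : J -> R := set_val f.
End FinSupp.

Section LinearAlgebra.
Variables (R : pzRingType) (V : lmodType R).

(* The linear map R^(J) -> V, e_j |-> v_j. *)
Definition lincomb (J : Type) (v : J -> V) (f : finsupp R J) : V :=
  \sum_(j \in [set: {classic J}]) finsupp_fun f j *: v j.

Definition lin_span (J : Type) (v : J -> V) : set V := range (lincomb v).

Definition relations (J : Type) (v : J -> V) : set (finsupp R J) :=
  [set f | lincomb v f = 0].

Definition is_basis (J : Type) (v : J -> V) (U : set V) : Prop :=
  relations v = [set 0] /\ lin_span v = U.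
End LinearAlgebra.

(* Dimensions are cardinalities of bases; they may be infinite. *)
Definition eq_dim (R : pzRingType) (V V' : lmodType R)
    (U : set V) (W : set V') : Prop :=
  exists J : Type, exists (v : J -> V) (w : J -> V'),
    is_basis v U /\ is_basis w W.

Local Close Scope ring_scope.

(* The fiber product.  The common value of the eta_i h_i is recorded as a first
   component in G, so that the fiber product of the empty family is G; for a
   nonempty family this component is redundant, see [fprod_nonempty]. *)
Section FiberProduct.
Variables (G : topGroupType) (I : Type) (K : I -> topGroupType).
Variable eta : forall i, epi (K i) G.

Definition in_fprod : set (G * prod_topology K) :=
  [set x | forall i, eta i (x.2 i) = x.1].

Definition fprod : Type := set_type in_fprod.

HB.instance Definition _ := Topological.on fprod.

Definition fbase (x : fprod) : G := (set_val x).1.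
Definition fcomp (x : fprod) (i : I) : K i := (set_val x).2 i.

Lemma fprodP (x : fprod) i : eta i (fcomp x i) = fbase x.
Proof. exact: (@set_valP _ in_fprod x). Qed.

Lemma fprod_eqP (x y : fprod) :
  fbase x = fbase y -> (forall i, fcomp x i = fcomp y i) -> x = y.
Proof.
move=> xy1 xy2; apply: val_inj.
rewrite [LHS]surjective_pairing [RHS]surjective_pairing; congr pair => //.
exact: functional_extensionality_dep.
Qed.

Definition Fprod (g : G) (h : forall i, K i) (e : forall i, eta i (h i) = g) :
  fprod := @SigSub _ _ _ (g, h : prod_topology K) (mem_set (e : in_fprod (g, h))).

Lemma fbaseK g h e : fbase (@Fprod g h e) = g.
Proof. by rewrite /fbase set_valE. Qed.

Lemma fcompK g h e i : fcomp (@Fprod g h e) i = h i.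
Proof. by rewrite /fcomp set_valE. Qed.

Fact fprod_one_subproof i : eta i 1 = 1. Proof. exact: epi1. Qed.
Fact fprod_mul_subproof x y i : eta i (fcomp x i * fcomp y i) = fbase x * fbase y.
Proof. by rewrite epiM !fprodP. Qed.
Fact fprod_inv_subproof x i : eta i (fcomp x i)^-1 = (fbase x)^-1.
Proof. by rewrite epiV fprodP. Qed.

Definition fprod_one : fprod := Fprod fprod_one_subproof.
Definition fprod_mul x y : fprod := Fprod (fprod_mul_subproof x y).
Definition fprod_inv x : fprod := Fprod (fprod_inv_subproof x).

Fact fprod_mulA : associative fprod_mul.
Proof. by move=> x y z; apply: fprod_eqP => [|i]; rewrite !(fbaseK, fcompK) mulgA. Qed.
Fact fprod_mul1 : left_id fprod_one fprod_mul.
Proof. by move=> x; apply: fprod_eqP => [|i]; rewrite !(fbaseK, fcompK) mul1g. Qed.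
Fact fprod_1mul : right_id fprod_one fprod_mul.
Proof. by move=> x; apply: fprod_eqP => [|i]; rewrite !(fbaseK, fcompK) mulg1. Qed.
Fact fprod_mulV : left_inverse fprod_one fprod_inv fprod_mul.
Proof. by move=> x; apply: fprod_eqP => [|i]; rewrite !(fbaseK, fcompK) mulVg. Qed.
Fact fprod_Vmul : right_inverse fprod_one fprod_inv fprod_mul.
Proof. by move=> x; apply: fprod_eqP => [|i]; rewrite !(fbaseK, fcompK) mulgV. Qed.

HB.instance Definition _ := isGroup.Build fprod
  fprod_mulA fprod_mul1 fprod_1mul fprod_mulV fprod_Vmul.

Lemma fbaseM : {morph fbase : x y / x * y}.
Proof. by move=> x y; rewrite fbaseK. Qed.

Lemma fcompM i : {morph (fun x => fcomp x i) : x y / x * y}.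
Proof. by move=> x y; rewrite fcompK. Qed.

Lemma fbase_continuous : continuous fbase.
Proof.
move=> x; apply: (@continuous_comp _ _ _ (@set_val _ in_fprod) fst).
  exact: initial_continuous.
exact: cvg_fst.
Qed.

Lemma fcomp_continuous i : continuous (fun x => fcomp x i).
Proof.
move=> x; apply: (@continuous_comp _ _ _ (@set_val _ in_fprod)
  (fun z : G * prod_topology K => z.2 i)); first exact: initial_continuous.
apply: (@continuous_comp _ _ _ snd (fun z : prod_topology K => z i)).
  exact: cvg_snd.
exact: (@proj_continuous {classic I} K i).
Qed.

Lemma fprod_comp_continuous (X : topologicalType) (f : X -> fprod) :
  continuous (fbase \o f) -> (forall i, continuous (fun x => fcomp (f x) i)) ->
  continuous f.
Proof.
move=> fb fc; apply: (@continuous_comp_initial fprod X _ (@set_val _ in_fprod)).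
have -> : @set_val _ in_fprod \o f =
    fun x => (fbase (f x), fcomp (f x) : prod_topology K).
  by apply/funext => x /=; rewrite [LHS]surjective_pairing.
apply: pair_continuous; first exact: fb.
move=> x; apply/cvg_sup => i U [_ [[V oV <-] /= Vx] /filterS]; apply.
by apply: (fc i x); exact: open_nbhs_nbhs.
Qed.

Fact fprod_mulg_continuous : continuous (fun x : fprod * fprod => x.1 * x.2).
Proof.
apply: fprod_comp_continuous => [|i].
  have -> : fbase \o (fun x : fprod * fprod => x.1 * x.2) =
      fun x => fbase x.1 * fbase x.2 by apply/funext => x; exact: fbaseM.
  by apply: mulg_comp_continuous => x; apply: continuous_comp;
    (exact: cvg_fst || exact: cvg_snd || exact: fbase_continuous).
have -> : (fun x : fprod * fprod => fcomp (x.1 * x.2) i) =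
    fun x => fcomp x.1 i * fcomp x.2 i by apply/funext => x; exact: fcompM.
by apply: mulg_comp_continuous => x;
  [apply: (@continuous_comp _ _ _ fst (fun z => fcomp z i))
  |apply: (@continuous_comp _ _ _ snd (fun z => fcomp z i))];
  (exact: cvg_fst || exact: cvg_snd || exact: fcomp_continuous).
Qed.

Fact fprod_invg_continuous : continuous (fun x : fprod => x^-1).
Proof.
apply: fprod_comp_continuous => [|i].
  have -> : fbase \o (fun x : fprod => x^-1) = fun x => (fbase x)^-1.
    by apply/funext => x /=; rewrite fbaseK.
  by apply: invg_comp_continuous; exact: fbase_continuous.
have -> : (fun x : fprod => fcomp x^-1 i) = fun x => (fcomp x i)^-1.
  by apply/funext => x /=; rewrite fcompK.
by apply: invg_comp_continuous; exact: fcomp_continuous.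
Qed.

HB.instance Definition _ :=
  isTopGroup.Build fprod fprod_mulg_continuous fprod_invg_continuous.

Fact fbase_surj g : exists x, fbase x = g.
Proof.
have e i : eta i (projT1 (cid (epi_surj (eta i) g))) = g by case: cid.
by exists (Fprod e); rewrite fbaseK.
Qed.

Definition fprod_epi : epi fprod G := Epi fbaseM fbase_continuous fbase_surj.

Lemma fprod_nonempty (j : I) :
  [/\ injective fcomp,
      range fcomp = [set h | forall i k, eta i (h i) = eta k (h k)] &
      forall x, fprod_epi x = eta j (fcomp x j)].
Proof.
split=> [x y xy||x]; last by rewrite fprodP.
  apply: fprod_eqP => [|i]; last by rewrite xy.
  by rewrite -(fprodP x j) -(fprodP y j) xy.
apply/seteqP; split=> [_ [x _ <-] i k|h hE]; first by rewrite !fprodP.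
by exists (Fprod (fun i => hE i j)).
Qed.

End FiberProduct.

Section Multiplicity.
Variables (H G : topGroupType) (p : epi H G).

(* mult_zeta(p) is the cardinality of this set. *)
Definition mult_na_set (E : topGroupType) (zeta : epi E G) :
    set (nsubgroup H) :=
  [set N : nsubgroup H | exists Np : nset N `<=` ker p, epi_iso (quot_epi Np) zeta].

(* C_A; Ker p / N is the kernel of H / N ->> G. *)
Definition ab_quotients (A : gmodType G) : set (nsubgroup H) :=
  [set N : nsubgroup H | exists Np : nset N `<=` ker p, ker_iso (quot_epi Np) A].

End Multiplicity.

Section AbelianPart.
Variables (H : topGroupType) (G : profGroupType) (p : epi H G) (A : gmodType G).

(* If C_A is empty, this is ker p. *)
Definition NA_set : set H := ker p `&` \bigcap_(N in ab_quotients p A) nset N.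

Lemma ker_closed : closed (ker p).
Proof.
rewrite (_ : ker p = p @^-1` [set 1]) //; apply: preimage_closed.
  by move=> x _; exact: epi_continuous.
apply: accessible_closed_set1; apply: hausdorff_accessible.
exact: profinite_hausdorff.
Qed.

Fact NA_set1 : NA_set 1.
Proof. by split=> [|N _]; [exact: epi1 | exact: nset1]. Qed.

Fact NA_setM x y : NA_set x -> NA_set y -> NA_set (x * y).
Proof.
move=> [px Nx] [py Ny]; split=> [|N CN].
  by rewrite /ker /= epiM px py mulg1.
by apply: nsetM; [exact: Nx | exact: Ny].
Qed.

Fact NA_setV x : NA_set x -> NA_set x^-1.
Proof.
move=> [px Nx]; split=> [|N CN]; first by rewrite /ker /= epiV px invg1.
by apply: nsetV; exact: Nx.
Qed.

Fact NA_setJ x y : NA_set x -> NA_set (x ^ y).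
Proof.
move=> [px Nx]; split=> [|N CN]; last by apply: nsetJ; exact: Nx.
by rewrite /ker /= !epiM epiV px mul1g mulVg.
Qed.

Fact NA_set_closed : closed NA_set.
Proof.
apply: closedI; first exact: ker_closed.
by apply: closed_bigI => N _; exact: nset_closed.
Qed.

Definition NA : nsubgroup H :=
  NSubgroup NA_set1 NA_setM NA_setV NA_setJ NA_set_closed.

Fact NA_ker : nset NA `<=` ker p. Proof. by move=> x []. Qed.

(* H_A ->> G; its source is [quot NA] and its kernel is B_A. *)
Definition epiA : epi (quot NA) G := quot_epi NA_ker.

Fact epiA_abelian : abelian_ker epiA.
Proof.
move=> a b; rewrite -(cosetK a) -(cosetK b) /ker /= => pa pb.
set x := repr a in pa *; set y := repr b in pb *.
have px : p x = 1 by rewrite -(quot_fun_coset NA_ker).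
have py : p y = 1 by rewrite -(quot_fun_coset NA_ker).
rewrite -!cosetM; apply/coset_eq; split=> [|N CN].
  by rewrite /ker /= epiM epiV !epiM px py !mulg1 invg1.
have [Np [[ab _ _]]] := CN.
have := ab (coset N x) (coset N y); rewrite -!cosetM => e.
by apply/coset_eq/e; rewrite /ker /= quot_fun_coset.
Qed.

Definition BA : gmodType G := kmod epiA_abelian.

Definition fA : H2 BA := ext_class epiA_abelian.

(* S_A : B_A^* -> H^2(G, A) *)
Definition SA (phi : ghom BA A) : H2 A := H2_map phi fA.

(* mult_A(p) is the dimension of this subspace of B_A^*. *)
Definition mult_ab_space : set (ghom BA A) := [set phi | SA phi = 0%R].

Definition supp_ab : set (H2 A) := range SA.

End AbelianPart.

Arguments mult_ab_space {H G} p A _.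
Arguments supp_ab {H G} p A _.

Section Families.
Variables (G : topGroupType) (I : Type) (K : I -> topGroupType).
Variable eta : forall i, epi (K i) G.

Definition I_na (E : topGroupType) (zeta : epi E G) : set I :=
  [set i | epi_iso (eta i) zeta].

Definition I_ab (A : gmodType G) : set I := [set i | ker_iso (eta i) A].
End Families.

(* Main.v *)
Require Import Defs.
From HB Require Import structures.
From mathcomp Require Import all_boot all_algebra.
From mathcomp Require Import all_classical topology.
Set Implicit Arguments.
Unset Strict Implicit.
Unset Printing Implicit Defensive.
Import GRing.Theory.
Local Open Scope classical_set_scope.
Local Open Scope card_scope.
Local Open Scope group_scope.

(** The kernel of an indecomposable epimorphism is a minimal closed normal
    subgroup, hence finite: it is either a finite simple G-module or non-abelian
    ([indecomposableP], [minimal_ker_finite], [minimal_abelian_simple]).  A map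
    from H to the fibre product of the eta i is a family of epimorphisms
    q i : H ->> K i over G, and it is an isomorphism as soon as the common kernel
    of the q i is trivial and every finite subfamily maps ker p onto the product
    of the kernels of its eta i; compactness does the rest ([fprod_onto],
    [to_fprod_iso]).

    Everything rests on deciding when one more factor can be added.  By Goursat's
    lemma this fails only if q j factors, on ker p, through a finite subfamily
    ([onto_on_independent]).  For a non-abelian ker (eta j), commutators force
    ker (q j) to be one of the earlier kernels ([nonabelian_prime]); for an
    abelian one, q j restricted to ker p becomes a linear combination of the
    earlier homomorphisms to the same module ([kerhom_split]).  So a non-abelian
    class zeta contributes the set of kernels N with H / N isomorphic to zeta,
    and a module A contributes a basis of B_A^* = Hom_G (B_A, A).

    The basis is matched with cohomology classes: an epimorphism q : H ->> E over
    G with ker (E ->> G) isomorphic to A restricts to some phi in B_A^* with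
    S_A phi equal to the class of E, and every nonzero phi with this property
    comes from such a q ([SA_of_morphism], [morphism_of_SA]).  Both need a
    continuous section of H_A ->> G; it exists because H_A is itself the fibre
    product of finite-kernel extensions over any basis of B_A^*
    ([epiA_section]).  What remains is linear algebra: a linear map S on V admits
    a basis (phi j) of V with S (phi j) = v j if and only if the v j span the
    image of S and their relations have the dimension of Ker S ([basis_lift],
    [basis_image]).

    If p is isomorphic to the fibre product, its coordinates provide the
    bijections and the bases ([nonabelian_card], [dual_basis]).  Conversely the
    bijections and bases granted by the three conditions provide the coordinates,
    and since p is fundamental their common kernel, which lies in every maximal N, is
    trivial ([coordinates]). *)

(** * Compact and totally disconnected spaces *)

Lemma compact_finite_cover (X : topologicalType) (A : set X) (I : eqType)
    (f : I -> set X) :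
  compact A -> (forall x, A x -> exists i, nbhs x (f i)) ->
  exists s : seq I, forall x, A x -> exists2 i, i \in s & f i x.
Proof.
move=> /compact_near_coveringP cA Af.
pose F := filter_from [set: seq I] (fun s0 => [set s : seq I | {subset s0 <= s}]).
have FF : Filter F.
  apply: filter_from_filter; first by exists [::].
  move=> s1 s2 _ _; exists (s1 ++ s2) => // s ss.
  by split => i si; apply: ss; rewrite mem_cat si ?orbT.
have [|s0 _ s0P] := cA _ F (fun s x => exists2 i, i \in s & f i x) FF.
  move=> x /Af[i fi]; exists (f i, [set s : seq I | {subset [:: i] <= s}]).
    by split => //; exists [:: i].
  by move=> [y s] [/= fy si]; exists i => //; apply: si; rewrite inE.
by exists s0 => x Ax; apply: (s0P s0 _ x Ax) => i.
Qed.

(** In a compact Hausdorff space the intersection Q of the clopen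
    neighbourhoods of x is connected: by normality, a separation of Q extends to
    disjoint open sets, and a clopen set around Q inside their union splits along
    it. *)
Lemma totally_disconnected_zero_dimensional (X : topologicalType) :
  compact [set: X] -> hausdorff_space X -> totally_disconnected [set: X] ->
  zero_dimensional X.
Proof.
move=> cX hX dX x y xy; apply: contrapT => nU.
pose Q := \bigcap_(U in [set U : set X | clopen U /\ U x]) U.
have Qx : Q x by move=> U [].
have Qy : Q y.
  by move=> U [cU Ux]; apply: contrapT => nUy; apply: nU; exists U.
have cQ : closed Q by apply: closed_bigI => U [[]].
have Qsub (O : set X) : open O -> Q `<=` O ->
    exists W, [/\ clopen W, W x & W `<=` O].
  move=> oO QO.
  have cO : compact (~` O).
    by apply: (subclosed_compact _ cX) => //; exact: open_closedC.
  have [|s sP] := @compact_finite_cover X (~` O) {classic (set X)}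
      (fun U => [set z | [/\ clopen U, U x & ~ U z]]) cO.
    move=> z nOz; have : ~ Q z by move=> /QO.
    move=> /existsNP[U /not_implyP[[cU Ux] nUz]]; exists U.
    have : nbhs z (~` U).
      by apply: open_nbhs_nbhs; split => //; apply: closed_openC; case: cU.
    by apply: filterS.
  have [W [cW Wx Ws]] : exists W, [/\ clopen W, W x &
      forall z U, W z -> U \in s -> clopen U -> U x -> U z].
    elim: s {sP} => [|U s [W [cW Wx Ws]]].
      by exists setT; split => //; exact: clopenT.
    have [[cU Ux]|nUx] := pselect (clopen U /\ U x).
      exists (W `&` U); split => [|//|z V [Wz Uz]]; first exact: clopenI.
      by rewrite inE => /orP[/eqP -> //|Vs]; exact: Ws.
    exists W; split => // z V Wz; rewrite inE => /orP[/eqP ->|Vs]; last exact: Ws.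
    by move=> cU Ux; case: nUx.
  exists W; split => // z Wz; apply: contrapT => nOz.
  by have [U Us [cU Ux]] := sP z nOz; apply; exact: Ws.
have conn : connected Q.
  move=> B [b Bb] [C oC BC] [D cD BD].
  have cB : closed B by rewrite BD; exact: closedI.
  have cB' : closed (Q `&` ~` C) by apply: closedI => //; exact: open_closedC.
  have nB : set_nbhs B (~` (Q `&` ~` C)).
    by apply/set_nbhsP; exists (~` (Q `&` ~` C)); split => //;
      [exact: closed_openC | rewrite BC => z [Qz Cz] []].
  have [S SB Scl] := compact_normal hX cX cB nB.
  have /set_nbhsP[U [oU BU US]] := SB.
  pose V := ~` closure S.
  have oV : open V by apply: closed_openC; exact: closed_closure.
  have QUV : Q `<=` U `|` V.
    move=> z Qz; have [Cz|nCz] := pselect (C z).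
      by left; apply: BU; rewrite BC.
    by right => /Scl; apply.
  have [W [[oW cW] Wx WUV]] := Qsub _ (openU oU oV) QUV.
  have WU : W `&` U = W `&` closure S.
    apply/seteqP; split => z [Wz h]; split => //.
      exact/subset_closure/US.
    by have [] := WUV z Wz.
  have cWU : clopen (W `&` U).
    split; first exact: openI.
    by rewrite WU; apply: closedI => //; exact: closed_closure.
  have cWV : clopen (W `\` (W `&` U)).
    by rewrite setDE; apply: clopenI; [split | exact: clopenC].
  have [Ux|nUx] := pselect (U x).
    rewrite BC; apply/seteqP; split; first by move=> ? [].
    move=> z Qz; split => //; apply: contrapT => nCz.
    have [_ Uz] := Qz _ (conj cWU (conj Wx Ux)).
    by have := Scl _ (subset_closure (US _ Uz)); apply.
  have Qb : Q b by move: Bb; rewrite BC => -[].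
  have [_ []] : (W `\` (W `&` U)) b by apply: Qb; split => //; split => // -[].
  split; last exact: BU.
  by apply: Qb; split.
have := dX x I; move=> /(congr1 (fun S : set X => S y)) /= e.
suff yx : y = x by move/eqP: xy; apply.
by rewrite -[_ = _]e; exists Q.
Qed.

Lemma compact_can_continuous (X Y : topologicalType) (f : X -> Y) (g : Y -> X) :
  compact [set: X] -> hausdorff_space Y -> continuous f ->
  cancel f g -> cancel g f -> continuous g.
Proof.
move=> cX hY fc fg gf; apply/continuous_closedP => C cC.
have -> : g @^-1` C = f @` C.
  apply/seteqP; split => [y Cy|_ [x Cx <-]]; last by rewrite /= fg.
  by exists (g y).
apply: compact_closed => //; apply: continuous_compact.
  by apply: continuous_subspaceT => x; exact: fc.
exact: subclosed_compact cX _.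
Qed.

(** * Open normal subgroups *)

Section Translations.
Variable G : topGroupType.

Lemma mulgl_continuous (a : G) : continuous (fun x : G => a * x).
Proof. by apply: mulg_comp_continuous => x; [exact: cvg_cst | exact: cvg_id]. Qed.

Lemma nbhs_translate (U : set G) (x : G) :
  nbhs 1 U -> nbhs x [set y | U (x^-1 * y)].
Proof.
move=> U1; by apply: (@mulgl_continuous x^-1 x); rewrite /= mulVg.
Qed.

Lemma stable_open (U A : set G) :
  nbhs 1 U -> (forall x u, A x -> U u -> A (x * u)) -> open A.
Proof.
move=> U1 AU; rewrite openE => x Ax; rewrite /interior.
apply: filterS (nbhs_translate x U1) => y /= Uy.
by rewrite -(mulVKg x y); exact: AU.
Qed.

End Translations.

Lemma profinite_finite_closed (H : profGroupType) (A : set H) :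
  finite_set A -> closed A.
Proof.
have /hausdorff_accessible/accessible_finite_set_closed := @profinite_hausdorff H.
exact.
Qed.

Lemma profinite_closed1 (H : profGroupType) (x : H) : closed [set x].
Proof. by apply: profinite_finite_closed; exact: finite_set1. Qed.

Lemma profinite_zero_dimensional (H : profGroupType) : zero_dimensional H.
Proof.
apply: totally_disconnected_zero_dimensional; first exact: profinite_compact.
  exact: profinite_hausdorff.
exact: profinite_disconnected.
Qed.

Lemma nset_exists (H : topGroupType) (P : set H) :
  P 1 -> (forall x y, P x -> P y -> P (x * y)) -> (forall x, P x -> P x^-1) ->
  (forall x y, P x -> P (x ^ y)) -> closed P ->
  exists N : nsubgroup H, nset N = P.
Proof. by move=> a b c d e; exists (NSubgroup a b c d e). Qed.

(** The elements that can be inserted between g and h without changing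
    whether the product lies in a clopen D, for all g and h, form a normal
    subgroup inside D; it is open by the tube lemma. *)
Lemma open_normal_base (H : profGroupType) (V : set H) :
  nbhs 1 V -> exists U : nsubgroup H, nbhs 1 (nset U) /\ nset U `<=` V.
Proof.
move=> nV.
have := @zero_dimensional_cvg H 1 (@profinite_hausdorff H)
  (@profinite_zero_dimensional H) (@profinite_compact H).
move=> /(_ V nV)[D [D1 cD] DV]; have [oD clD] := cD.
pose P := [set x | forall g h, D (g * x * h) <-> D (g * h)].
have clP : closed P.
  have -> : P = \bigcap_(gh in [set: H * H])
      ((fun x => gh.1 * x * gh.2) @^-1` [set y | D y <-> D (gh.1 * gh.2)]).
    apply/seteqP; split => [x Px [g h] _|x Px g h]; first exact: Px.
    exact: (Px (g, h) I).
  apply: closed_bigI => -[g h] _; apply: preimage_closed => /= [x _|].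
    apply: (@mulg_comp_continuous _ _ (fun y => g * y) (fun=> h)) => y.
      exact: mulgl_continuous.
    exact: cvg_cst.
  have [Dgh|nDgh] := pselect (D (g * h)).
    rewrite (_ : [set y | _] = D) //.
    by apply/seteqP; split => y /=; [move=> e; apply/e | split].
  rewrite (_ : [set y | _] = ~` D); first exact: open_closedC.
  apply/seteqP; split => y /=; first by move=> e Dy; apply/nDgh/e.
  by move=> nDy; split.
have [| | | |U UP] := @nset_exists H P _ _ _ _ clP.
- by move=> g h; rewrite mulg1.
- by move=> x y Px Py g h; rewrite mulgA Py Px.
- by move=> x Px g h; rewrite -(Px (g * x^-1)) mulgVK.
- move=> x y Px g h; rewrite /conjg !mulgA -(mulgA _ y h) Px.
  by rewrite !mulgA mulgVK.
exists U; rewrite UP; split; last first.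
  by move=> x Px; apply: DV; have := Px 1 1; rewrite !mul1g !mulg1 => /iffRL; exact.
have /compact_near_coveringP cHH : compact ([set: H] `*` [set: H]).
  by apply: compact_setX; exact: profinite_compact.
suff cov (gh : H * H) : nbhs (gh, 1 : H) [set z : (H * H) * H |
    D (z.1.1 * z.2 * z.1.2) <-> D (z.1.1 * z.1.2)].
  have := cHH _ (nbhs (1 : H)) (fun x gh => D (gh.1 * x * gh.2) <-> D (gh.1 * gh.2))
    (nbhs_filter _) (fun gh _ => cov gh).
  by apply: filterS => x Dx g h; exact: (Dx (g, h)).
case: gh => g h.
have c1 : continuous (fun z : (H * H) * H => z.1.1 * z.2 * z.1.2).
  apply: mulg_comp_continuous; first apply: mulg_comp_continuous.
  - by move=> z; apply: continuous_comp; exact: cvg_fst.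
  - by move=> z; exact: cvg_snd.
  - by move=> z; apply: (@continuous_comp _ _ _ fst snd); [exact: cvg_fst|exact: cvg_snd].
have c2 : continuous (fun z : (H * H) * H => z.1.1 * z.1.2).
  apply: mulg_comp_continuous.
  - by move=> z; apply: continuous_comp; exact: cvg_fst.
  - by move=> z; apply: (@continuous_comp _ _ _ fst snd); [exact: cvg_fst|exact: cvg_snd].
have [C [oC Cgh CD]] : exists C : set H, [/\ open C, C (g * h) &
    (C `<=` D) \/ (C `<=` ~` D)].
  have [Dgh|nDgh] := pselect (D (g * h)); first by exists D; split => //; left.
  by exists (~` D); split => //; [exact: closed_openC | right].
have n1 : nbhs (((g, h), 1) : (H * H) * H) [set z | C (z.1.1 * z.2 * z.1.2)].
  by apply: c1; rewrite /= mulg1; exact: open_nbhs_nbhs.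
have n2 : nbhs (((g, h), 1) : (H * H) * H) [set z | C (z.1.1 * z.1.2)].
  by apply: c2; exact: open_nbhs_nbhs.
apply: filterS (filterI n1 n2) => -[[a b] c] /= [Ca Cb].
by case: CD => CD; split=> // ?; [exact: CD| exact: CD | case: (CD _ Ca) | case: (CD _ Cb)].
Qed.

(** * Quotients, kernels and sections of profinite groups *)

Section QuotientProfinite.
Variables (H : profGroupType) (N : nsubgroup H).

Lemma quot_stable_open (U : set H) (A : set (quot N)) : nbhs 1 U ->
  (forall q u, A q -> U u -> A (q * coset N u)) -> open A.
Proof.
move=> U1 AU; rewrite /open /= /quotient_open.
apply: (stable_open U1) => x u Ax Uu.
by have := AU _ _ Ax Uu; rewrite -[(\pi_(quot N) x)%qT]/(coset N x) -cosetM.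
Qed.

(** For an open normal U missing the closed coset that separates the two points,
    the image of x U is clopen: it and its complement are stable under U. *)
Lemma quot_zero_dimensional : zero_dimensional (quot N).
Proof.
move=> a b; rewrite -(cosetK a) -(cosetK b); set x := repr a; set y := repr b.
move=> /eqP xy; have nN : ~ nset N (x^-1 * y) by move=> /coset_eq.
have [U [U1 UN]] : exists U : nsubgroup H, nbhs 1 (nset U) /\
    nset U `<=` [set u | ~ nset N (u^-1 * (x^-1 * y))].
  apply: open_normal_base.
  have c : continuous (fun u : H => u^-1 * (x^-1 * y)).
    apply: (@mulg_comp_continuous _ _ (fun u : H => u^-1) (fun=> x^-1 * y)) => u.
      exact: invg_continuous.
    exact: cvg_cst.
  have := c 1 (~` nset N); apply; rewrite /= invg1 mul1g.
  apply: open_nbhs_nbhs; split => //.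
  by apply: closed_openC; exact: nset_closed.
pose C := [set q | exists2 u, nset U u & q = coset N (x * u)].
exists C; split; last 1 first.
- move=> [u Uu /esym/coset_eq]; rewrite invgM -mulgA; exact: UN.
- split; first apply: (@quot_stable_open U) => // q v [u Uu ->] Uv.
    by exists (u * v); [exact: nsetM | rewrite -cosetM mulgA].
  rewrite -openC; apply: (@quot_stable_open U) => // q v nC Uv [u Uu e].
  apply: nC; exists (u * v^-1); first by apply: nsetM => //; exact: nsetV.
  by rewrite mulgA cosetM -e -mulgA -cosetM mulgV [q * _]mulg1.
- by exists 1; [exact: nset1 | rewrite mulg1].
Qed.

Fact quot_compact : compact [set: quot N].
Proof.
have -> : [set: quot N] = coset N @` setT.
  by apply/seteqP; split => // q _; exists (repr q) => //; exact: cosetK.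
apply: continuous_compact; last exact: profinite_compact.
by apply: continuous_subspaceT => x; exact: coset_continuous.
Qed.

Fact quot_hausdorff : hausdorff_space (quot N).
Proof.
rewrite open_hausdorff => a b /quot_zero_dimensional[C [[oC cC] Ca nCb]].
exists (C, ~` C); rewrite /= ?inE //; split => //; first exact: closed_openC.
by rewrite setICr.
Qed.

HB.instance Definition _ := isProfinite.Build (quot N) quot_compact
  quot_hausdorff (zero_dimension_totally_disconnected quot_zero_dimensional).

Definition coset_epi : epi H (quot N) :=
  Epi (@cosetM H N) (@coset_continuous H N)
      (fun q => ex_intro _ (repr q) (cosetK q)).

End QuotientProfinite.

Section EpiBasics.
Variables (H G : profGroupType) (p : epi H G).

Fact ker_conj x y : ker p x -> ker p (x ^ y).
Proof. by move=> px; rewrite /ker /= /conjg !epiM epiV px mul1g mulVg. Qed.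

Definition kerN : nsubgroup H.
Proof.
apply: (@NSubgroup H (ker p)); last exact: ker_closed.
- exact: epi1.
- by move=> x y px py; rewrite /ker /= epiM px py mulg1.
- by move=> x px; rewrite /ker /= epiV px invg1.
- by move=> x y; exact: ker_conj.
Defined.

Lemma kerNE : nset kerN = ker p. Proof. by []. Qed.

Lemma inj_iso : (forall x, p x = 1 -> x = 1) -> top_group_iso p.
Proof.
move=> inj; split; [exact: epiM|exact: epi_continuous|].
pose f g := projT1 (cid (epi_surj p g)).
have fK : cancel f p by move=> g; rewrite /f; case: cid.
have pK : cancel p f.
  move=> x; apply: (mulgI x^-1); rewrite mulVg; apply: inj.
  by rewrite epiM epiV fK mulVg.
exists f; last by split.
apply: compact_can_continuous pK fK; first exact: profinite_compact.
  exact: profinite_hausdorff.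
exact: epi_continuous.
Qed.

End EpiBasics.

Lemma iso_inj (H G : topGroupType) (f : H -> G) (x y : H) :
  top_group_iso f -> f x = f y -> x = y.
Proof. by move=> [_ _ [g _ [fK _]]] /(can_inj fK). Qed.

Definition nsetI (H : topGroupType) (M N : nsubgroup H) : nsubgroup H.
Proof.
apply: (@NSubgroup H (nset M `&` nset N)).
- by split; exact: nset1.
- by move=> x y [? ?] [? ?]; split; exact: nsetM.
- by move=> x [? ?]; split; exact: nsetV.
- by move=> x y [? ?]; split; exact: nsetJ.
- by apply: closedI; exact: nset_closed.
Defined.

Lemma nset_eq (H : topGroupType) (M N : nsubgroup H) :
  nset M = nset N -> M = N.
Proof.
case: M N => [M a b c d e] [N a' b' c' d' e'] /= MN; subst N.
by f_equal; exact: Prop_irrelevance.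
Qed.

Section ImagePreimage.
Variables (H E : profGroupType) (r : epi H E).

Lemma epi_image_closed (C : set H) : closed C -> closed (r @` C).
Proof.
move=> cC; apply: compact_closed; first exact: profinite_hausdorff.
apply: continuous_compact.
  by apply: continuous_subspaceT => x; exact: epi_continuous.
exact: subclosed_compact (@profinite_compact H) _.
Qed.

Definition nset_image (M : nsubgroup H) : nsubgroup E.
Proof.
apply: (@NSubgroup E (r @` nset M)).
- by exists 1; [exact: nset1 | exact: epi1].
- by move=> _ _ [x Mx <-] [y My <-]; exists (x * y); [exact: nsetM | rewrite epiM].
- by move=> _ [x Mx <-]; exists x^-1; [exact: nsetV | rewrite epiV].
- move=> _ y [x Mx <-]; have [z <-] := epi_surj r y.
  by exists (x ^ z); [exact: nsetJ | rewrite /conjg !epiM epiV].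
- by apply: epi_image_closed; exact: nset_closed.
Defined.

Definition nset_preimage (M : nsubgroup E) : nsubgroup H.
Proof.
apply: (@NSubgroup H (r @^-1` nset M)).
- by rewrite /= epi1; exact: nset1.
- by move=> x y /= ? ?; rewrite epiM; exact: nsetM.
- by move=> x /= ?; rewrite epiV; exact: nsetV.
- by move=> x y /= ?; rewrite /conjg !epiM epiV; exact: nsetJ.
- apply: preimage_closed; last exact: nset_closed.
  by move=> x _; exact: epi_continuous.
Defined.

End ImagePreimage.

Definition epi_comp (H E G : topGroupType) (q : epi H E) (r : epi E G) : epi H G.
Proof.
apply: (@Epi H G (r \o q)).
- by move=> x y /=; rewrite !epiM.
- by move=> x; apply: continuous_comp; exact: epi_continuous.
- move=> g; have [e <-] := epi_surj r g; have [h <-] := epi_surj q e.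
  by exists h.
Defined.

(** Indecomposability read on the kernel. *)
Definition minimal_ker (H G : topGroupType) (p : epi H G) : Prop :=
  (exists x, ker p x /\ x <> 1) /\
  forall M : nsubgroup H, nset M `<=` ker p ->
    nset M `<=` [set 1] \/ ker p `<=` nset M.

Section MinimalKernel.
Variables (H G : profGroupType) (p : epi H G).

(** A factorisation of p is the passage to the quotient by a closed normal
    subgroup of ker p. *)
Lemma indecomposableP : indecomposable p <-> minimal_ker p.
Proof.
split=> [[pN pdec]|[[x [px x1]] pmin]].
  split.
    apply: contrapT => nex; apply/pN/inj_iso => x px; apply: contrapT => x1.
    by apply: nex; exists x.
  move=> M Mp.
  have [|iso|iso] := pdec _ (coset_epi M) (quot_epi Mp).
  - by move=> h; rewrite [RHS](quot_fun_coset Mp).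
  - left=> x Mx; apply: (iso_inj iso) => /=; apply/esym/coset_eq.
    by rewrite invg1 mul1g.
  - right=> x px; suff : coset M 1 = coset M x by move/coset_eq; rewrite invg1 mul1g.
    by apply: (iso_inj iso); rewrite /= !(quot_fun_coset Mp) (px : p x = 1); exact: epi1.
split; first by move=> iso; apply/x1/(iso_inj iso); rewrite (px : p x = 1); exact/esym/epi1.
move=> E q r pqr; have [|q1|qp] := pmin (kerN q).
- by move=> y qy; rewrite /ker /= pqr qy epi1.
- by left; apply: inj_iso => y qy; exact: q1.
- right; apply: inj_iso => e re; have [h he] := epi_surj q e.
  by rewrite -he; apply: qp; rewrite /ker /= pqr he.
Qed.

Lemma ker_finite_sep : finite_set (ker p) ->
  exists U : nsubgroup H, nbhs 1 (nset U) /\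
    forall x, nset U x -> p x = 1 -> x = 1.
Proof.
move=> fin; have cl : closed (ker p `\ 1).
  by apply: profinite_finite_closed; exact: finite_setD.
have [|U [U1 Us]] := @open_normal_base H (~` (ker p `\ 1)).
  by apply: open_nbhs_nbhs; split; [exact: closed_openC | case=> _ []].
exists U; split => // x Ux px; apply: contrapT => x1.
by apply: (Us x Ux); split.
Qed.

Lemma sep_ker_finite (U : nsubgroup H) : nbhs 1 (nset U) ->
  (forall x, nset U x -> p x = 1 -> x = 1) -> finite_set (ker p).
Proof.
move=> U1 Up.
have cK : compact (ker p).
  by apply: (subclosed_compact _ (@profinite_compact H)) => //; exact: ker_closed.
pose f (x : {classic H}) : set H := [set y | ker p x /\ nset U (x^-1 * y)].
have [|s sP] := @compact_finite_cover H (ker p) {classic H} f cK.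
  move=> x px; exists x; apply: filterS (nbhs_translate x U1) => y /= Uy; split=> //.
apply: (@sub_finite_set _ _ [set` s]); last exact: finite_seq.
move=> y py; have [x xs [px /Up]] := sP y py.
rewrite epiM epiV px py invg1 mulg1 => /(_ erefl) xy.
by rewrite /= (_ : y = x) // -(mulVKg x y) xy mulg1.
Qed.

(** An open normal subgroup that misses one point of the kernel cuts it in a
    smaller normal subgroup, which is trivial; so the kernel is discrete. *)
Lemma minimal_ker_finite : minimal_ker p -> finite_set (ker p).
Proof.
move=> [[x [px x1]] pmin].
have [|U [U1 Ux]] := @open_normal_base H (~` [set x]).
  apply: open_nbhs_nbhs; split; last by move=> /esym.
  apply: closed_openC; exact: profinite_closed1.
apply: (sep_ker_finite U1) => y Uy py.
have [|M1|Mp] := pmin (nsetI U (kerN p)); first by move=> z [].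
  by apply: M1; split.
by have [/Ux] := Mp x px; case.
Qed.

(** Let U be open with U and ker p meeting trivially.  Pick a lift c of each
    coset of p(U) and keep, in the fibre over g, the one point that lies in c U:
    this is a closed transversal W, and p maps it bijectively onto G. *)
Lemma finite_ker_section : finite_set (ker p) ->
  exists2 s : G -> H, continuous s & cancel s p.
Proof.
move=> /ker_finite_sep[U [U1 Up]].
pose cls g := [set h : H | exists2 u, nset U u & g = p (h * u)].
have clsU h h' : nset U (h^-1 * h') -> cls (p h) = cls (p h').
  move=> Uh; apply/seteqP; split => k [u Uu e].
    exists (u * (h^-1 * h')); first exact: nsetM.
    by rewrite mulgA epiM -e -epiM mulVKg.
  exists (u * (h^-1 * h')^-1); first by apply: nsetM => //; exact: nsetV.
  by rewrite mulgA epiM -e -epiM invgM invgK mulVKg.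
have cls_ex g : exists h, cls g h.
  have [h <-] := epi_surj p g; exists h, 1; first exact: nset1.
  by rewrite mulg1.
(* The lift depends on g only through its coset, as a function of [cls g]. *)
pose c g := xget (1 : {classic H}) (cls g).
have cP g : cls g (c g).
  by have [h hP] := cls_ex g; exact: (@xgetPex {classic H} 1 (cls g)).
pose W := [set h | nset U ((c (p h))^-1 * h)].
have WU h u : nset U u -> W h -> W (h * u).
  move=> Uu Wh; rewrite /W /= /c -(clsU h (h * u)) ?mulKg // mulgA.
  exact: nsetM.
have cW : closed W.
  rewrite -openC; apply: (stable_open U1) => h u nW Uu WhU; apply: nW.
  by rewrite -(mulgK u h); apply: WU => //; exact: nsetV.
have W_ex g : exists h, W h /\ p h = g.
  have [u Uu e] := cP g; exists (c g * u); split => //.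
  by rewrite /W /= -e mulKg.
have W_uniq h h' : W h -> W h' -> p h = p h' -> h = h'.
  move=> Wh Wh' e; apply: (mulgI h^-1); rewrite mulVg; apply/esym/Up; last first.
    by rewrite epiM epiV e mulVg.
  have -> : h^-1 * h' = ((c (p h))^-1 * h)^-1 * ((c (p h))^-1 * h').
    by rewrite invgM invgK mulgA mulgK.
  by apply: nsetM; [exact: nsetV | rewrite e].
pose s g := projT1 (cid (W_ex g)).
have sW g : W (s g) by rewrite /s; case: cid => ? [].
have sK : cancel s p by move=> g; rewrite /s; case: cid => ? [].
exists s => //; apply/continuous_closedP => C cC.
have -> : s @^-1` C = p @` (C `&` W).
  apply/seteqP; split => [g Cg|_ [h [Ch Wh] <-]] /=; first by exists (s g).
  by rewrite (W_uniq (s (p h)) h).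
by apply: epi_image_closed; exact: closedI.
Qed.

End MinimalKernel.

(** * Independence of epimorphisms over G *)

(** G-equivariant homomorphisms ker p -> A, encoded as functions on all of H so
    that they can be composed with maps out of H; ker p need not be abelian. *)
Definition kerhom (H G : topGroupType) (p : epi H G) (A : gmodType G)
    (f : H -> A) : Prop :=
  (forall x y, ker p x -> ker p y -> f (x * y)%g = f x + f y)%R /\
  (forall h x, ker p x -> f (h * x * h^-1) = gact (p h) (f x)).

Section KerHom.
Variables (H G : profGroupType) (p : epi H G) (A : gmodType G).
Implicit Types f g : H -> A.

Lemma kerM x y : ker p x -> ker p y -> ker p (x * y).
Proof. by move=> px py; rewrite /ker /= epiM px py mulg1. Qed.

Lemma kerV x : ker p x -> ker p x^-1.
Proof. by move=> px; rewrite /ker /= epiV px invg1. Qed.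

Lemma kerJ h x : ker p x -> ker p (h * x * h^-1).
Proof. by move=> px; rewrite /ker /= !epiM epiV px mulg1 mulgV. Qed.

Lemma kerhom1 f : kerhom p f -> f 1 = 0%R.
Proof.
move=> [fD _]; have p1 : ker p 1 by exact: epi1.
by apply: (addrI (f 1)); rewrite -fD // mulg1 addr0.
Qed.

Lemma kerhomV f x : kerhom p f -> ker p x -> f x^-1 = (- f x)%R.
Proof.
move=> fh px; apply: (addrI (f x)); rewrite -(proj1 fh) //; last exact: kerV.
by rewrite mulgV subrr kerhom1.
Qed.

Lemma kerhomB f g : kerhom p f -> kerhom p g -> kerhom p (fun x => f x - g x)%R.
Proof.
move=> [fD fJ] [gD gJ]; split=> [x y px py|h x px].
  by rewrite fD // gD // opprD addrACA.
by rewrite fJ // gJ // gactD gactN.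
Qed.

Lemma kerhom0 : kerhom p (fun=> 0 : A)%R.
Proof. by split=> [x y _ _|h x _]; rewrite ?addr0 ?gact0. Qed.

Lemma kerhom_comp (E : profGroupType) (q : epi E H) (r : epi E G) f :
  (forall x, p (q x) = r x) -> kerhom p f -> kerhom r (f \o q).
Proof.
move=> pq [fD fJ]; split=> [x y rx ry|h x rx] /=.
  by rewrite epiM fD // /ker /= pq.
by rewrite !epiM epiV fJ ?pq // /ker /= pq.
Qed.

End KerHom.

Section OverGroup.
Variables (H G E : profGroupType) (p : epi H G) (rho : epi E G) (r : epi H E).
Hypothesis rhor : forall h, rho (r h) = p h.
Hypothesis rho_min : minimal_ker rho.

(** The image of M is normal in E, so minimality leaves no room in between. *)
Lemma full_image (M : nsubgroup H) : nset M `<=` ker p ->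
  ~ (nset M `<=` ker r) -> forall s, rho s = 1 -> exists2 m, nset M m & r m = s.
Proof.
move=> Mp nM; have [_ /(_ (nset_image r M))[]] := rho_min.
- by move=> _ [m /Mp pm <-]; rewrite /ker /= rhor.
- by move=> M1; case: nM => m Mm; apply: M1; exists m.
- by move=> full s /full[m Mm <-]; exists m.
Qed.

Lemma minimal_proper : ~ (ker p `<=` ker r).
Proof.
have [[s [rs s1]] _] := rho_min => pr; apply: s1.
have [h hs] := epi_surj r s; rewrite -hs; apply: pr.
by rewrite /ker /= -rhor hs.
Qed.

(** Commutators of elements of M1 and M2 lie in both, and their images are
    the commutators of ker rho. *)
Lemma nonabelian_prime (M1 M2 : nsubgroup H) : ~ abelian_ker rho ->
  nset M1 `<=` ker p -> nset M2 `<=` ker p ->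
  nset M1 `&` nset M2 `<=` ker r -> nset M1 `<=` ker r \/ nset M2 `<=` ker r.
Proof.
move=> nab M1p M2p M12; apply: contrapT => /not_orP[n1 n2]; apply: nab => a b ra rb.
have [x M1x <-] := full_image M1p n1 ra; have [y M2y <-] := full_image M2p n2 rb.
rewrite -!epiM; have e : x * y = y * x * (x^-1 * (x ^ y)).
  by rewrite /conjg !mulgA mulgK mulgV mul1g.
rewrite e epiM; have -> : r (x^-1 * x ^ y) = 1; last by rewrite mulg1.
apply: M12; split; first by apply: nsetM; [exact: nsetV | exact: nsetJ].
have -> : x^-1 * x ^ y = (y^-1 ^ x) * y by rewrite /conjg !mulgA.
by apply: nsetM => //; apply: nsetJ; exact: nsetV.
Qed.

End OverGroup.

(** If q and r both have minimal kernels over G, then ker q and ker r are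
    maximal among the closed normal subgroups strictly inside ker p. *)
Lemma ker_maximal (H G E F : profGroupType) (p : epi H G) (eta : epi E G)
    (rho : epi F G) (q : epi H E) (r : epi H F) :
  (forall h, eta (q h) = p h) -> (forall h, rho (r h) = p h) ->
  minimal_ker eta -> minimal_ker rho -> ker q `<=` ker r -> ker q = ker r.
Proof.
move=> etaq rhor emin rmin qr; apply/seteqP; split => // x rx.
apply: contrapT => qx; apply: (minimal_proper rhor rmin) => y py.
have rp : ker r `<=` ker p by move=> z rz; rewrite /ker /= -rhor rz epi1.
have [||m rm qm] := @full_image _ _ _ p eta q etaq emin (kerN r) rp _ (q y).
- by move=> rq; apply: qx; exact: rq.
- by rewrite etaq.
- have : ker r (y * m^-1) by apply: qr; rewrite /ker /= epiM epiV qm mulgV.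
  by rewrite /ker /= epiM epiV rm invg1 mulg1.
Qed.

Section Family.
Variables (H G : profGroupType) (p : epi H G) (I : Type).
Variables (K : I -> profGroupType) (eta : forall i, epi (K i) G).
Variable q : forall i, epi H (K i).
Hypothesis etaq : forall i h, eta i (q i h) = p h.
Local Notation J := {classic I}.

Fixpoint capN (F : seq J) : nsubgroup H :=
  if F is i :: F' then nsetI (kerN (q i)) (capN F') else kerN p.

Lemma capNP F x : nset (capN F) x <-> p x = 1 /\ forall i, i \in F -> q i x = 1.
Proof.
elim: F => [|i F IH] /=; first by split => // -[].
split=> [[qx /IH[px Fx]]|[px Fx]].
  by split=> // j; rewrite inE => /orP[/eqP->|/Fx].
split; first by apply: Fx; rewrite mem_head.
by apply/IH; split=> // j jF; apply: Fx; rewrite inE jF orbT.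
Qed.

Lemma capN_ker F : nset (capN F) `<=` ker p.
Proof. by move=> x /capNP[]. Qed.

(** H surjects onto the finite fibre product indexed by F, read on kernels:
    the part over G is automatic. *)
Definition onto_on (F : seq J) : Prop :=
  forall f : (forall i, K i), (forall i, eta i (f i) = 1) ->
  exists x, p x = 1 /\ forall i, i \in F -> q i x = f i.

Lemma onto_onS (F F' : seq J) : {subset F <= F'} -> onto_on F' -> onto_on F.
Proof.
move=> s o f fe; have [x [px Fx]] := o f fe.
by exists x; split => // i /s; exact: Fx.
Qed.

Lemma nonabelian_prime_seq (E : profGroupType) (rho : epi E G) (r : epi H E) F :
  (forall h, rho (r h) = p h) -> minimal_ker rho -> ~ abelian_ker rho ->
  nset (capN F) `<=` ker r -> exists2 i, i \in F & ker (q i) `<=` ker r.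
Proof.
move=> rhor rmin nab; elim: F => [pr|i F IH Fr].
  by case: (minimal_proper rhor rmin).
have qp : ker (q i) `<=` ker p by move=> z qz; rewrite /ker /= -(etaq i) qz epi1.
have [qr|/IH[j jF jr]] :=
  nonabelian_prime rhor rmin nab (M1 := kerN (q i)) (M2 := capN F) qp (@capN_ker F) Fr.
  by exists i => //; rewrite mem_head.
by exists j => //; rewrite inE jF orbT.
Qed.

(** A homomorphism on a finite product is the sum of its restrictions to the
    factors.  The elements of ker p that vanish in the coordinates of F map onto
    ker (eta j), and f factors through q j on them; subtracting the resulting
    component leaves a homomorphism that factors through F. *)
Lemma kerhom_split (A : gmodType G) (F : seq J) (f : H -> A) :
  uniq F -> onto_on F -> kerhom p f ->
  (forall x, nset (capN F) x -> f x = 0%R) ->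
  exists u : forall i, K i -> A, (forall i, kerhom (eta i) (u i)) /\
    forall x, p x = 1 -> f x = (\sum_(i <- F) u i (q i x))%R.
Proof.
elim: F f => [|j F IH] f /=.
  move=> _ _ fh f0; exists (fun i _ => 0%R); split=> [i|x px]; first exact: kerhom0.
  by rewrite big_nil f0.
move=> /andP[jF uF] onto fh f0; have [fD fJ] := fh.
have m_ex (s : K j) : exists m, eta j s = 1 -> nset (capN F) m /\ q j m = s.
  have [es|] := pselect (eta j s = 1); last by exists 1.
  have [|m [pm Fm]] := onto (@dfwith J K (fun=> 1) j s).
    move=> i; case: (eqVneq (j : J) i) => [<-|ji]; first by rewrite dfwithin.
    by rewrite dfwithout //; exact: epi1.
  exists m => _; split; last by rewrite Fm ?mem_head // dfwithin.
  apply/capNP; split => // i iF; rewrite Fm ?inE ?iF ?orbT // dfwithout //.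
  by apply: contraNneq jF => ->.
have [m mP] := choice m_ex.
have fE x y : nset (capN F) x -> nset (capN F) y -> q j x = q j y -> f x = f y.
  move=> Fx Fy xy; have [px py] := (capN_ker Fx, capN_ker Fy).
  apply/eqP; rewrite -subr_eq0 -(kerhomV fh py) -fD //; last exact: kerV.
  apply/eqP/f0; split; first by rewrite /= /ker /= epiM epiV xy mulgV.
  by apply: nsetM => //; exact: nsetV.
(* [m] lifts ker (eta j) to elements with trivial other coordinates. *)
pose u0 s := f (m s).
have u0h : kerhom (eta j) u0.
  split=> [x y ex ey|h x ex].
    have [[mx qx] [my qy]] := (mP x ex, mP y ey).
    have [mxy qxy] := mP (x * y) (kerM ex ey).
    rewrite /u0 -fD; [|exact: capN_ker mx|exact: capN_ker my].
    by apply: fE => //; [exact: nsetM | rewrite qxy epiM qx qy].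
  have [mx qx] := mP x ex; have [mh qh] := mP _ (kerJ h ex).
  have [k hk] := epi_surj (q j) h.
  rewrite /u0 -hk etaq -fJ; last exact: capN_ker mx.
  apply: fE => //; first by rewrite hk.
    by have := nsetJ k^-1 mx; rewrite /conjg invgK mulgA.
  by rewrite hk qh !epiM epiV qx hk.
have [|||u [uh uE]] := IH (fun x => f x - (u0 \o q j) x)%R uF.
- by apply: onto_onS onto => i iF; rewrite inE iF orbT.
- by apply: kerhomB => //; exact: kerhom_comp u0h.
- move=> x Fx /=; apply/eqP; rewrite subr_eq0; apply/eqP/fE => //.
    by apply: (proj1 (mP _ _)); rewrite etaq; exact: capN_ker Fx.
  by rewrite (proj2 (mP _ _)) // etaq; exact: capN_ker Fx.
exists (@dfwith J (fun i => K i -> A) u j u0); split.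
  move=> i; case: (eqVneq (j : J) i) => [<-|ji]; first by rewrite dfwithin.
  by rewrite dfwithout //; exact: uh.
move=> x px; rewrite big_cons dfwithin.
rewrite (_ : (\sum_(i <- F) _)%R = (\sum_(i <- F) u i (q i x))%R).
  by rewrite -uE //= addrC subrK.
apply: eq_big_seq => i iF; rewrite dfwithout //.
by apply: contraNneq jF => ->.
Qed.

Hypothesis eta_min : forall i, minimal_ker (eta i).

Definition kernels_separated : Prop :=
  forall i j, ~ abelian_ker (eta j) -> ker (q i) = ker (q j) -> i = j.

(** Linear independence without reference to a scalar field: each module
    ker (eta j) carries a homomorphism f such that f o q j is not a sum of
    homomorphisms that factor through finitely many other q i. *)
Definition kernels_independent : Prop :=
  forall j, abelian_ker (eta j) -> exists A : gmodType G, exists2 f : K j -> A,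
    kerhom (eta j) f &
    forall (F : seq J) (u : forall i, K i -> A), uniq F -> (j : J) \notin F ->
      (forall i, kerhom (eta i) (u i)) ->
      ~ forall x, p x = 1 -> f (q j x) = (\sum_(i <- F) u i (q i x))%R.

(** Goursat: the image of H in a finite fibre product grows by a full factor
    ker (eta j) as long as q j does not factor through the previous ones. *)
Lemma onto_on_independent (F : seq J) :
  kernels_separated -> kernels_independent -> uniq F -> onto_on F.
Proof.
move=> sep ind; elim: F => [|j F IH] /=.
  by move=> _ f fe; exists 1; split => //; exact: epi1.
move=> /andP[jF uF]; have {IH} onto := IH uF.
have nFj : ~ (nset (capN F) `<=` ker (q j)).
  move=> Fj; have [ab|nab] := pselect (abelian_ker (eta j)).
    have [A [f fh fE]] := ind j ab.
    have [|u [uh uE]] := kerhom_split uF onto (kerhom_comp (etaq j) fh).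
      by move=> x /Fj qx; rewrite /= (qx : q j x = 1) (kerhom1 fh).
    exact: (fE F u).
  have [i iF ij] := nonabelian_prime_seq (etaq j) (eta_min j) nab Fj.
  have e : i = j :> J.
    apply: sep => //; exact: (ker_maximal (etaq i) (etaq j)).
  by move: jF; rewrite -e iF.
move=> f fe; have [x [px Fx]] := onto f fe.
have [|m /capNP[pm Fm] qm] :=
    full_image (etaq j) (eta_min j) (@capN_ker F) nFj (s := (q j x)^-1 * f j).
  by rewrite epiM epiV etaq px fe invg1 mulg1.
exists (x * m); split; first by rewrite epiM px pm mulg1.
move=> i; rewrite inE => /orP[/eqP ->|iF]; rewrite epiM; first by rewrite qm mulVKg.
by rewrite Fm // mulg1 Fx.
Qed.

(** The conditions p h = fbase y and q i h = fcomp y i define closed subsets of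
    the compact group H, and finitely many of them are always compatible. *)
Lemma fprod_onto : (forall F, uniq F -> onto_on F) ->
  forall y : Defs.fprod eta, exists h, p h = fbase y /\ forall i, q i h = fcomp y i.
Proof.
move=> onto y; apply: contrapT => noh.
have [x0 px0] := epi_surj p (fbase y).
have cA : compact [set h | p h = fbase y].
  apply: (subclosed_compact _ (@profinite_compact H)) => //.
  apply: (@preimage_closed _ _ p [set fbase y]) => [x _|]; first exact: epi_continuous.
  exact: profinite_closed1.
have [|s sP] := @compact_finite_cover H _ J
    (fun i => [set h | q i h <> fcomp y i]) cA.
  move=> h ph; apply: contrapT => /forallNP nh; apply: noh; exists h; split => // i.
  apply: contrapT => qh; apply: (nh i); apply: open_nbhs_nbhs; split => //.
  apply: (@open_comp _ _ (q i) (~` [set fcomp y i])) => [x _|].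
    exact: epi_continuous.
  apply: closed_openC; exact: profinite_closed1.
have [|x [px sx]] := onto _ (undup_uniq s) (fun i => (q i x0)^-1 * fcomp y i).
  by move=> i; rewrite epiM epiV etaq Defs.fprodP px0 mulVg.
have [|i si] := sP (x0 * x); first by rewrite /= epiM px px0 mulg1.
by apply; rewrite epiM sx ?mem_undup // mulVKg.
Qed.

End Family.

Lemma injective_hausdorff (X : topologicalType) :
  (forall x y : X, x <> y -> exists Y : topologicalType, exists f : X -> Y,
     [/\ continuous f, hausdorff_space Y & f x <> f y]) -> hausdorff_space X.
Proof.
move=> sep x y xy; apply: contrapT => /sep[Y [f [fc hY]]]; apply.
apply: hY => A B fA fB.
have [z [Az Bz]] := xy _ _ (fc x A fA) (fc y B fB).
by exists (f z).
Qed.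

(** * Isomorphisms onto a fibre product *)

Section FprodIso.
Variables (X : topGroupType) (G : profGroupType) (p : epi X G) (I : Type).
Variables (K : I -> profGroupType) (eta : forall i, epi (K i) G).
Variable q : forall i, epi X (K i).
Hypothesis etaq : forall i h, eta i (q i h) = p h.

Lemma fprod_hausdorff : hausdorff_space (Defs.fprod eta).
Proof.
apply: injective_hausdorff => x y xy.
have [b|b] := pselect (fbase x = fbase y); last first.
  exists G; exists (@fbase _ _ _ _); split => //; first exact: fbase_continuous.
  exact: profinite_hausdorff.
have [i xyi] : exists i, fcomp x i <> fcomp y i.
  by apply/existsNP => h; apply: xy; exact: fprod_eqP.
exists (K i); exists (fun z => fcomp z i); split => //.
  exact: fcomp_continuous.
exact: profinite_hausdorff.
Qed.

Definition to_fprod (h : X) : Defs.fprod eta := Fprod (fun i => etaq i h).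

Lemma to_fprodM : {morph to_fprod : x y / x * y}.
Proof. by move=> x y; apply: fprod_eqP => [|i]; rewrite !(fbaseK, fcompK) epiM. Qed.

Lemma to_fprod_continuous : continuous to_fprod.
Proof.
apply: fprod_comp_continuous => [|i].
  rewrite (_ : _ \o _ = p); first exact: epi_continuous.
  by apply/funext => x /=; rewrite fbaseK.
rewrite (_ : (fun x => _) = q i); first exact: epi_continuous.
by apply/funext => x /=; rewrite fcompK.
Qed.

Lemma to_fprod_iso : compact [set: X] ->
  (forall y : Defs.fprod eta, exists h, p h = fbase y /\ forall i, q i h = fcomp y i) ->
  (forall x, p x = 1 -> (forall i, q i x = 1) -> x = 1) ->
  top_group_iso to_fprod.
Proof.
move=> cX surj inj; split; [exact: to_fprodM | exact: to_fprod_continuous|].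
pose g y := projT1 (cid (surj y)).
have gK : cancel g to_fprod.
  move=> y; rewrite /g; case: cid => h [ph qh] /=.
  by apply: fprod_eqP => [|i]; rewrite !(fbaseK, fcompK).
have fK : cancel to_fprod g.
  move=> x; apply: (mulgI x^-1); rewrite mulVg.
  have e := gK (to_fprod x); apply: inj => [|i].
    have := congr1 (@fbase _ _ _ _) e; rewrite !fbaseK epiM epiV => ->.
    by rewrite mulVg.
  have := congr1 (fun z => fcomp z i) e; rewrite !fcompK epiM epiV => ->.
  by rewrite mulVg.
exists g; last by split.
apply: (compact_can_continuous cX fprod_hausdorff) fK gK.
exact: to_fprod_continuous.
Qed.

End FprodIso.

(** * Linear algebra in arbitrary dimension *)

Section FinitelySupported.
Local Open Scope ring_scope.
Variables (R : pzRingType) (V : lmodType R).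

Definition fcover (J : Type) (s : seq {classic J}) (f : finsupp R J) : Prop :=
  forall j, (j : {classic J}) \notin s -> finsupp_fun f j = 0.

Lemma fcover_ex (J : Type) (f : finsupp R J) : exists2 s, uniq s & fcover s f.
Proof.
have /(@finite_seqP {classic J})[s sE] : finite_set [set j | finsupp_fun f j != 0].
  exact: (@set_valP _ (@is_finsupp R J) f).
exists (undup s); first exact: undup_uniq.
move=> j; rewrite mem_undup => js; apply: contrapT => /eqP fj.
have : [set` s] j by rewrite -sE.
by rewrite /= (negPf js).
Qed.

Lemma fcoverS (J : Type) (s s' : seq {classic J}) f :
  {subset s <= s'} -> fcover s f -> fcover s' f.
Proof. by move=> ss fs j js; apply: fs; apply: contra js => /ss. Qed.

Lemma fcover2_ex (J : Type) (f g : finsupp R J) :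
  exists s, [/\ uniq s, fcover s f & fcover s g].
Proof.
have [s _ sf] := fcover_ex f; have [t _ tg] := fcover_ex g.
exists (undup (s ++ t)); rewrite undup_uniq; split => //.
  by apply: fcoverS sf => j js; rewrite mem_undup mem_cat js.
by apply: fcoverS tg => j js; rewrite mem_undup mem_cat js orbT.
Qed.

Lemma lincombE (J : Type) (v : J -> V) s f : uniq s -> fcover s f ->
  lincomb v f = \sum_(j <- s) finsupp_fun f j *: v j.
Proof.
move=> us sf; rewrite /lincomb (@fsbigE _ _ _ {classic J} _ s) //.
  by apply: eq_bigl => j; exact: in_setT.
by move=> j _ js; rewrite sf // scale0r.
Qed.

Lemma finsupp_eqP (J : Type) (f g : finsupp R J) :
  finsupp_fun f =1 finsupp_fun g -> f = g.
Proof. by move=> fg; apply: val_inj; apply/funext => j; exact: fg. Qed.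

Lemma finsuppP (J : Type) (s : seq {classic J}) (c : J -> R) :
  (forall j, (j : {classic J}) \notin s -> c j = 0) ->
  exists2 f : finsupp R J, fcover s f & finsupp_fun f =1 c.
Proof.
move=> cs; have fin : @is_finsupp R J c.
  apply: (@sub_finite_set {classic J} _ [set` s]); last exact: finite_seq.
  by move=> j /= /eqP cj; apply: contrapT => /negP js; apply/cj/cs.
have e : finsupp_fun (SigSub (mem_set fin)) =1 c.
  by move=> j; rewrite /finsupp_fun set_valE.
by exists (SigSub (mem_set fin)) => // j js; rewrite e cs.
Qed.

Lemma lincombP (J : Type) (v : J -> V) a f g :
  lincomb v (a *: f + g) = a *: lincomb v f + lincomb v g.
Proof.
have [s [us sf sg]] := fcover2_ex f g.
have sfg : fcover s (a *: f + g).
  move=> j js; rewrite -[LHS]/(a * finsupp_fun f j + finsupp_fun g j).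
  by rewrite sf // sg // mulr0 addr0.
rewrite !(lincombE v us) // scaler_sumr -big_split /=; apply: eq_bigr => j _.
rewrite -[finsupp_fun (_ + _) j]/(a * finsupp_fun f j + finsupp_fun g j).
by rewrite scalerDl scalerA.
Qed.

Lemma lincomb0 (J : Type) (v : J -> V) : lincomb v 0 = 0.
Proof. by have := lincombP v (-1) 0 0; rewrite scaler0 addr0 scaleN1r addNr. Qed.

Lemma lincombB (J : Type) (v : J -> V) f g :
  lincomb v (f - g) = lincomb v f - lincomb v g.
Proof.
by have := lincombP v (-1) g f; rewrite !scaleN1r addrC => ->; rewrite addrC.
Qed.

Lemma free_inj (J : Type) (v : J -> V) :
  relations v = [set 0] -> injective (lincomb v).
Proof.
move=> v0 f g fg; apply/eqP; rewrite -subr_eq0; apply/eqP.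
have : relations v (f - g) by rewrite /relations /= lincombB fg subrr.
by rewrite v0.
Qed.

Lemma inj_free (J : Type) (v : J -> V) :
  (forall f, lincomb v f = 0 -> f = 0) -> relations v = [set 0].
Proof.
move=> inj; apply/seteqP; split=> [f /inj|f ->] //.
exact: lincomb0.
Qed.

Lemma funitP (J : Type) (j : J) : exists f : finsupp R J,
  finsupp_fun f =1 (fun k => ((k : {classic J}) == j)%:R) /\
  forall v : J -> V, lincomb v f = v j.
Proof.
have [k|f cf fE] := @finsuppP J [:: j : {classic J}]
    (fun k => ((k : {classic J}) == j)%:R).
  by rewrite inE => /negPf ->.
exists f; split => // v; rewrite (lincombE v _ cf) // big_seq1 fE eqxx.
by rewrite scale1r.
Qed.

End FinitelySupported.

Section LinearMaps.
Local Open Scope ring_scope.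
Variables (R : pzRingType).

Definition linmap (V W : lmodType R) (S : V -> W) : Prop :=
  forall a x y, S (a *: x + y) = a *: S x + S y.

Variables (V W : lmodType R) (S : V -> W).
Hypothesis S_lin : linmap S.

Lemma linmap0 : S 0 = 0.
Proof. by have := S_lin (-1) 0 0; rewrite scaler0 addr0 scaleN1r addNr. Qed.

Lemma linmapD x y : S (x + y) = S x + S y.
Proof. by have := S_lin 1 x y; rewrite !scale1r. Qed.

Lemma linmapB x y : S (x - y) = S x - S y.
Proof.
by have := S_lin (-1) y x; rewrite !scaleN1r addrC => ->; rewrite addrC.
Qed.

Lemma linmap_lincomb (J : Type) (v : J -> V) f :
  S (lincomb v f) = lincomb (S \o v) f.
Proof.
have [s us sf] := fcover_ex f; rewrite !(lincombE _ us sf).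
elim/big_rec2: _ => [|j x y _ <-]; first exact: linmap0.
exact: S_lin.
Qed.

End LinearMaps.

Section Bases.
Local Open Scope ring_scope.
Variables (R : pzRingType).
Hypothesis R_div : forall a : R, a != 0 -> exists b, b * a = 1.

Definition submod (V : lmodType R) (U : set V) : Prop :=
  U 0 /\ forall a x y, U x -> U y -> U (a *: x + y).

Lemma submod_sum (V : lmodType R) (U : set V) (J : eqType) (s : seq J)
    (c : J -> R) (v : J -> V) :
  submod U -> (forall j, j \in s -> U (v j)) -> U (\sum_(j <- s) c j *: v j).
Proof.
move=> [U0 UD]; elim: s => [|j s IH] Uv; first by rewrite big_nil.
rewrite big_cons; apply: UD; first by apply: Uv; rewrite mem_head.
by apply: IH => k ks; apply: Uv; rewrite inE ks orbT.
Qed.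

Lemma lin_span_submod (V : lmodType R) (J : Type) (v : J -> V) :
  submod (lin_span v).
Proof.
split; first by exists 0 => //; exact: lincomb0.
by move=> a _ _ [f _ <-] [g _ <-]; exists (a *: f + g) => //; exact: lincombP.
Qed.

(** Zorn's lemma for linearly independent subsets of U.  A vector outside a
    maximal one occurs in a relation, where its coefficient is nonzero and can be
    inverted. *)
Lemma basis_exists (V : lmodType R) (U : set V) : submod U ->
  exists J : Type, exists v : J -> V, is_basis v U.
Proof.
move=> subU; pose indep (X : set V) := X `<=` U /\
  forall (s : seq V) (c : V -> R), uniq s -> (forall x, x \in s -> X x) ->
  \sum_(x <- s) c x *: x = 0 -> forall x, x \in s -> c x = 0.
have [F Find Ftot|X [[XU Xfree] Xmax]] := @Zorn_bigcup V indep.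
  split; first by move=> x [Y FY Yx]; exact: (proj1 (Find _ FY)).
  move=> s c us sF s0 x xs.
  have [Y FY sY] : exists2 Y, F Y & forall y, y \in s -> Y y.
    have : s != [::] by case: s xs {us sF s0}.
    elim: s sF {us s0 xs} => // y s IH sF _.
    have [Y FY Yy] := sF y (mem_head _ _).
    have [s0|s0] := eqVneq s [::].
      by exists Y => // z; rewrite s0 inE => /eqP ->.
    have [|Z FZ sZ] := IH _ s0; first by move=> z zs; apply: sF; rewrite inE zs orbT.
    have [YZ|ZY] := Ftot _ _ FY FZ.
      by exists Z => // z; rewrite inE => /orP[/eqP ->|/sZ //]; exact: YZ.
    by exists Y => // z; rewrite inE => /orP[/eqP -> //|/sZ]; exact: ZY.
  exact: (proj2 (Find _ FY)) s0 x xs.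
pose J := {x | X x}; pose w (j : J) := sval j.
have winj : injective (w : {classic J} -> V).
  by move=> [x Xx] [y Xy] /= xy; exact: eq_exist.
exists J, w; split.
  apply: inj_free => f f0; have [s us sf] := fcover_ex f.
  apply: finsupp_eqP => j.
  have [js|/sf -> //] := boolP ((j : {classic J}) \in s).
  pose c x := if pselect (X x) is left Xx then finsupp_fun f (exist _ x Xx) else 0.
  have cE k : c (w k) = finsupp_fun f k.
    rewrite /c; case: pselect => [Xk|]; last by case: k.
    by congr finsupp_fun; exact: winj.
  rewrite -[LHS]cE; apply: (Xfree (map w s) c).
  - by rewrite (map_inj_uniq winj s).
  - by move=> x /(@mapP {classic J} _ w)[k _ ->]; exact: (svalP k).
  - rewrite big_map -[RHS]f0 (lincombE w us sf).
    by apply: eq_bigr => k _; rewrite cE.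
  - exact: (map_f (T1 := {classic J})).
apply/seteqP; split.
  move=> _ [f _ <-]; have [s us sf] := fcover_ex f; rewrite (lincombE w us sf).
  by apply: submod_sum => // -[x Xx] _; exact: XU.
move=> x Ux; have span_X y : X y -> lin_span w y.
  move=> Xy; have [f [_ fE]] := @funitP R V J (exist _ y Xy).
  by exists f => //; rewrite fE.
have [/span_X //|nXx] := pselect (X x).
have : ~ indep (X `|` [set x]).
  apply: Xmax; split; first by move=> y; left.
  by move=> /(_ x (or_intror erefl)).
move=> /not_andP[[]|]; first by move=> y [/XU|->].
move=> /existsNP[s /existsNP[c /not_implyP[us /not_implyP[sX]]]].
move=> /not_implyP[s0 /existsNP[y /not_implyP[ys cy]]].
have xs : x \in s.
  apply: contrapT => /negP xs; apply: cy; apply: (Xfree s c us) => // z zs.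
  by have [//|zx] := sX z zs; move: xs; rewrite -zx zs.
have remX z : z \in rem x s -> X z.
  by rewrite mem_rem_uniq // inE => /andP[/eqP zx /sX[]].
move: s0; rewrite (big_rem x) //=; set r := \sum_(_ <- _) _ => s0.
have cx : c x != 0.
  apply/eqP => cx; apply: cy.
  have [-> //|yx] := eqVneq y x.
  apply: (Xfree (rem x s) c) => //; first exact: rem_uniq.
    by move: s0; rewrite cx scale0r add0r.
  by rewrite mem_rem_uniq // inE yx.
have [b bc] := R_div cx.
have -> : x = (- b) *: r + 0.
  rewrite addr0 scaleNr -scalerN; move/eqP: s0; rewrite addr_eq0 => /eqP <-.
  by rewrite scalerA bc scale1r.
apply: (proj2 (lin_span_submod w)); last exact: (proj1 (lin_span_submod w)).
apply: submod_sum; first exact: lin_span_submod.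
by move=> z /remX; exact: span_X.
Qed.

Definition sumfam (V : lmodType R) (J0 J1 : Type) (a : J0 -> V) (s : J1 -> V)
    (j : J0 + J1) : V := match j with inl k => a k | inr k => s k end.

Lemma sumfam_lincomb (V : lmodType R) (J0 J1 : Type) (a : J0 -> V)
    (s : J1 -> V) (f : finsupp R (J0 + J1)) (f0 : finsupp R J0) (f1 : finsupp R J1) :
  (forall k, finsupp_fun f (inl k) = finsupp_fun f0 k) ->
  (forall k, finsupp_fun f (inr k) = finsupp_fun f1 k) ->
  lincomb (sumfam a s) f = lincomb a f0 + lincomb s f1.
Proof.
move=> fl fr; have [t0 u0 c0] := fcover_ex f0; have [t1 u1 c1] := fcover_ex f1.
pose t : seq {classic J0 + J1} :=
  map (inl : {classic J0} -> {classic J0 + J1}) t0 ++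
  map (inr : {classic J1} -> {classic J0 + J1}) t1.
have ut : uniq t.
  rewrite cat_uniq !map_inj_uniq; [|by move=> ? ? []|by move=> ? ? []].
  rewrite u0 u1 andbT /=; apply/hasPn => _ /mapP[k _ ->].
  by apply/negP => /mapP[].
have ct : fcover t f.
  move=> [k|k]; rewrite mem_cat negb_or => /andP[h0 h1].
    rewrite fl; apply: c0; apply: contra h0 => kt.
    exact: (map_f (inl : {classic J0} -> {classic J0 + J1})).
  rewrite fr; apply: c1; apply: contra h1 => kt.
  exact: (map_f (inr : {classic J1} -> {classic J0 + J1})).
rewrite (lincombE _ ut ct) (lincombE _ u0 c0) (lincombE _ u1 c1) big_cat !big_map.
by congr (_ + _); apply: eq_bigr => k _; rewrite ?fl ?fr.
Qed.

Lemma finsupp_split (J0 J1 : Type) (f : finsupp R (J0 + J1)) :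
  exists (f0 : finsupp R J0) (f1 : finsupp R J1),
  (forall k, finsupp_fun f (inl k) = finsupp_fun f0 k) /\
  (forall k, finsupp_fun f (inr k) = finsupp_fun f1 k).
Proof.
have [t _ tf] := fcover_ex f.
pose t0 : seq {classic J0} :=
  pmap (fun j : {classic J0 + J1} => if j is inl k then Some k else None) t.
pose t1 : seq {classic J1} :=
  pmap (fun j : {classic J0 + J1} => if j is inr k then Some k else None) t.
have [k kt|f0 _ f0E] := @finsuppP R J0 t0 (fun k => finsupp_fun f (inl k)).
  apply: tf; apply: contra kt => kt; rewrite mem_pmap; apply/mapP.
  by exists (inl k).
have [k kt|f1 _ f1E] := @finsuppP R J1 t1 (fun k => finsupp_fun f (inr k)).
  apply: tf; apply: contra kt => kt; rewrite mem_pmap; apply/mapP.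
  by exists (inr k).
by exists f0, f1; split => k; rewrite ?f0E ?f1E.
Qed.

Lemma finsupp_join (J0 J1 : Type) (f0 : finsupp R J0) (f1 : finsupp R J1) :
  exists f : finsupp R (J0 + J1),
  (forall k, finsupp_fun f (inl k) = finsupp_fun f0 k) /\
  (forall k, finsupp_fun f (inr k) = finsupp_fun f1 k).
Proof.
have [t0 _ c0] := fcover_ex f0; have [t1 _ c1] := fcover_ex f1.
pose t : seq {classic J0 + J1} :=
  map (inl : {classic J0} -> {classic J0 + J1}) t0 ++
  map (inr : {classic J1} -> {classic J0 + J1}) t1.
have [|f _ fE] := @finsuppP R (J0 + J1) t
    (fun j => match j with inl k => finsupp_fun f0 k | inr k => finsupp_fun f1 k end).
  move=> [k|k]; rewrite mem_cat negb_or => /andP[h0 h1].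
    apply: c0; apply: contra h0 => kt.
    exact: (map_f (inl : {classic J0} -> {classic J0 + J1})).
  apply: c1; apply: contra h1 => kt.
  exact: (map_f (inr : {classic J1} -> {classic J0 + J1})).
by exists f; split => k; rewrite fE.
Qed.

(** Rank-nullity: a basis of the kernel and lifts of a basis of the image. *)
Lemma sumfam_basis (V W : lmodType R) (S : V -> W) (J0 J1 : Type)
    (a : J0 -> V) (c : J1 -> W) (s : J1 -> V) :
  linmap S -> is_basis a [set x | S x = 0] -> is_basis c (range S) ->
  (forall k, S (s k) = c k) -> is_basis (sumfam a s) setT.
Proof.
move=> S_lin [afree aspan] [cfree cspan] sc.
have Sa f : S (lincomb a f) = 0.
  suff : [set x | S x = 0] (lincomb a f) by [].
  by rewrite -aspan; exists f.
have Ss f : S (lincomb s f) = lincomb c f.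
  rewrite (linmap_lincomb S_lin); congr (lincomb _ f).
  by apply/funext => k; exact: sc.
split.
  apply: inj_free => f; have [f0 [f1 [fl fr]]] := finsupp_split f.
  rewrite (sumfam_lincomb a s fl fr) => e.
  have f10 : f1 = 0.
    apply: (free_inj cfree); rewrite lincomb0 -Ss -[LHS]add0r -(Sa f0).
    by rewrite -(linmapD S_lin) e (linmap0 S_lin).
  have f00 : f0 = 0.
    by apply: (free_inj afree); move: e; rewrite f10 !lincomb0 addr0.
  by apply: finsupp_eqP => -[k|k]; rewrite ?fl ?fr ?f00 ?f10.
apply/seteqP; split => // x _.
have [f1 _ f1E] : lin_span c (S x) by rewrite cspan; exists x.
have [f0 _ f0E] : lin_span a (x - lincomb s f1).
  by rewrite aspan /= (linmapB S_lin) Ss f1E subrr.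
have [f [fl fr]] := finsupp_join f0 f1.
by exists f => //; rewrite (sumfam_lincomb a s fl fr) f0E subrK.
Qed.

Lemma range_submod (V W : lmodType R) (S : V -> W) : linmap S -> submod (range S).
Proof.
move=> S_lin; split; first by exists 0 => //; exact: linmap0.
by move=> r _ _ [x _ <-] [y _ <-]; exists (r *: x + y).
Qed.

Lemma kernel_submod (V W : lmodType R) (S : V -> W) :
  linmap S -> submod [set x | S x = 0].
Proof.
move=> S_lin; split=> [|r x y /= Sx Sy]; first exact: linmap0.
by rewrite S_lin Sx Sy scaler0 addr0.
Qed.

(** Two linear maps S and T to W with the same image and with kernels of the
    same dimension differ by an isomorphism L of their sources: send a basis
    adapted to T to one adapted to S.  Here T is the map with values v j at the
    unit vectors, and phi j is the image under L of the j-th unit vector. *)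
Lemma basis_lift (V W : lmodType R) (S : V -> W) (J : Type) (v : J -> W) :
  linmap S -> lin_span v = range S -> eq_dim [set x | S x = 0] (relations v) ->
  exists phi : J -> V, is_basis phi setT /\ forall j, S (phi j) = v j.
Proof.
move=> S_lin vS [J0 [a [b [aB bB]]]].
pose T : finsupp R J -> W := lincomb v.
have T_lin : linmap T by exact: lincombP.
have [J1 [c cB]] := basis_exists (range_submod S_lin).
have s_ex k : exists x, S x = c k.
  have : range S (c k).
    rewrite -(proj2 cB); have [f [_ fE]] := funitP W k.
    by exists f => //; rewrite fE.
  by move=> [x _ <-]; exists x.
have t_ex k : exists f, T f = c k.
  have : range T (c k) by rewrite -[range T]/(lin_span v) vS; have [x <-] := s_ex k; exists x.
  by move=> [x _ <-]; exists x.
have [s sc] := choice s_ex; have [t tc] := choice t_ex.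
have [Bfree Bspan] := sumfam_basis S_lin aB cB sc.
have [B'free B'span] : is_basis (sumfam b t) setT.
  by apply: (sumfam_basis T_lin) tc => //; rewrite -[range T]/(lin_span v) vS.
have coord_ex x : exists f, lincomb (sumfam b t) f = x.
  have : [set: finsupp R J] x by [].
  by rewrite -B'span => -[f _ <-]; exists f.
have [coord coordE] := choice coord_ex.
have coord_lin : linmap coord.
  by move=> r x y; apply: (free_inj B'free); rewrite lincombP !coordE.
(* [coord] takes coordinates in the basis adapted to T; the values of S on the
   basis adapted to S are those of T, index by index in J0 + J1. *)
pose L x := lincomb (sumfam a s) (coord x).
have L_lin : linmap L.
  by move=> r x y; rewrite /L coord_lin lincombP.
have SL x : S (L x) = T x.
  rewrite /L -[in RHS](coordE x) (linmap_lincomb S_lin) (linmap_lincomb T_lin).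
  congr (lincomb _ (coord x)); apply/funext => -[k|k] /=; last by rewrite sc tc.
  have inspan (V' : lmodType R) (w : J0 -> V') : lin_span w (w k).
    by have [f [_ fE]] := funitP V' k; exists f => //; rewrite fE.
  have : relations v (b k) by rewrite -(proj2 bB); exact: inspan.
  move=> /= Tb; have : [set x | S x = 0] (a k) by rewrite -(proj2 aB); exact: inspan.
  by move=> /= ->; rewrite [RHS]Tb.
have e_ex j : exists f : finsupp R J,
    (finsupp_fun f =1 (fun k => ((k : {classic J}) == j)%:R)) /\ T f = v j.
  by have [f [fe fE]] := funitP W j; exists f; split => //; exact: fE.
have [e eP] := choice e_ex.
have eE f : lincomb e f = f.
  have [u uu uf] := fcover_ex f; apply: finsupp_eqP => k; rewrite (lincombE _ uu uf).
  have -> : finsupp_fun (\sum_(j <- u) finsupp_fun f j *: e j) k =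
      \sum_(j <- u) finsupp_fun f j * finsupp_fun (e j) k.
    by elim/big_rec2: _ => // j x y _ <-.
  have [ku|ku] := boolP ((k : {classic J}) \in u).
    rewrite (big_rem (k : {classic J})) //= (proj1 (eP k)) eqxx mulr1.
    rewrite big_seq big1 ?addr0 // => j; rewrite mem_rem_uniq // inE => /andP[jk _].
    by rewrite (proj1 (eP j)) eq_sym (negPf jk) mulr0.
  rewrite uf // big_seq big1 // => j ju.
  rewrite (proj1 (eP j)) (_ : _ == _ = false) ?mulr0 //.
  by apply/negbTE; apply: contraNneq ku => ->.
have phiE f : lincomb (L \o e) f = L f by rewrite -(linmap_lincomb L_lin) eE.
exists (L \o e); split; last by move=> j /=; rewrite SL (proj2 (eP j)).
split.
  apply: inj_free => f; rewrite phiE => Lf.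
  have c0 : coord f = 0 by apply: (free_inj Bfree); rewrite lincomb0.
  by rewrite -(coordE f) c0 lincomb0.
apply/seteqP; split => // x _.
have [g _ gE] : lin_span (sumfam a s) x by rewrite Bspan.
exists (lincomb (sumfam b t) g) => //; rewrite phiE /L -gE; congr lincomb.
by apply: (free_inj B'free); rewrite coordE.
Qed.

Lemma basis_image (V W : lmodType R) (S : V -> W) (J : Type) (phi : J -> V) :
  linmap S -> is_basis phi setT ->
  lin_span (S \o phi) = range S /\
  eq_dim [set x | S x = 0] (relations (S \o phi)).
Proof.
move=> S_lin [pfree pspan].
have pE x : exists f, lincomb phi f = x.
  have : [set: V] x by [].
  by rewrite -pspan => -[f _ <-]; exists f.
have SE f : lincomb (S \o phi) f = S (lincomb phi f).
  by rewrite (linmap_lincomb S_lin).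
split.
  apply/seteqP; split=> [_ [f _ <-]|_ [x _ <-]].
    by rewrite SE; exists (lincomb phi f).
  by have [f <-] := pE x; exists f; rewrite ?SE.
have [J0 [a aB]] := basis_exists (kernel_submod S_lin); have [afree aspan] := aB.
have [b bE] := choice (fun k => pE (a k)).
exists J0, a, b; split => //.
have abE f : lincomb phi (lincomb b f) = lincomb a f.
  rewrite (linmap_lincomb (S := lincomb phi)); last exact: lincombP.
  by congr (lincomb _ f); apply/funext => k; exact: bE.
split.
  apply: inj_free => f f0; apply: (free_inj afree).
  by rewrite lincomb0 -abE f0 lincomb0.
apply/seteqP; split => [_ [f _ <-]|x] /=.
  rewrite /relations /= SE abE; suff : [set x | S x = 0] (lincomb a f) by [].
  by rewrite -aspan; exists f.
rewrite /relations /= SE => Sx.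
have [f _ fE] : lin_span a (lincomb phi x) by rewrite aspan.
by exists f => //; apply: (free_inj pfree); rewrite abE.
Qed.

End Bases.

(** * Simple modules as kernels *)

Lemma GhomE (G : topGroupType) (B A : gmodType G) (f : B -> A) (hf : is_ghom f) :
  ghom_fun (Ghom hf) = f.
Proof. by rewrite /ghom_fun set_valE. Qed.

Section SimpleModules.
Local Open Scope ring_scope.
Variables (G : topGroupType) (A : simpleModule G).

Lemma simple_continuous (X : topologicalType) (f : A -> X) : continuous f.
Proof. by apply/continuousP => U _; exact: smod_discrete. Qed.

Lemma is_ghom_simple (B : gmodType G) (f : A -> B) :
  (forall x y, f (x + y) = f x + f y) ->
  (forall g x, f (gact g x) = gact g (f x)) -> is_ghom f.
Proof. by move=> fD fJ; split => //; exact: simple_continuous. Qed.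

(** Schur: the kernel and the image of a are submodules of a simple module. *)
Lemma gend_div (a : gend A) : a != 0 -> exists b : gend A, b * a = 1.
Proof.
move=> a0; have aB (x y : A) : ghom_fun a (x - y) = ghom_fun a x - ghom_fun a y.
  by rewrite ghomD ghomN.
have [|||a1|aT] := @smod_simple G A [set x | ghom_fun a x = 0].
- exact: ghom0.
- by move=> x y /= ax ay; rewrite aB ax ay subrr.
- by move=> g x /= ax; rewrite ghom_act ax gact0.
- have [|||i0|iT] := @smod_simple G A (range (ghom_fun a)).
  + by exists 0 => //; exact: ghom0.
  + by move=> _ _ [x _ <-] [y _ <-]; exists (x - y).
  + by move=> g _ [x _ <-]; exists (gact g x) => //; rewrite ghom_act.
  + case/eqP: a0; apply: ghom_eqP => x.
    suff : [set (0 : A)] (ghom_fun a x) by [].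
    by rewrite -i0; exists x.
  have b_ex y : exists x, ghom_fun a x = y.
    by have : [set: A] y by []; rewrite -iT => -[x _ <-]; exists x.
  have [b bK] := choice b_ex.
  have ainj x y : ghom_fun a x = ghom_fun a y -> x = y.
    move=> xy; apply/eqP; rewrite -subr_eq0; apply/eqP.
    suff : [set (0 : A)] (x - y) by [].
    by rewrite -a1 /= aB xy subrr.
  have bh : is_ghom b.
    apply: is_ghom_simple => [x y|g x]; apply: ainj.
      by rewrite bK ghomD !bK.
    by rewrite bK ghom_act bK.
  exists (Ghom bh); apply: ghom_eqP => x; apply: ainj.
  by rewrite -[RHS]bK; congr (ghom_fun a); rewrite [ghom_fun _ _]/(ghom_fun (Ghom bh) _) GhomE.
case/eqP: a0; apply: ghom_eqP => x.
suff : [set x | ghom_fun a x = 0] x by [].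
by rewrite aT.
Qed.

Lemma gend_neq0 : (1 : gend A) != 0.
Proof.
apply/eqP => e; have [a /eqP[]] := smod_neq0 A.
by have := congr1 (fun f : gend A => ghom_fun f a) e.
Qed.

End SimpleModules.

Lemma finite_hausdorff_continuous (X Y : topologicalType) (f : X -> Y) :
  hausdorff_space X -> finite_set [set: X] -> continuous f.
Proof.
move=> /hausdorff_accessible/accessible_finite_set_closed cl fin.
by apply/continuous_closedP => C _; apply: cl; exact: sub_finite_set fin.
Qed.

Section KernelValues.
Local Open Scope ring_scope.
Variables (E G : profGroupType) (p : epi E G).

(** A function on the kernel module, as a function on E vanishing elsewhere. *)
Definition extend_ker (ab : abelian_ker p) (A : gmodType G) (f : kmod ab -> A) (x : E) : A :=
  if pselect (p x = 1%g) is left px then f (Kmod ab px) else 0.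

Lemma extend_kerE (ab : abelian_ker p) (A : gmodType G) (f : kmod ab -> A) x
    (px : p x = 1%g) : extend_ker f x = f (Kmod ab px).
Proof.
rewrite /extend_ker; case: pselect => // px'.
by congr f; apply: kval_inj; rewrite !KmodK.
Qed.

Lemma extend_ker_kval (ab : abelian_ker p) (A : gmodType G) (f : kmod ab -> A) b :
  extend_ker f (kval b) = f b.
Proof. by rewrite (extend_kerE _ (kvalP b)); congr f; apply: kval_inj; rewrite KmodK. Qed.

Lemma extend_ker_kerhom (ab : abelian_ker p) (A : gmodType G) (f : ghom (kmod ab) A) :
  kerhom p (extend_ker f).
Proof.
split=> [x y px py|h x px].
  rewrite (extend_kerE _ (kerM px py)) (extend_kerE _ px) (extend_kerE _ py) -ghomD.
  by congr (ghom_fun f); apply: kval_inj; rewrite !KmodK.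
rewrite (extend_kerE _ (kerJ h px)) (extend_kerE _ px) -ghom_act.
by congr (ghom_fun f); apply: kval_inj; rewrite kactE !KmodK.
Qed.

(** The isomorphism ker p -> A contained in k. *)
Definition kerval (A : gmodType G) (k : kiso p A) : E -> A := extend_ker (kiso_hom k).

Variable A : gmodType G.

Lemma kerval_kerhom (k : kiso p A) : kerhom p (kerval k).
Proof. exact: extend_ker_kerhom. Qed.

Lemma kerval_inj (k : kiso p A) x : p x = 1%g -> kerval k x = 0 -> x = 1%g.
Proof.
move=> px; rewrite /kerval (extend_kerE _ px) => kx.
have [k' [kK _]] := kiso_iso k.
have : Kmod (kiso_abelian k) px = 0 by rewrite -[LHS]kK kx ghom0.
by move/(congr1 (@kval _ _ _ _)); rewrite !KmodK.
Qed.

Lemma kerval_surj (k : kiso p A) a : exists x, p x = 1%g /\ kerval k x = a.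
Proof.
have [k' [_ kK]] := kiso_iso k.
by exists (kval (k' a)); rewrite kvalP; split=> //; rewrite /kerval extend_ker_kval kK.
Qed.

(** The endomorphism is u precomposed with the inverse of k.  The continuity
    hypothesis on A holds for discrete modules. *)
Lemma kerhom_gend (k : kiso p A) (u : E -> A) : kerhom p u ->
  (forall f : A -> A, continuous f) ->
  exists a : gend A, forall x, p x = 1%g -> u x = ghom_fun a (kerval k x).
Proof.
move=> uh cont; have [k' [kK k'K]] := kiso_iso k.
have ah : is_ghom (fun a => u (kval (k' a))).
  split=> [x y|g x|]; last exact: cont.
    by rewrite ghomD KmodK (proj1 uh) //; exact: kvalP.
  have [h <-] := epi_surj p g.
  by rewrite ghom_act kactE (proj2 uh) //; exact: kvalP.
exists (Ghom ah) => x px; rewrite /kerval GhomE (extend_kerE _ px).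
by rewrite kK KmodK.
Qed.

End KernelValues.

Section KernelsAndSimpleModules.
Local Open Scope ring_scope.
Variables (E G : profGroupType) (p : epi E G) (A : simpleModule G).

(** An embedding of the kernel in a finite simple module is an isomorphism of
    modules; commutativity of the kernel and continuity come for free. *)
Lemma kiso_of (u : E -> A) : kerhom p u ->
  (forall x, p x = 1%g -> u x = 0 -> x = 1%g) ->
  (exists x, p x = 1%g /\ u x <> 0) ->
  exists k : kiso p A, forall x, p x = 1%g -> kerval k x = u x.
Proof.
move=> uh uinj [x0 [px0 ux0]]; have [uD uJ] := uh.
have uinj2 x y : p x = 1%g -> p y = 1%g -> u x = u y -> x = y.
  move=> px py xy; apply: (mulIg y^-1%g); rewrite mulgV; apply: uinj.
    by apply: kerM => //; exact: kerV.
  by rewrite uD // ?(kerhomV uh) ?xy ?subrr //; exact: kerV.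
have ab : abelian_ker p.
  move=> x y px py; apply: uinj2; try exact: kerM.
  by rewrite !uD // addrC.
have usurj a : exists x, p x = 1%g /\ u x = a.
  have [|||i0|iT] := @smod_simple G A [set a | exists x, p x = 1%g /\ u x = a].
  - by exists 1%g; split; [exact: epi1 | exact: (kerhom1 uh)].
  - move=> _ _ [x [px <-]] [y [py <-]]; exists (x * y^-1)%g.
    split; first by apply: kerM => //; exact: kerV.
    by rewrite uD ?(kerhomV uh) //; exact: kerV.
  - move=> g _ [x [px <-]]; have [h <-] := epi_surj p g.
    by exists (h * x * h^-1)%g; split; [exact: kerJ | exact: uJ].
  - case: ux0; suff : [set (0 : A)] (u x0) by [].
    by rewrite -i0; exists x0.
  - suff : [set a | exists x, p x = 1%g /\ u x = a] a by [].
    by rewrite iT.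
have cont : continuous (fun b : kmod ab => u (kval b)).
  apply: finite_hausdorff_continuous.
    apply: injective_hausdorff => x y xy; exists E, (@kval _ _ _ ab); split.
    - exact: kval_continuous.
    - exact: profinite_hausdorff.
    - by move=> /kval_inj.
  have [m mP] := choice usurj.
  have -> : [set: kmod ab] = (fun a => Kmod ab (proj1 (mP a))) @` setT.
    apply/seteqP; split => // b _; exists (u (kval b)) => //.
    apply: kval_inj; rewrite KmodK; have [pm um] := mP (u (kval b)).
    by apply: uinj2 => //; exact: kvalP.
  by apply: finite_image; exact: smod_finite.
have fh : is_ghom (fun b : kmod ab => u (kval b)).
  split => // [x y|g x]; first by rewrite KmodK uD //; exact: kvalP.
  have [h <-] := epi_surj p g.
  by rewrite [gact _ x]/(kact _ x) kactE uJ //; exact: kvalP.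
have [b bK] : exists b : A -> kmod ab, forall a, u (kval (b a)) = a.
  have [m mP] := choice usurj; exists (fun a => Kmod ab (proj1 (mP a))) => a.
  by rewrite KmodK; case: (mP a).
have binj (x y : kmod ab) : u (kval x) = u (kval y) -> x = y.
  by move=> xy; apply/kval_inj/uinj2 => //; exact: kvalP.
have bh : is_ghom b.
  apply: is_ghom_simple => [x y|g x]; apply: binj; rewrite bK.
    by rewrite KmodK uD ?bK //; exact: kvalP.
  have [h <-] := epi_surj p g.
  by rewrite [gact _ (b x)]/(kact _ (b x)) kactE uJ ?bK //; exact: kvalP.
have iso : giso (Ghom fh).
  exists (Ghom bh); split => x; rewrite !GhomE; last exact: bK.
  by apply: binj; rewrite bK.
exists (KIso iso) => x px; rewrite /kerval (extend_kerE _ px) GhomE.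
by rewrite KmodK.
Qed.

Lemma minimal_kiso (u : E -> A) : minimal_ker p -> kerhom p u ->
  (exists x, p x = 1%g /\ u x <> 0) ->
  exists k : kiso p A, forall x, p x = 1%g -> kerval k x = u x.
Proof.
move=> pmin uh [x0 [px0 ux0]]; apply: kiso_of => //; last by exists x0.
have [uD uJ] := uh.
have cl : closed [set x | ker p x /\ u x = 0].
  apply: profinite_finite_closed.
  by apply: sub_finite_set (minimal_ker_finite pmin) => x [].
have [||||M ME] := nset_exists _ _ _ _ cl.
- by split; [exact: epi1 | exact: (kerhom1 uh)].
- move=> x y [px ux] [py uy]; split; first exact: kerM.
  by rewrite uD // ux uy addr0.
- by move=> x [px ux]; split; [exact: kerV | rewrite (kerhomV uh) // ux oppr0].
- move=> x y [px ux]; have -> : (x ^ y = y^-1 * x * y^-1^-1)%g by rewrite /conjg invgK mulgA.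
  split; first exact: kerJ.
  by rewrite uJ // ux gact0.
move=> x px ux; have [|M1|Mfull] := proj2 pmin M.
- by rewrite ME => y [].
- by apply: M1; rewrite ME.
- by have := Mfull x0 px0; rewrite ME => -[_ /ux0].
Qed.

Lemma kiso_minimal (k : kiso p A) : minimal_ker p.
Proof.
have [kD kJ] := kerval_kerhom k; split.
  have [a a0] := smod_neq0 A; have [x [px kx]] := kerval_surj k a.
  exists x; split => // x1; case/eqP: a0; rewrite -kx x1.
  exact: (kerhom1 (kerval_kerhom k)).
move=> M Mp; pose U := [set a | exists x, nset M x /\ kerval k x = a].
have [|||i0|iT] := @smod_simple G A U.
- by exists 1%g; split; [exact: nset1 | exact: (kerhom1 (kerval_kerhom k))].
- move=> _ _ [x [Mx <-]] [y [My <-]]; exists (x * y^-1)%g.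
  split; first by apply: nsetM => //; exact: nsetV.
  rewrite kD ?(kerhomV (kerval_kerhom k)) //; try exact: Mp.
  by apply: kerV; exact: Mp.
- move=> g _ [x [Mx <-]]; have [h <-] := epi_surj p g.
  exists (h * x * h^-1)%g; split; last by rewrite kJ //; exact: Mp.
  by have := nsetJ h^-1%g Mx; rewrite /conjg invgK mulgA.
- left=> x Mx; apply: (kerval_inj (k := k)); first exact: Mp.
  by suff : [set (0 : A)] (kerval k x) by []; rewrite -i0; exists x.
- right=> x px; have [y [My yx]] : U (kerval k x) by rewrite iT.
  suff -> : x = y by [].
  apply: (mulIg y^-1%g); rewrite mulgV; apply: (kerval_inj (k := k)).
    by apply: kerM => //; apply: kerV; exact: Mp.
  rewrite kD ?(kerhomV (kerval_kerhom k)) ?yx ?subrr //; try exact: Mp.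
  by apply: kerV; exact: Mp.
Qed.

Lemma kiso_section (k : kiso p A) : exists2 s : G -> E, continuous s & cancel s p.
Proof.
by apply: finite_ker_section; apply: minimal_ker_finite; exact: kiso_minimal k.
Qed.

End KernelsAndSimpleModules.

(** * The largest A-isotypic quotient of the kernel *)

Lemma quot_lift (H E : topGroupType) (q : epi H E) (N : nsubgroup H) :
  nset N `<=` ker q -> exists q' : epi (quot N) E, forall x, q' (coset N x) = q x.
Proof. by move=> Nq; exists (quot_epi Nq) => x; exact: (quot_fun_coset Nq). Qed.

Section AbelianLayer.
Local Open Scope ring_scope.
Variables (H G : profGroupType) (p : epi H G) (A : simpleModule G).
Local Notation NA := (NA p A).
Local Notation BA := (BA p A).
Local Notation epiA := (epiA p A).

Lemma epiA_coset x : epiA (coset NA x) = p x.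
Proof. exact: quot_fun_coset (@NA_ker _ _ p A) x. Qed.

(** The elements of B_A^* are handled as homomorphisms ker p -> A. *)
Definition pullback (phi : ghom BA A) (x : H) : A :=
  extend_ker (ghom_fun phi : kmod (@epiA_abelian _ _ p A) -> A) (coset NA x).

Lemma pullback_kerhom phi : kerhom p (pullback phi).
Proof.
apply: (@kerhom_comp _ _ epiA A _ (coset_epi NA)); first exact: epiA_coset.
exact: extend_ker_kerhom.
Qed.

Lemma pullback_eq (phi psi : ghom BA A) :
  (forall x, p x = 1%g -> pullback phi x = pullback psi x) -> phi = psi.
Proof.
move=> e; apply: ghom_eqP => b.
have := e (repr (kval b)); rewrite /pullback !cosetK => {}e.
have := e _; rewrite !extend_ker_kval; apply.
by rewrite -epiA_coset cosetK; exact: kvalP.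
Qed.

Section FromQuotient.
Variables (E : profGroupType) (eta : epi E G) (q : epi H E) (k : kiso eta A).
Hypothesis etaq : forall h, eta (q h) = p h.

Lemma kerq_ker : nset (kerN q) `<=` ker p.
Proof. by move=> x qx; rewrite /ker /= -etaq (qx : q x = 1%g) epi1. Qed.

(** H / ker q and E are isomorphic over G, so that ker q is one of the subgroups
    whose intersection defines the isotypic quotient. *)
Lemma quot_kiso : exists k' : kiso (quot_epi kerq_ker) A,
  forall x, p x = 1%g -> kerval k' (coset (kerN q) x) = kerval k (q x).
Proof.
have [q' q'E] := quot_lift (N := kerN q) (q := q) (fun x qx => qx).
have qE x : eta (q' x) = quot_epi kerq_ker x.
  by rewrite -(cosetK x) q'E etaq [RHS](quot_fun_coset kerq_ker).
have qkE x : quot_epi kerq_ker (coset (kerN q) x) = p x.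
  exact: (quot_fun_coset kerq_ker).
have [||| k' k'E] := @kiso_of (quot (kerN q)) G (quot_epi kerq_ker) A (kerval k \o q').
- by apply: (@kerhom_comp _ _ eta A _ q') => //; exact: kerval_kerhom.
- move=> x; rewrite -(cosetK x) qkE /= q'E => px /kerval_inj kx.
  by apply/esym/coset_eq; rewrite invg1 mul1g; apply: kx; rewrite etaq.
- have [a /eqP a0] := smod_neq0 A; have [y [ey ky]] := kerval_surj k a.
  have [x xy] := epi_surj q y; exists (coset (kerN q) x).
  by rewrite qkE -etaq xy ey /= q'E xy ky.
exists k' => x px; rewrite k'E /= ?q'E //.
exact: etrans (qkE x) px.
Qed.

Lemma NA_kerq : nset NA `<=` ker q.
Proof.
have [k' _] := quot_kiso.
by move=> x [_ /(_ (kerN q))]; apply; exists kerq_ker; exists.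
Qed.

(** Quotients of H with kernel A over G give elements of B_A^*; conversely,
    [pullback_kernel] recovers such a quotient from a nonzero element. *)
Lemma BA_ghom_exists : exists phi : ghom BA A,
  forall x, p x = 1%g -> pullback phi x = kerval k (q x).
Proof.
have [q' q'E] := quot_lift NA_kerq.
have qE x : eta (q' x) = epiA x by rewrite -(cosetK x) q'E etaq epiA_coset.
have q'K (b : BA) : eta (q' (kval b)) = 1%g by rewrite qE; exact: kvalP.
pose f (b : BA) : A := kiso_hom k (Kmod (kiso_abelian k) (q'K b)).
have kh : kerhom epiA (kerval k \o q') := kerhom_comp qE (kerval_kerhom k).
have kD x y : ker epiA x -> ker epiA y ->
  kerval k (q' (x * y)%g) = kerval k (q' x) + kerval k (q' y) := proj1 kh x y.
have kJ h x : ker epiA x ->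
  kerval k (q' (h * x * h^-1)%g) = gact (epiA h) (kerval k (q' x)) := proj2 kh h x.
have fE b : f b = kerval k (q' (kval b)) by rewrite /kerval (extend_kerE _ (q'K b)).
have fh : is_ghom f.
  split.
  - move=> x y; rewrite !fE KmodK kD //; exact: kvalP.
  - move=> g x; have [h <-] := epi_surj epiA g.
    by rewrite !fE [gact _ x]/(kact _ x) kactE kJ //; exact: kvalP.
  - move=> x; apply: continuous_comp; last exact: ghom_continuous.
    apply: kval_comp_continuous => y.
    have -> : @kval _ _ _ (kiso_abelian k) \o (fun b : BA => Kmod (kiso_abelian k) (q'K b)) =
        q' \o @kval _ _ _ (@epiA_abelian _ _ p A).
      by apply/funext => b /=; rewrite KmodK.
    by apply: continuous_comp; [exact: kval_continuous | exact: epi_continuous].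
exists (Ghom fh) => x px; rewrite /pullback GhomE.
have cx : epiA (coset NA x) = 1%g by rewrite epiA_coset.
by rewrite (extend_kerE _ cx) fE KmodK q'E.
Qed.

End FromQuotient.

Lemma pullback_kernel (phi : ghom BA A) : phi != 0 ->
  exists (N : nsubgroup H) (Np : nset N `<=` ker p) (k : kiso (quot_epi Np) A),
  forall x, p x = 1%g -> kerval k (coset N x) = pullback phi x.
Proof.
move=> phi0; have fh := pullback_kerhom phi; have [fD fJ] := fh.
have cl : closed [set x | ker p x /\ pullback phi x = 0].
  have : open [set b : BA | ghom_fun phi b != 0].
    apply: (@open_comp _ _ (ghom_fun phi) [set a | a != 0]) => [b _|].
      exact: ghom_continuous.
    exact: smod_discrete.
  move=> [O oO OE].
  have OP b : O (kval b) <-> ghom_fun phi b != 0.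
    by have := congr1 (fun S : set BA => S b) OE => /= <-.
  have cx x : ker p x -> epiA (coset NA x) = 1%g by rewrite epiA_coset.
  rewrite (_ : [set x | _] = ker p `&` (coset NA) @^-1` (~` O)).
    apply: closedI; first exact: ker_closed.
    apply: preimage_closed; last exact: open_closedC.
    by move=> x _; exact: coset_continuous.
  have OE' x (px : ker p x) : O (coset NA x) <-> pullback phi x != 0.
    rewrite /pullback (extend_kerE _ (cx x px)) -OP KmodK //.
  apply/seteqP; split => x [px]; rewrite /= => h; split => //.
    by move/(OE' x px)/eqP.
  by apply: contrapT => /eqP/(OE' x px).
have [||||N NE] := nset_exists _ _ _ _ cl.
- by split; [exact: epi1 | exact: (kerhom1 fh)].
- move=> x y [px ux] [py uy]; split; first exact: kerM.
  by rewrite fD // ux uy addr0.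
- by move=> x [px ux]; split; [exact: kerV | rewrite (kerhomV fh) // ux oppr0].
- move=> x y [px ux]; have -> : (x ^ y = y^-1 * x * y^-1^-1)%g by rewrite /conjg invgK mulgA.
  split; first exact: kerJ.
  by rewrite fJ // ux gact0.
have Np : nset N `<=` ker p by rewrite NE => x [].
have qE x : quot_epi Np (coset N x) = p x by exact: (quot_fun_coset Np).
pose u (y : quot N) := pullback phi (repr y).
have uE x : p x = 1%g -> u (coset N x) = pullback phi x.
  move=> px; have := repr_coset N x; rewrite NE => -[pr].
  have pc : p (repr (coset N x)) = 1%g by rewrite -qE cosetK qE.
  rewrite fD //; last exact: kerV.
  by rewrite (kerhomV fh) // addrC => /eqP; rewrite subr_eq0 => /eqP.
have [|||k kE] := @kiso_of _ _ (quot_epi Np) A u.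
- split=> [x y|h x].
    rewrite -(cosetK x) -(cosetK y) -cosetM => px py.
    have {}px : p (repr x) = 1%g by rewrite -qE.
    have {}py : p (repr y) = 1%g by rewrite -qE.
    by rewrite !uE // ?fD // epiM px py mulg1.
  rewrite -(cosetK x) -(cosetK h) => px; have {}px : p (repr x) = 1%g by rewrite -qE.
  have -> : (coset N (repr h) * coset N (repr x) * (coset N (repr h))^-1 =
     coset N (repr h * repr x * (repr h)^-1))%g.
    by rewrite !cosetM -quot_invE.
  by rewrite !uE // ?fJ ?qE //; exact: kerJ.
- move=> x; rewrite -(cosetK x) qE => px; rewrite uE // => ux.
  by apply/esym/coset_eq; rewrite invg1 mul1g NE.
- apply: contrapT => nex; case/eqP: phi0; apply: pullback_eq => x px.
  apply: contrapT => ux; apply: nex; exists (coset N x); rewrite qE uE //.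
  split => //; move: ux; rewrite [in X in _ <> X]/pullback.
  have cx : epiA (coset NA x) = 1%g by rewrite epiA_coset.
  by rewrite (extend_kerE _ cx).
exists N, Np, k => x px; rewrite kE ?uE //.
exact: etrans (qE x) px.
Qed.

End AbelianLayer.

(** * Extension classes *)

Section ExtensionClasses.
Local Open Scope ring_scope.

Lemma CocycleE (G : topGroupType) (A : gmodType G) (c : G * G -> A) (hc : is_cocycle c) :
  cocycle_fun (Cocycle hc) = c.
Proof. by rewrite /cocycle_fun set_valE. Qed.

Lemma kval_add (E G : topGroupType) (p : epi E G) (ab : abelian_ker p) (x y : kmod ab) :
  kval (x + y) = (kval x * kval y)%g.
Proof. exact: KmodK. Qed.

Lemma kval_act (E G : topGroupType) (p : epi E G) (ab : abelian_ker p) h (x : kmod ab) :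
  kval (gact (p h) x) = (h * kval x * h^-1)%g.
Proof. exact: kactE. Qed.

Lemma kval_act_section (E G : topGroupType) (p : epi E G) (ab : abelian_ker p)
    (s : G -> E) g (x : kmod ab) : cancel s p ->
  kval (gact g x) = (s g * kval x * (s g)^-1)%g.
Proof. by move=> sK; rewrite -{1}(sK g) kval_act. Qed.

Lemma Kmod_continuous (X : topologicalType) (E G : topGroupType) (p : epi E G)
    (ab : abelian_ker p) (f : X -> E) (pf : forall x, p (f x) = 1%g) :
  continuous f -> continuous (fun x => Kmod ab (pf x)).
Proof.
move=> fc; apply: kval_comp_continuous.
by have -> : @kval _ _ _ ab \o (fun x => Kmod ab (pf x)) = f
  by apply/funext => x /=; rewrite KmodK.
Qed.

(** The cocycle of a section, with the section that the definition of the class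
    happens to select. *)
Lemma ext_class_spec (E G : topGroupType) (p : epi E G) (ab : abelian_ker p)
    (s : G -> E) : continuous s -> cancel s p ->
  exists s' : G -> E, exists c : cocycle (kmod ab),
    [/\ continuous s', cancel s' p, ext_class ab = H2class c &
        forall a b : G,
          kval (cocycle_fun c (a, b)) = (s' a * s' b * (s' (a * b))^-1)%g].
Proof.
move=> cs sK; suff [x hx] : exists x, @ext_classes _ _ _ ab x.
  exact: (@xgetPex _ 0 (@ext_classes _ _ _ ab)) (ex_intro _ x hx).
have pc (ab' : G * G) : p (s ab'.1 * s ab'.2 * (s (ab'.1 * ab'.2))^-1)%g = 1%g.
  by rewrite !epiM epiV !sK mulgV.
pose c (z : G * G) : kmod ab := Kmod ab (pc z).
have hc : is_cocycle c.
  split.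
    apply: Kmod_continuous.
    apply: (@mulg_comp_continuous _ _ (fun z : G * G => s z.1 * s z.2)%g
        (fun z : G * G => (s (z.1 * z.2))^-1)%g).
      apply: mulg_comp_continuous => z.
        by apply: continuous_comp; [exact: cvg_fst | exact: cs].
      by apply: continuous_comp; [exact: cvg_snd | exact: cs].
    apply: (@invg_comp_continuous _ _ (fun z : G * G => s (z.1 * z.2))%g) => z.
    by apply: continuous_comp; [exact: mulg_continuous | exact: cs].
  move=> r t u.
  have e : gact r (c (t, u)) + c (r, (t * u)%g) = c (r, t) + c ((r * t)%g, u).
    apply: kval_inj; rewrite !kval_add (kval_act_section _ _ sK) !KmodK /=.
    by rewrite !mulgA !mulgVK.
  by rewrite (addrAC (gact _ _)) e addrK subrr.
by exists (H2class (Cocycle hc)), s, (Cocycle hc).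
Qed.

Section Comparison.
Variables (E0 E G : profGroupType) (p : epi E0 G) (ab : abelian_ker p).
Variables (eta : epi E G) (A : gmodType G) (k : kiso eta A).
Variable phi : ghom (kmod ab) A.
Hypothesis p_section : exists2 s : G -> E0, continuous s & cancel s p.
Hypothesis eta_section : exists2 s : G -> E, continuous s & cancel s eta.

(** Two sections differ by a cochain whose coboundary is the difference of
    the two cocycles. *)
Lemma class_of_morphism (q : epi E0 E) : (forall x, eta (q x) = p x) ->
  (forall b : kmod ab, kerval k (q (kval b)) = phi b) ->
  H2_map phi (ext_class ab) = kiso_class k.
Proof.
move=> etaq qphi; have [s s_c sK] := p_section; have [t t_c tK] := eta_section.
rewrite /kiso_class.
have [{s s_c sK}s [c [sc sK -> cE]]] := ext_class_spec ab s_c sK.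
have [{t t_c tK}t [d [tc tK -> dE]]] := ext_class_spec (kiso_abelian k) t_c tK.
rewrite !H2_map_class; apply/H2class_eq/asboolP.
have pD g : eta (q (s g) * (t g)^-1)%g = 1%g by rewrite epiM epiV etaq sK tK mulgV.
pose D g : kmod (kiso_abelian k) := Kmod (kiso_abelian k) (pD g).
exists (kiso_hom k \o D).
  move=> g; apply: continuous_comp; last exact: ghom_continuous.
  apply: Kmod_continuous.
  apply: (@mulg_comp_continuous _ _ (fun g => q (s g)) (fun g => (t g)^-1%g)).
    by move=> h; apply: continuous_comp; [exact: sc | exact: epi_continuous].
  exact: invg_comp_continuous.
move=> g h; rewrite -[LHS]/(cocycle_fun (cocycle_map phi c) (g, h) -
   cocycle_fun (cocycle_map (kiso_hom k) d) (g, h)) !CocycleE /=.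
rewrite -qphi /kerval.
have pc : eta (q (kval (cocycle_fun c (g, h)))) = 1%g by rewrite etaq; exact: kvalP.
rewrite (extend_kerE _ pc) -ghom_act -!ghomN -!ghomD; congr (ghom_fun (kiso_hom k)).
have e : Kmod (kiso_abelian k) pc + D (g * h)%g =
  D g + gact g (D h) + cocycle_fun d (g, h).
  apply: kval_inj; rewrite !kval_add (kval_act_section _ _ tK) !KmodK cE dE !epiM epiV.
  by rewrite !mulgA !mulgVK.
have -> : Kmod (kiso_abelian k) pc =
  D g + gact g (D h) + cocycle_fun d (g, h) - D (g * h)%g by rewrite -e addrK.
by rewrite addrAC addrK -addrA addrC.
Qed.

(** Write an element of E0 as b times s g, with b in the kernel, and send it to
    the element k^-1 (phi b + u g) times t g of E.  This is multiplicative exactly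
    when the coboundary of u is the difference of the two cocycles. *)
Lemma morphism_of_class : H2_map phi (ext_class ab) = kiso_class k ->
  exists q : E0 -> E, [/\ {morph q : x y / (x * y)%g}, continuous q,
    forall x, eta (q x) = p x & forall b : kmod ab, kerval k (q (kval b)) = phi b].
Proof.
have [s s_c sK] := p_section; have [t t_c tK] := eta_section.
rewrite /kiso_class.
have [{s s_c sK}s [c [sc sK -> cE]]] := ext_class_spec ab s_c sK.
have [{t t_c tK}t [d [tc tK -> dE]]] := ext_class_spec (kiso_abelian k) t_c tK.
rewrite !H2_map_class => /H2class_eq/asboolP[u uc uE].
have {}uE g h : phi (cocycle_fun c (g, h)) =
    kiso_hom k (cocycle_fun d (g, h)) + (gact g (u h) - u (g * h)%g + u g).
  rewrite -uE -[X in _ + X]/(cocycle_fun (cocycle_map phi c) (g, h) -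
   cocycle_fun (cocycle_map (kiso_hom k) d) (g, h)) !CocycleE /=.
  by rewrite addrC subrK.
have [k' [kK k'K]] := kiso_iso k.
have pb x : p (x * (s (p x))^-1)%g = 1%g by rewrite epiM epiV sK mulgV.
pose b x : kmod ab := Kmod ab (pb x).
have bM x y : b (x * y)%g = b x + gact (p x) (b y) + cocycle_fun c (p x, p y).
  apply: kval_inj; rewrite !kval_add (kval_act_section _ _ sK) cE !KmodK epiM.
  by rewrite !mulgA !mulgVK.
pose w x := k' (phi (b x) + u (p x)).
have wM x y : w (x * y)%g = w x + gact (p x) (w y) + cocycle_fun d (p x, p y).
  rewrite -[cocycle_fun d _]kK /w -ghom_act -!ghomD; congr (ghom_fun k').
  rewrite bM !ghomD uE ghom_act gactD epiM.
  rewrite -addrA -(addrA (kiso_hom k _)) (addrAC _ (u (p x))) subrK.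
  rewrite (addrC (kiso_hom k _)) addrA; congr (_ + _).
  by rewrite (addrACA _ (u (p x))) (addrC (u (p x))).
pose q x := (kval (w x) * t (p x))%g.
have qM : {morph q : x y / (x * y)%g}.
  move=> x y; rewrite /q wM epiM !kval_add dE (kval_act_section _ _ tK).
  by rewrite !mulgA !mulgVK.
have q1 : q 1%g = 1%g by apply: (mulgI (q 1%g)); rewrite -qM !mulg1.
exists q; split => //.
- apply: mulg_comp_continuous.
    move=> x; apply: continuous_comp; last exact: kval_continuous.
    apply: continuous_comp; last exact: ghom_continuous.
    apply: addr_comp_continuous.
      move=> z; apply: continuous_comp; last exact: ghom_continuous.
      apply: Kmod_continuous.
      apply: (@mulg_comp_continuous _ _ id (fun z => (s (p z))^-1)%g).
        by move=> y; exact: cvg_id.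
      apply: (@invg_comp_continuous _ _ (fun z => s (p z))) => y.
      by apply: continuous_comp; [exact: epi_continuous | exact: sc].
    by move=> z; apply: continuous_comp; [exact: epi_continuous | exact: uc].
  by move=> x; apply: continuous_comp; [exact: epi_continuous | exact: tc].
- by move=> x; rewrite /q epiM tK kvalP mul1g.
move=> x.
(* The section s need not be normalised at 1; q 1 = 1 absorbs the correction. *)
have -> : q (kval x) = kval (k' (phi x)).
  rewrite -[RHS]mulg1 -q1 /q epi1 kvalP mulgA; congr (_ * _)%g.
  rewrite -kval_add; congr kval; rewrite /w -ghomD; congr (ghom_fun k').
  rewrite addrA -ghomD epi1 kvalP; congr (_ + _); congr (ghom_fun phi).
  by apply: kval_inj; rewrite kval_add !KmodK kvalP epi1 mul1g.
by rewrite /kerval extend_ker_kval k'K.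
Qed.

End Comparison.

End ExtensionClasses.

(** * Families of epimorphisms and the dual of an isotypic quotient *)

Lemma lincomb_free (R : pzRingType) (V : lmodType R) (J : Type) (v : J -> V)
    (s : seq {classic J}) (c : J -> R) :
  relations v = [set 0%R] -> uniq s -> (\sum_(j <- s) c j *: v j = 0)%R ->
  forall j, (j : {classic J}) \in s -> c j = 0%R.
Proof.
move=> vfree us s0 j js.
have [i /negPf is_|f cf fE] := @finsuppP R J s
    (fun k => if (k : {classic J}) \in s then c k else 0%R); first by rewrite is_.
have f0 : f = 0%R.
  apply: (free_inj vfree); rewrite lincomb0 -s0 (lincombE v us cf).
  by apply: eq_big_seq => i is_; rewrite fE is_.
by have := fE j; rewrite js f0 => <-.
Qed.

Lemma kerval_inj2 (E G : profGroupType) (p : epi E G) (A : gmodType G)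
    (k : kiso p A) x y :
  p x = 1 -> p y = 1 -> kerval k x = kerval k y -> x = y.
Proof.
move=> px py xy; apply: (mulIg y^-1); rewrite mulgV.
apply: (kerval_inj (k := k)); first by apply: kerM => //; exact: kerV.
rewrite (proj1 (kerval_kerhom k)) //; last exact: kerV.
by rewrite (kerhomV (kerval_kerhom k)) // xy subrr.
Qed.

Section PullbackLinear.
Local Open Scope ring_scope.
Variables (H G : profGroupType) (p : epi H G) (A : simpleModule G).

Lemma pullback_lin (a : gend A) (phi psi : ghom (BA p A) A) x : p x = 1%g ->
  pullback (a *: phi + psi) x = ghom_fun a (pullback phi x) + pullback psi x.
Proof.
move=> px; have cx : epiA p A (coset (NA p A) x) = 1%g by rewrite epiA_coset.
by rewrite /pullback !(extend_kerE _ cx).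
Qed.

Lemma pullback_sum (J : Type) (s : seq J) (a : J -> gend A)
    (phi : J -> ghom (BA p A) A) x : p x = 1%g ->
  pullback (\sum_(j <- s) a j *: phi j) x =
  \sum_(j <- s) ghom_fun (a j) (pullback (phi j) x).
Proof.
move=> px; elim: s => [|j s IH].
  rewrite !big_nil /pullback; have cx : epiA p A (coset (NA p A) x) = 1%g by rewrite epiA_coset.
  by rewrite (extend_kerE _ cx).
by rewrite !big_cons pullback_lin // IH.
Qed.

Lemma SA_lin : linmap (@SA _ _ p A).
Proof.
move=> a phi psi; rewrite /SA -(H2classK (fA p A)) !H2_map_class.
rewrite -[a *: H2class _]/(H2_map _ _) H2_map_class -H2classD; congr H2class.
exact: cocycle_eqP.
Qed.

End PullbackLinear.

Section FamilyModules.
Local Open Scope ring_scope.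
Variables (H G : profGroupType) (p : epi H G) (I : Type).
Variables (K : I -> profGroupType) (eta : forall i, epi (K i) G).
Variable q : forall i, epi H (K i).
Hypothesis etaq : forall i h, eta i (q i h) = p h.
Hypothesis eta_min : forall i, minimal_ker (eta i).
Variables (A : simpleModule G) (phi : I -> ghom (BA p A) A).
Hypothesis phiP : forall i, ker_iso (eta i) A ->
  exists k : kiso (eta i) A, forall x, p x = 1%g -> kerval k (q i x) = pullback (phi i) x.
Local Notation J := {classic I}.

(** A homomorphism ker (eta i) -> A is zero unless ker (eta i) is isomorphic to
    A, and then it is an endomorphism of A applied to the given isomorphism. *)
Lemma coefficients (u : forall i, K i -> A) : (forall i, kerhom (eta i) (u i)) ->
  exists c : I -> gend A, (forall i, ~ ker_iso (eta i) A -> c i = 0) /\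
    forall i x, p x = 1%g -> u i (q i x) = ghom_fun (c i) (pullback (phi i) x).
Proof.
move=> uh; suff c_ex i : exists c : gend A, (~ ker_iso (eta i) A -> c = 0) /\
    forall x, p x = 1%g -> u i (q i x) = ghom_fun c (pullback (phi i) x).
  by have [c cP] := choice c_ex; exists c; split => i; have [] := cP i.
have [ki|nki] := pselect (ker_iso (eta i) A).
  have [k kE] := phiP ki.
  have [a aE] := kerhom_gend k (uh i) (fun f => @simple_continuous _ _ _ f).
  by exists a; split => // x px; rewrite aE ?etaq // kE.
exists 0; split => // x px; rewrite ghom0E; apply: contrapT => ux; apply: nki.
have [|k _] := minimal_kiso (eta_min i) (uh i); last by exists.
by exists (q i x); rewrite etaq.
Qed.

Lemma independent_at j : ker_iso (eta j) A ->
  (forall (F : seq J) (c : I -> gend A), uniq F -> (j : J) \notin F ->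
     (forall i, ~ ker_iso (eta i) A -> c i = 0) ->
     phi j <> \sum_(i <- F) c i *: phi i) ->
  exists B : gmodType G, exists2 f : K j -> B, kerhom (eta j) f &
    forall (F : seq J) (u : forall i, K i -> B), uniq F -> (j : J) \notin F ->
      (forall i, kerhom (eta i) (u i)) ->
      ~ forall x, p x = 1%g -> f (q j x) = \sum_(i <- F) u i (q i x).
Proof.
move=> kj free; have [k kE] := phiP kj; exists A; exists (kerval k).
  exact: kerval_kerhom.
move=> F u uF jF uh e; have [c [c0 cE]] := coefficients uh.
apply: (free F c) => //; apply: pullback_eq => x px.
rewrite -kE // e // pullback_sum //; apply: eq_bigr => i _.
exact: cE.
Qed.

(** Compactness of the part of ker p outside V, which is covered by the open
    sets where some q i is nontrivial. *)
Lemma capN_small (V : set H) : open V ->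
  (forall x, p x = 1%g -> (forall i, q i x = 1%g) -> V x) ->
  exists2 F : seq J, uniq F & nset (capN p q F) `<=` V.
Proof.
move=> oV qV.
have cA : compact (ker p `\` V).
  apply: (subclosed_compact _ (@profinite_compact H)) => //.
  apply: closedI; first exact: ker_closed.
  exact: open_closedC.
have [|s sP] := @compact_finite_cover H _ J (fun i => [set h | q i h <> 1%g]) cA.
  move=> h [ph nV]; apply: contrapT => /forallNP nh; apply/nV/qV => // i.
  apply: contrapT => qh; apply: (nh i); apply: open_nbhs_nbhs; split => //.
  apply: (@open_comp _ _ (q i) (~` [set 1%g])) => [x _|].
    exact: epi_continuous.
  apply: closed_openC; exact: profinite_closed1.
exists (undup s); first exact: undup_uniq.
move=> x /capNP[px sx]; apply: contrapT => nV; have [//|i si] := sP x.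
by apply; apply: sx; rewrite mem_undup.
Qed.

(** As ker rho is finite, ker r is relatively open in ker p. *)
Lemma capN_quotient (E : profGroupType) (rho : epi E G) (r : epi H E) :
  (forall h, rho (r h) = p h) -> minimal_ker rho ->
  (forall x, p x = 1%g -> (forall i, q i x = 1%g) -> r x = 1%g) ->
  exists2 F : seq J, uniq F & nset (capN p q F) `<=` ker r.
Proof.
move=> rhor rmin qr; have cl : closed (ker rho `\ 1%g).
  apply: profinite_finite_closed.
  by apply: finite_setD; exact: minimal_ker_finite.
have [||F uF FV] := @capN_small (r @^-1` (~` (ker rho `\ 1%g))).
- apply: open_comp => [x _|]; first exact: epi_continuous.
  exact: closed_openC.
- by move=> x px qx /= [_]; apply; exact: qr.
exists F => // x Fx; apply: contrapT => rx; apply: (FV x Fx); split => //.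
by rewrite /ker /= rhor; exact: (capN_ker Fx).
Qed.

End FamilyModules.

(** B_A is infinite in general.  Over a basis (phi j) of B_A^* the group H_A is
    the fibre product of the extensions H / N j with N j the kernel of phi j;
    these have finite kernels, and their sections assemble to one of H_A. *)
Lemma epiA_section (H G : profGroupType) (p : epi H G) (A : simpleModule G) :
  exists2 s : G -> quot (NA p A), continuous s & cancel s (epiA p A).
Proof.
have [|J [phi [pfree pspan]]] := @basis_exists (gend A) (@gend_div G A)
    (ghom (BA p A) A) setT; first by split.
have phi0 j : phi j != 0%R.
  apply/eqP => phij; have := @lincomb_free _ _ _ _ [:: j : {classic J}] (fun=> 1%R) pfree.
  rewrite big_seq1 phij scaler0 => /(_ isT erefl j (mem_head _ _)) /eqP.
  by rewrite (negPf (gend_neq0 A)).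
pose data j := {N : nsubgroup H & {Np : nset N `<=` ker p & {k : kiso (quot_epi Np) A |
  forall x, p x = 1 -> kerval k (coset N x) = pullback (phi j) x}}}.
have D j : data j.
  have /cid[N /cid[Np /cid[k kE]]] := pullback_kernel (phi0 j).
  by exists N, Np, k.
pose N j := projT1 (D j); pose Np j := projT1 (projT2 (D j)).
pose k j := proj1_sig (projT2 (projT2 (D j))).
have kE j x : p x = 1 -> kerval (k j) (coset (N j) x) = pullback (phi j) x.
  exact: (proj2_sig (projT2 (projT2 (D j)))).
pose K j : profGroupType := quot (N j).
pose eta j : epi (K j) G := quot_epi (Np j).
pose q j : epi H (K j) := coset_epi (N j).
have etaq j h : eta j (q j h) = p h by exact: (quot_fun_coset (Np j)).
have eta_min j : minimal_ker (eta j) by exact: kiso_minimal (k j).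
have phiP j : ker_iso (eta j) A -> exists k : kiso (eta j) A,
    forall x, p x = 1 -> kerval k (q j x) = pullback (phi j) x.
  by move=> _; exists (k j); exact: kE.
have sep : kernels_separated eta q by move=> i j []; exact: kiso_abelian (k j).
have ind : kernels_independent p eta q.
  move=> j _; apply: (independent_at etaq eta_min phiP); first by exists; exact: k j.
  move=> F c uF jF _ e.
  have := @lincomb_free _ _ _ phi (j :: F)
    (fun i => if (i : {classic J}) == j then (-1)%R else c i) pfree.
  rewrite /= jF uF big_cons eqxx (_ : (\sum_(_ <- _) _)%R = phi j).
    rewrite scaleN1r addNr => /(_ isT erefl j (mem_head _ _)) /eqP.
    by rewrite eqxx oppr_eq0 (negPf (gend_neq0 A)).
  rewrite [RHS]e; apply: eq_big_seq => i iF; case: eqP => // ij.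
  by move: jF; rewrite -ij iF.
have onto := fprod_onto etaq (fun F uF => onto_on_independent etaq eta_min sep ind uF).
have NAN j : nset (NA p A) `<=` ker (q j).
  exact: (NA_kerq (k j) (etaq j)).
pose q' j : epi (quot (NA p A)) (K j) := quot_epi (NAN j).
have q'E j x : q' j (coset (NA p A) x) = q j x by exact: (quot_fun_coset (NAN j)).
have eta' j h : eta j (q' j h) = epiA p A h.
  by rewrite -(cosetK h) q'E etaq epiA_coset.
have [_ _ [g gc [fK gK]]] : top_group_iso (to_fprod eta').
  apply: to_fprod_iso; first exact: quot_compact.
    move=> y; have [h [ph qh]] := onto y; exists (coset _ h).
    by rewrite epiA_coset; split => // i; rewrite q'E.
  move=> x; rewrite -(cosetK x) epiA_coset => px qx.
  apply/esym/coset_eq; rewrite invg1 mul1g; split => // M [Mp [kM]].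
  have etaM h : quot_epi Mp (coset_epi M h) = p h by exact: (quot_fun_coset Mp).
  have [psi psiE] := BA_ghom_exists kM etaM.
  suff : coset M 1 = coset M (repr x) by move/coset_eq; rewrite invg1 mul1g.
  apply/esym; apply: (kerval_inj (k := kM)); first by rewrite etaM.
  rewrite -psiE //; have [f _ <-] : lin_span phi psi by rewrite pspan.
  have [s us sf] := fcover_ex f; rewrite (lincombE _ us sf) pullback_sum //.
  rewrite big1 // => j _; rewrite -kE // -[coset _ _]/(q j _) -q'E qx.
  by rewrite (kerhom1 (kerval_kerhom (k j))) ghom0.
have s_ex j := cid2 (kiso_section (k j)).
pose s j := s2val (s_ex j).
have sK j g' : eta j (s j g') = g' by exact: (s2valP' (s_ex j)).
exists (g \o (fun g' => Fprod (fun j => sK j g'))).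
  move=> x; apply: continuous_comp; last exact: gc.
  apply: fprod_comp_continuous => [|j].
    rewrite (_ : _ \o _ = id); first by move=> y; exact: cvg_id.
    by apply/funext => y /=; rewrite fbaseK.
  rewrite (_ : (fun y => _) = s j); first exact: (s2valP (s_ex j)).
  by apply/funext => y /=; rewrite fcompK.
move=> x /=; have := congr1 (@fbase _ _ _ _) (gK (Fprod (fun j => sK j x))).
by rewrite !fbaseK.
Qed.

(** Epimorphisms over G with kernel A correspond to the nonzero elements of
    B_A^* with the right image under S_A. *)
Section SAofMorphism.
Variables (H G E : profGroupType) (p : epi H G) (A : simpleModule G).
Variables (eta : epi E G) (k : kiso eta A) (phi : ghom (BA p A) A).

Lemma SA_of_morphism (q : epi H E) : (forall h, eta (q h) = p h) ->
  (forall x, p x = 1 -> kerval k (q x) = pullback phi x) ->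
  SA phi = kiso_class k.
Proof.
move=> etaq qphi; have [q' q'E] := quot_lift (NA_kerq k etaq).
apply: (class_of_morphism (epiA_section p A) (kiso_section k) (q := q')).
  by move=> x; rewrite -(cosetK x) q'E etaq epiA_coset.
move=> b; have bE := cosetK (kval b).
have pb : p (repr (kval b)) = 1 by rewrite -(epiA_coset p A) bE; exact: kvalP.
rewrite -[in LHS]bE q'E qphi // /pullback bE.
exact: extend_ker_kval.
Qed.

Lemma morphism_of_SA : phi != 0%R -> SA phi = kiso_class k ->
  exists q : epi H E, (forall h, eta (q h) = p h) /\
    forall x, p x = 1 -> kerval k (q x) = pullback phi x.
Proof.
move=> phi0 e; have [q [qM qc etaq qphi]] :=
  morphism_of_class (epiA_section p A) (kiso_section k) e.
have qE x : p x = 1 -> kerval k (q (coset (NA p A) x)) = pullback phi x.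
  move=> px; have cx : epiA p A (coset (NA p A) x) = 1 by rewrite epiA_coset.
  by rewrite /pullback (extend_kerE _ cx) -qphi KmodK.
have etaq' x : eta (q (coset (NA p A) x)) = p x by rewrite etaq epiA_coset.
pose r := fun h => q (coset (NA p A) h).
have rM : {morph r : x y / x * y} by move=> x y; rewrite /r cosetM qM.
have rc : continuous r.
  by move=> x; apply: continuous_comp; [exact: coset_continuous | exact: qc].
have onto_ker s : eta s = 1 -> exists2 x, p x = 1 & r x = s.
  move=> es; have [N [Np [kN kNE]]] := pullback_kernel phi0.
  have [y [py ky]] := kerval_surj kN (kerval k s).
  have px : p (repr y) = 1 by rewrite -(quot_fun_coset Np) cosetK.
  exists (repr y) => //; apply: (kerval_inj2 (k := k)) => //; first by rewrite etaq'.
  by rewrite qE // -kNE // cosetK.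
have rS s : exists h, r h = s.
  have [h ph] := epi_surj p (eta s).
  have [|x px rx] := onto_ker ((r h)^-1 * s).
    have etaM := epiM eta; rewrite etaM epiV etaq' ph mulVg //.
  by exists (h * x); rewrite rM rx mulVKg.
exists (Epi rM rc rS); split => //.
Qed.
End SAofMorphism.

(** * Isomorphisms over G and minimal kernels *)

Section EpiIso.
Variable G : topGroupType.

Lemma top_group_iso_epi (H E : topGroupType) (f : H -> E) :
  top_group_iso f -> exists r : epi H E, epi_fun r = f.
Proof.
move=> [fM fc [g gc [fK gK]]].
by exists (Epi fM fc (fun e => ex_intro _ (g e) (gK e))).
Qed.

Lemma epi_iso_refl (H : topGroupType) (eta : epi H G) : epi_iso eta eta.
Proof.
exists id => //; split => //; first by move=> x; exact: cvg_id.
by exists id => // x; exact: cvg_id.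
Qed.

Lemma epi_iso_sym (H E : topGroupType) (eta : epi H G) (zeta : epi E G) :
  epi_iso eta zeta -> epi_iso zeta eta.
Proof.
move=> [f [fM fc [g gc [fK gK]]] e]; exists g; last by move=> x; rewrite e gK.
split; [|exact: gc | by exists f].
by move=> x y; apply: (can_inj fK); rewrite gK fM !gK.
Qed.

Lemma epi_iso_trans (H E F : topGroupType) (eta : epi H G) (zeta : epi E G)
    (xi : epi F G) : epi_iso eta zeta -> epi_iso zeta xi -> epi_iso eta xi.
Proof.
move=> [f [fM fc [g gc [fK gK]]] e] [f' [f'M f'c [g' g'c [f'K g'K]]] e'].
exists (f' \o f); last by move=> x; rewrite e e'.
split; first by move=> x y /=; rewrite fM f'M.
  by move=> x; apply: continuous_comp; [exact: fc | exact: f'c].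
exists (g \o g').
  by move=> x; apply: continuous_comp; [exact: g'c | exact: gc].
by split=> x /=; rewrite ?f'K ?fK ?gK ?g'K.
Qed.

Lemma epi_iso_abelian (H E : topGroupType) (eta : epi H G) (zeta : epi E G) :
  epi_iso eta zeta -> abelian_ker zeta -> abelian_ker eta.
Proof.
move=> [f fiso e] ab x y ex ey; apply: (iso_inj fiso); have [fM _ _] := fiso.
by rewrite !fM; apply: ab; rewrite /ker /= -e.
Qed.

End EpiIso.

Section EpiIsoProfinite.
Variable G : profGroupType.

Lemma epi_iso_minimal (H E : profGroupType) (eta : epi H G) (zeta : epi E G) :
  epi_iso eta zeta -> minimal_ker zeta -> minimal_ker eta.
Proof.
move=> [f fiso e] zmin; have [r rf] := top_group_iso_epi fiso.
have rinj x y : r x = r y -> x = y by rewrite rf; exact: iso_inj.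
have zr h : zeta (r h) = eta h by rewrite rf e.
split.
  have [[s [zs s1]] _] := zmin; have [x rx] := epi_surj r s.
  exists x; split; first by rewrite /ker /= -zr rx.
  by move=> x1; apply: s1; rewrite -rx x1 epi1.
move=> M Me; have [Mr|nMr] := pselect (nset M `<=` ker r).
  by left=> x /Mr rx; apply: rinj; rewrite epi1.
right=> x ex; have [|m Mm /rinj <- //] := full_image zr zmin Me nMr (s := r x).
by rewrite zr.
Qed.

Lemma quot_epi_iso (H E : profGroupType) (p : epi H G) (eta : epi E G)
    (q : epi H E) (etaq : forall h, eta (q h) = p h) :
  epi_iso (quot_epi (kerq_ker etaq)) eta.
Proof.
have [q' q'E] := quot_lift (N := kerN q) (q := q) (fun x qx => qx).
exists q'.
  apply: inj_iso => x; rewrite -(cosetK x) q'E => qx.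
  by apply/esym/coset_eq; rewrite invg1 mul1g.
by move=> x; rewrite -(cosetK x) q'E etaq [LHS](quot_fun_coset (kerq_ker etaq)).
Qed.

Lemma maximal_normal_minimal (H : profGroupType) (p : epi H G)
    (N : nsubgroup H) (Np : nset N `<=` ker p) :
  maximal_normal_in (ker p) N -> minimal_ker (quot_epi Np).
Proof.
move=> [[_ pN] Nmax]; have qE x : quot_epi Np (coset N x) = p x.
  exact: (quot_fun_coset Np).
split.
  have /existsNP[x /not_implyP[px nx]] := pN.
  exists (coset N x); split; first exact: etrans (qE x) px.
  move=> /esym/coset_eq.
  by rewrite invg1 mul1g.
move=> M Mp; pose M' := nset_preimage (coset_epi N) M.
have M'p : nset M' `<=` ker p by move=> x /Mp cx; exact: etrans (esym (qE x)) cx.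
have [pM'|npM'] := pselect (ker p `<=` nset M').
  by right=> x; rewrite -(cosetK x) => cx; apply: pM'; exact: etrans (esym (qE _)) cx.
left=> x; rewrite -(cosetK x) => Mx.
apply/esym/coset_eq; rewrite invg1 mul1g; apply: (Nmax M') => // y Ny.
rewrite /M' /= (_ : coset N y = 1); first exact: nset1.
by apply/esym/coset_eq; rewrite invg1 mul1g.
Qed.

(** An abelian minimal kernel is a finite simple module; the action is
    continuous because it is conjugation by a continuous section. *)
Lemma minimal_abelian_simple (E : profGroupType) (eta : epi E G) :
  minimal_ker eta -> abelian_ker eta -> exists A : simpleModule G, ker_iso eta A.
Proof.
move=> emin ab; pose A : gmodType G := kmod ab.
have haus : hausdorff_space (kmod ab).
  apply: injective_hausdorff => x y xy; exists E, (@kval _ _ _ ab); split.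
  - exact: kval_continuous.
  - exact: profinite_hausdorff.
  - by move=> /kval_inj.
have fin : finite_set [set: A].
  pose f x : kmod ab := if pselect (eta x = 1) is left ex then Kmod ab ex else 0%R.
  have -> : [set: A] = f @` ker eta.
    apply/seteqP; split => // b _; exists (kval b); first exact: kvalP.
    rewrite /f; case: pselect => [e|]; last by case; exact: kvalP.
    by apply: kval_inj; rewrite KmodK.
  by apply: finite_image; exact: minimal_ker_finite.
have disc (U : set A) : open U.
  have /hausdorff_accessible/accessible_finite_set_closed cl := haus.
  by rewrite -closedC; apply: cl; exact: sub_finite_set fin.
have [s sc sK] := finite_ker_section (minimal_ker_finite emin).
have act : continuous (fun x : G * A => gact x.1 x.2).
  apply: kval_comp_continuous.
  rewrite (_ : _ \o _ = fun x : G * A => s x.1 * kval (x.2 : kmod ab) * (s x.1)^-1).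
    have c1 : continuous (fun x : G * A => s x.1).
      by move=> x; apply: continuous_comp; [exact: cvg_fst | exact: sc].
    apply: (@mulg_comp_continuous _ _ (fun x : G * A => s x.1 * kval (x.2 : kmod ab))
      (fun x : G * A => (s x.1)^-1)); last exact: invg_comp_continuous.
    apply: mulg_comp_continuous => //.
    by move=> x; apply: continuous_comp; [exact: cvg_snd | exact: kval_continuous].
  by apply/funext => x /=; rewrite (kval_act_section _ _ sK).
have neq0 : exists a : A, a != 0%R.
  have [[x [ex x1]] _] := emin; exists (Kmod ab ex : kmod ab); apply/eqP => e.
  by apply: x1; have := congr1 (@kval _ _ _ ab) e; rewrite !KmodK.
have simple (U : set A) : U 0%R -> (forall a b, U a -> U b -> U (a - b)%R) ->
    (forall g a, U a -> U (gact g a)) -> U = [set 0%R] \/ U = setT.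
  move=> U0 UB UJ; pose P : set E := [set x | exists2 a : kmod ab, U a & kval a = x].
  have UN a : U a -> U (- a)%R by move=> Ua; rewrite -sub0r; exact: UB.
  have UD a b : U a -> U b -> U (a + b)%R.
    by move=> Ua Ub; rewrite -(opprK b); apply: UB => //; exact: UN.
  have clP : closed P.
    apply: profinite_finite_closed.
    apply: sub_finite_set (minimal_ker_finite emin) => x [a _ <-].
    exact: kvalP.
  have [||||M ME] := @nset_exists E P _ _ _ _ clP.
  - by exists 0%R => //; exact: KmodK.
  - by move=> _ _ [a Ua <-] [b Ub <-]; exists (a + b)%R; [exact: UD | exact: kval_add].
  - by move=> _ [a Ua <-]; exists (- a)%R; [exact: UN | exact: KmodK].
  - move=> _ y [a Ua <-]; exists (gact (eta y^-1) a); first exact: UJ.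
    by rewrite kval_act /conjg invgK mulgA.
  have [|M1|Mfull] := proj2 emin M.
  - by rewrite ME => _ [a _ <-]; exact: kvalP.
  - left; apply/seteqP; split => [a Ua|a -> //].
    apply: (@kval_inj _ _ _ ab); rewrite [RHS]KmodK; apply: M1.
    by rewrite ME; exists a.
  - right; apply/seteqP; split => // a _.
    have : nset M (kval (a : kmod ab)) by apply: Mfull; exact: kvalP.
    by rewrite ME => -[b Ub /kval_inj <-].
exists (SimpleModule fin disc act neq0 simple); exists.
apply: (@KIso _ _ eta _ ab (ghom_id A)).
by exists (ghom_id A); split => x.
Qed.

End EpiIsoProfinite.

(** * Families indexed by subsets *)

Lemma set_type_ex (T : Type) (D : set T) i : D i -> exists d : D, set_val d = i.
Proof. by move=> Di; exists (SigSub (mem_set Di)); rewrite set_valE. Qed.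

Definition extend (T V : Type) (D : set T) (v0 : V) (f : D -> V) (i : T) : V :=
  if pselect (exists d : D, set_val d = i) is left e then f (projT1 (cid e)) else v0.

Lemma extend_val (T V : Type) (D : set T) (v0 : V) (f : D -> V) d :
  extend v0 f (set_val d) = f d.
Proof.
rewrite /extend; case: pselect => [e|[]]; last by exists d.
case: cid => d' /= dd'; congr f; apply: val_inj.
by move: dd'; rewrite set_valE.
Qed.

Lemma extend_out (T V : Type) (D : set T) (v0 : V) (f : D -> V) i :
  ~ D i -> extend v0 f i = v0.
Proof.
move=> nDi; rewrite /extend; case: pselect => // e; case: nDi.
by have [d <-] := e; exact: set_valP.
Qed.

Lemma sum_extend (R : pzRingType) (V : lmodType R) (T : Type) (D : set T)
    (F : seq {classic T}) (c : T -> R) (v : D -> V) : uniq F ->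
  exists F' : seq {classic D}, [/\ uniq F', forall d, (d : {classic D}) \in F' ->
      (set_val d : {classic T}) \in F &
    (\sum_(i <- F) c i *: extend 0 v i = \sum_(d <- F') c (set_val d) *: v d)%R].
Proof.
elim: F => [|i F IH] /=; first by exists [::]; rewrite !big_nil.
move=> /andP[iF /IH[F' [uF' F'F e]]].
have [Di|nDi] := pselect (D i).
  have [d dE] := set_type_ex Di; exists ((d : {classic D}) :: F').
  split; rewrite /= ?uF' ?andbT.
  - by apply: contra iF => /F'F; rewrite dE.
  - move=> d'; rewrite inE => /orP[/eqP ->|/F'F]; first by rewrite dE mem_head.
    by rewrite inE => ->; rewrite orbT.
  - by rewrite !big_cons e -dE extend_val.
exists F'; split => // [d /F'F|]; first by rewrite inE => ->; rewrite orbT.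
by rewrite big_cons e extend_out // scaler0 add0r.
Qed.

Lemma lin_span_in (R : pzRingType) (V : lmodType R) (J : Type) (v : J -> V) j :
  lin_span v (v j).
Proof. by have [f [_ fE]] := funitP V j; exists f. Qed.

(** The chosen element depends on P alone, so equal classes get the same
    representative.  P is not taken in [set T], because T will be a type of
    profinite groups or of modules, which lives in a larger universe. *)
Lemma choice_of_element (T : Type) : exists f : (T -> Prop) -> option T,
  forall P : T -> Prop, (exists x, P x) -> exists2 x, P x & f P = Some x.
Proof.
exists (fun P => if pselect (exists x, P x) is left e then Some (projT1 (cid e)) else None).
move=> P Pe; case: pselect => // e; exists (projT1 (cid e)) => //.
by case: cid.
Qed.

Lemma card_eq_extend (T U : Type) (D : set T) (B : set U) (u0 : U) : D #= B ->
  exists f : T -> U, [/\ forall i, D i -> B (f i),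
    forall i j, D i -> D j -> f i = f j -> i = j &
    forall u, B u -> exists2 i, D i & f i = u].
Proof.
move=> /card_bijP[f [g fK gK]]; exists (extend u0 (fun d => set_val (f d))); split.
- move=> i Di; have [d <-] := set_type_ex Di; rewrite extend_val; exact: set_valP.
- move=> i j Di Dj; have [d <-] := set_type_ex Di.
  have [d' <-] := set_type_ex Dj; rewrite !extend_val => e.
  congr set_val; apply: (can_inj fK); apply: val_inj.
  by move: e; rewrite !set_valE.
- move=> u Bu; have [b <-] := set_type_ex Bu; exists (set_val (g b)); first exact: set_valP.
  by rewrite extend_val gK.
Qed.

Lemma card_eq_of (T U : Type) (D : set T) (B : set U) (f : T -> U) :
  (forall i, D i -> B (f i)) -> (forall i j, D i -> D j -> f i = f j -> i = j) ->
  (forall u, B u -> exists2 i, D i & f i = u) -> D #= B.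
Proof.
move=> fB finj fsurj; apply/card_bijP.
pose F (d : D) : B := SigSub (mem_set (fB _ (set_valP d))).
have FE d : set_val (F d) = f (set_val d) by rewrite /F set_valE.
have g_ex (b : B) : exists d : D, F d = b.
  have [i Di fi] := fsurj _ (set_valP b); have [d dE] := set_type_ex Di.
  exists d; apply: val_inj; have := FE d; rewrite dE fi !set_valE; exact.
have [g gK] := choice g_ex; exists F; exists g => // d.
have := FE (g (F d)); rewrite gK FE => /esym /finj.
move=> /(_ (set_valP _) (set_valP _)); rewrite !set_valE; exact: val_inj.
Qed.

(** * From the fibre product to multiplicities and supports *)

Section Forward.
Variables (G H : profGroupType) (p : epi H G) (I : Type).
Variables (K : I -> profGroupType) (eta : forall i, epi (K i) G).
Variable q : forall i, epi H (K i).
Hypothesis etaq : forall i h, eta i (q i h) = p h.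
Hypothesis eta_min : forall i, minimal_ker (eta i).
Hypothesis onto : forall F, uniq F -> onto_on p eta q F.
Hypothesis inj : forall x, p x = 1 -> (forall i, q i x = 1) -> x = 1.
Local Notation J := {classic I}.

(** Some x is nontrivial in coordinate i and trivial in coordinate j. *)
Lemma kernels_injective i j : kerN (q i) = kerN (q j) -> i = j.
Proof.
move=> e; apply: contrapT => ij; have [[s [es s1]] _] := eta_min i.
have uF : uniq [:: i : J; j : J] by rewrite /= inE andbT; apply/eqP.
have [|x [_ xF]] := onto uF (f := @dfwith J K (fun=> 1) i s).
  move=> k; case: (eqVneq (i : J) k) => [<-|ik]; first by rewrite dfwithin.
  by rewrite dfwithout //; exact: epi1.
have xi := xF i (mem_head _ _); have xj := xF j; rewrite dfwithin in xi.
have qj : ker (q j) x.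
  by rewrite /ker /= xj ?inE ?eqxx ?orbT // dfwithout //; apply/eqP.
have : nset (kerN (q i)) x by rewrite e.
by move=> qi; apply: s1; rewrite -xi.
Qed.

(** If H / N has a non-abelian minimal kernel over G, then N contains the common
    kernel of finitely many q i by compactness, hence one ker (q i) since N is
    prime, and equals it since ker (q i) is maximal in ker p. *)
Lemma nonabelian_card (E : profGroupType) (zeta : epi E G) :
  indecomposable zeta -> ~ abelian_ker zeta ->
  I_na eta zeta #= mult_na_set p zeta.
Proof.
move=> /indecomposableP zmin znab.
apply: (card_eq_of (f := fun i => kerN (q i))).
- move=> i iz; exists (kerq_ker (etaq i)).
  exact: epi_iso_trans (quot_epi_iso (etaq i)) iz.
- by move=> i j _ _; exact: kernels_injective.
move=> N [Np Nz]; have Nmin := epi_iso_minimal Nz zmin.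
have Nnab : ~ abelian_ker (quot_epi Np).
  by move=> ab; apply: znab; exact: epi_iso_abelian (epi_iso_sym Nz) ab.
have cE h : quot_epi Np (coset_epi N h) = p h by exact: (quot_fun_coset Np).
have [|F uF FN] := capN_quotient (q := q) cE Nmin.
  by move=> x px qx; rewrite (inj px qx) epi1.
have [i iF iN] := nonabelian_prime_seq etaq cE Nmin Nnab FN.
have kE : ker (q i) = ker (coset_epi N).
  exact: (ker_maximal (etaq i) cE (eta_min i) Nmin iN).
have qN : kerN (q i) = N.
  apply: nset_eq; rewrite kerNE kE; apply/seteqP; split => x /=.
    by move=> /esym/coset_eq; rewrite invg1 mul1g.
  by move=> Nx; apply/esym/coset_eq; rewrite invg1 mul1g.
exists i => //; apply: epi_iso_trans (epi_iso_sym (quot_epi_iso (etaq i))) _.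
move: (kerq_ker (etaq i)); rewrite qN => Np'.
by rewrite (Prop_irrelevance Np' Np).
Qed.

Section Abelian.
Variables (A : simpleModule G).
Variable k : forall d : I_ab eta A, kiso (eta (set_val d)) A.

(** Independence: elements of ker p can be prescribed in finitely many
    coordinates.  Generation: an element of B_A^* factors through finitely many
    coordinates by compactness, and splits into components there. *)
Lemma dual_basis : exists phi : I_ab eta A -> ghom (BA p A) A,
  is_basis phi setT /\ forall d, SA (phi d) = kiso_class (k d).
Proof.
have phi_ex d : exists phi : ghom (BA p A) A, forall x, p x = 1 ->
    pullback phi x = kerval (k d) (q (set_val d) x).
  exact: BA_ghom_exists (k d) (etaq _).
have [phi phiE] := choice phi_ex; exists phi; split; last first.
  by move=> d; apply: (SA_of_morphism (etaq _)) => x px; rewrite phiE.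
pose D := I_ab eta A.
split.
  apply: inj_free => f f0; have [s us sf] := fcover_ex f.
  apply: finsupp_eqP => d; have [ds|/sf -> //] := boolP ((d : {classic D}) \in s).
  apply: ghom_eqP => a; have [y [ey ky]] := kerval_surj (k d) a.
  pose F : seq J := undup (map (fun d : {classic D} => set_val d : J) s).
  have [|x [px xF]] := onto (undup_uniq _ : uniq F)
      (f := @dfwith J K (fun=> 1) (set_val d) y).
    move=> i; case: (eqVneq (set_val d : J) i) => [<-|di]; first by rewrite dfwithin.
    by rewrite dfwithout //; exact: epi1.
  have xs d' : (d' : {classic D}) \in s -> q (set_val d') x =
      @dfwith J K (fun=> 1) (set_val d) y (set_val d').
    move=> d's; apply: xF; rewrite mem_undup.
    exact: (map_f (fun d : {classic D} => set_val d : J)).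
  have : pullback (lincomb phi f) x = 0%R.
    rewrite f0 /pullback.
    have cx : epiA p A (coset (NA p A) x) = 1 by rewrite epiA_coset.
    by rewrite (extend_kerE _ cx).
  rewrite (lincombE _ us sf) pullback_sum // (big_rem (d : {classic D})) //=.
  rewrite big_seq big1 => [|d']; last first.
    rewrite mem_rem_uniq // inE => /andP[d'd d's].
    rewrite phiE // xs // dfwithout ?(kerhom1 (kerval_kerhom (k d'))) ?ghom0 //.
    by apply: contra_neq d'd => /val_inj.
  by rewrite addr0 phiE // xs // dfwithin ky.
apply/seteqP; split => // psi _.
have [subS subD] := lin_span_submod phi.
have [->//|psi0] := eqVneq psi 0%R.
pose tot := extend (0%R : ghom (BA p A) A) phi.
have totS i : lin_span phi (tot i).
  have [Di|nDi] := pselect (I_ab eta A i).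
    by have [d <-] := set_type_ex Di; rewrite /tot extend_val; exact: lin_span_in.
  by rewrite /tot extend_out.
have totP i : ker_iso (eta i) A -> exists k : kiso (eta i) A,
    forall x, p x = 1 -> kerval k (q i x) = pullback (tot i) x.
  move=> ki; have [d <-] := @set_type_ex _ (I_ab eta A) i ki; exists (k d) => x px.
  by rewrite /tot extend_val phiE.
have [N [Np [kN kNE]]] := pullback_kernel psi0.
have cE h : quot_epi Np (coset_epi N h) = p h by exact: (quot_fun_coset Np).
have [|F uF FN] := capN_quotient (q := q) cE (kiso_minimal kN).
  by move=> x px qx; rewrite (inj px qx) epi1.
have [|u [uh uE]] := kerhom_split etaq uF (onto uF) (pullback_kerhom psi).
  move=> x Fx; have px : p x = 1 by exact: (capN_ker Fx).
  rewrite -kNE // (_ : coset N x = 1); first exact: (kerhom1 (kerval_kerhom kN)).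
  exact: FN.
have [c [c0 cE']] := coefficients etaq eta_min totP uh.
have -> : psi = (\sum_(i <- F) c i *: tot i)%R.
  apply: pullback_eq => x px; rewrite uE // pullback_sum //.
  by apply: eq_bigr => i _; exact: cE'.
by apply: (@submod_sum (gend A) _ _ J F c tot) => [|i _]; [exact: lin_span_submod | exact: totS].
Qed.

End Abelian.
End Forward.

Lemma fcomp_surj (G : profGroupType) (I : Type) (K : I -> profGroupType)
    (eta : forall i, epi (K i) G) i (k : K i) :
  exists y : Defs.fprod eta, fcomp y i = k.
Proof.
have [x xe] := fbase_surj eta (eta i k).
have e j : eta j (@dfwith {classic I} K (fcomp x) i k j) = eta i k.
  case: (eqVneq (i : {classic I}) j) => [<-|ij]; first by rewrite dfwithin.
  by rewrite dfwithout // Defs.fprodP xe.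
by exists (Fprod e); rewrite fcompK dfwithin.
Qed.

Lemma fprod_projections (G H : profGroupType) (p : epi H G) (I : Type)
    (K : I -> profGroupType) (eta : forall i, epi (K i) G) :
  epi_iso p (fprod_epi eta) ->
  exists q : forall i, epi H (K i), [/\ forall i h, eta i (q i h) = p h,
    forall F, uniq F -> onto_on p eta q F &
    forall x, p x = 1 -> (forall i, q i x = 1) -> x = 1].
Proof.
move=> [psi piso pE]; have [r rE] := top_group_iso_epi piso.
have q_surj i g : exists h, fcomp (r h) i = g.
  have [y <-] := fcomp_surj eta g; have [h <-] := epi_surj r y.
  by exists h.
have qM i : {morph (fun h => fcomp (r h) i) : x y / x * y}.
  by move=> x y; rewrite epiM fcompM.
have qc i : continuous (fun h => fcomp (r h) i).
  move=> x; apply: (@continuous_comp _ _ _ r (fun z => fcomp z i)).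
    exact: epi_continuous.
  exact: fcomp_continuous.
pose q i := Epi (qM i) (qc i) (q_surj i).
have pr h : p h = fbase (r h) by rewrite pE rE.
exists q; split.
- by move=> i h; rewrite pr -(Defs.fprodP (r h) i).
- move=> F _ f fe; have [x xE] := epi_surj r (Fprod fe).
  exists x; split; first by rewrite pr xE fbaseK.
  by move=> i _; rewrite /q /= xE fcompK.
- move=> x px qx; apply: (iso_inj piso); rewrite -rE epi1.
  apply: fprod_eqP => [|i]; first by rewrite -pr px fbaseK.
  by rewrite [LHS]qx fcompK.
Qed.

(** * From multiplicities and supports to the fibre product *)

Lemma ghom_compE (G : topGroupType) (C B A : gmodType G) (f : ghom B A)
    (g : ghom C B) x : ghom_fun (ghom_comp f g) x = f (g x).
Proof. by rewrite /ghom_comp GhomE. Qed.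

Lemma extend_free (R : pzRingType) (V : lmodType R) (I : Type) (D : set I)
    (phi : D -> V) (F : seq {classic I}) (c : I -> R) (d : D) :
  (1 : R)%R != 0%R -> relations phi = [set 0%R] -> uniq F ->
  (set_val d : {classic I}) \notin F ->
  phi d <> (\sum_(i <- F) c i *: extend 0 phi i)%R.
Proof.
move=> R1 phifree uF dF; have [F' [uF' F'F ->]] := sum_extend c phi uF => e.
have dF' : (d : {classic D}) \notin F' by apply: contra dF => /F'F.
have := @lincomb_free _ _ _ phi ((d : {classic D}) :: F')
  (fun i => if (i : {classic D}) == d then (-1)%R else c (set_val i)) phifree.
rewrite /= dF' uF' big_cons eqxx (_ : (\sum_(_ <- _) _)%R = phi d).
  rewrite scaleN1r addNr => /(_ isT erefl d (mem_head _ _)) /eqP.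
  by rewrite eqxx oppr_eq0 (negPf R1).
rewrite [RHS]e; apply: eq_big_seq => i iF; case: eqP => // id.
by move: dF'; rewrite -id iF.
Qed.

Section Backward.
Variables (G H : profGroupType) (p : epi H G) (I : Type).
Variables (K : I -> profGroupType) (eta : forall i, epi (K i) G).
Hypothesis eta_min : forall i, minimal_ker (eta i).
Local Notation J := {classic I}.
Let extEpi := {E : profGroupType & epi E G}.

Variable phi : forall A : simpleModule G, I_ab eta A -> ghom (BA p A) A.
Hypothesis phi_basis : forall A, is_basis (@phi A) setT.
Hypothesis phi_class : forall (A : simpleModule G) d,
  exists k : kiso (eta (set_val d)) A, SA (@phi A d) = kiso_class k.
Hypothesis na_card : forall (E : profGroupType) (zeta : epi E G),
  indecomposable zeta -> ~ abelian_ker zeta ->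
  I_na eta zeta #= mult_na_set p zeta.

Let tot (A : simpleModule G) : I -> ghom (BA p A) A := extend 0%R (@phi A).

Definition na_class (E : profGroupType) (zeta : epi E G) (z : extEpi) : Prop :=
  epi_iso zeta (projT2 z).
Definition ab_class (E : profGroupType) (zeta : epi E G) (A : simpleModule G) : Prop :=
  ker_iso zeta A.

Lemma na_class_eq (E F : profGroupType) (zeta : epi E G) (xi : epi F G) :
  epi_iso zeta xi -> na_class zeta = na_class xi.
Proof.
move=> zx; apply/funext => z; apply/propext; split.
  exact: epi_iso_trans (epi_iso_sym zx).
exact: epi_iso_trans zx.
Qed.

Lemma ab_class_eq (E F : profGroupType) (zeta : epi E G) (xi : epi F G)
    (A : simpleModule G) :
  ker_iso zeta A -> ker_iso xi A -> ab_class zeta = ab_class xi.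
Proof.
suff sub (E' F' : profGroupType) (z : epi E' G) (x : epi F' G) :
    ker_iso z A -> ker_iso x A -> forall B, ab_class z B -> ab_class x B.
  by move=> zA xA; apply/funext => B; apply/propext; split; exact: sub.
move=> [kz] [kx] B [lz]; have [kz' [kzK kz'K]] := kiso_iso kz.
have [kx' [kxK kx'K]] := kiso_iso kx.
move: kz kx kz' kzK kz'K kx' kxK kx'K lz => [abz fz gz] [abx fx gx] /=.
move=> kz' kzK kz'K kx' kxK kx'K [abz' fz' [gz' [gzK gz'K]]].
rewrite (Prop_irrelevance abz' abz) in fz' gz' gzK gz'K *.
exists; apply: (@KIso _ _ x B abx (ghom_comp fz' (ghom_comp kz' fx))).
exists (ghom_comp kx' (ghom_comp fz gz')).
by split=> y; rewrite !ghom_compE ?gzK ?kz'K ?kxK ?kx'K ?kzK ?gz'K.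
Qed.

(** The coordinates of the isomorphism.  A bijection is granted for each zeta and
    a basis for each A, but these are unrelated for isomorphic choices; so one
    representative zeta or A is fixed in each class, and all the q i of the class
    are taken from the bijection or the basis of that representative.  Then every
    maximal N is reached: it is the kernel of some q i if it is non-abelian, and
    contains the intersection of the kernels of finitely many q i otherwise. *)
Lemma coordinates : exists q : forall i, epi H (K i),
  [/\ forall i h, eta i (q i h) = p h,
      kernels_separated eta q, kernels_independent p eta q &
      (forall N : nsubgroup H, maximal_normal_in (ker p) N ->
         forall x, p x = 1 -> (forall i, q i x = 1) -> nset N x)].
Proof.
have [fz fzP] := choice_of_element extEpi.
have [fA fAP] := choice_of_element (simpleModule G).
have nof_ex (z : extEpi) : exists n : I -> nsubgroup H,
    indecomposable (projT2 z) -> ~ abelian_ker (projT2 z) ->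
    [/\ forall i, I_na eta (projT2 z) i -> mult_na_set p (projT2 z) (n i),
      forall i j, I_na eta (projT2 z) i -> I_na eta (projT2 z) j -> n i = n j -> i = j &
      forall N, mult_na_set p (projT2 z) N -> exists2 i, I_na eta (projT2 z) i & n i = N].
  have [[zi zab]|nz] :=
    pselect (indecomposable (projT2 z) /\ ~ abelian_ker (projT2 z)).
    by have [n nP] := card_eq_extend (kerN p) (na_card zi zab); exists n.
  by exists (fun=> kerN p) => zi zab; case: nz.
pose nof z := projT1 (cid (nof_ex z)); pose nofP z := projT2 (cid (nof_ex z)).
have zind (E : profGroupType) (zeta : epi E G) z : minimal_ker zeta ->
    ~ abelian_ker zeta -> na_class zeta z ->
    indecomposable (projT2 z) /\ ~ abelian_ker (projT2 z).
  move=> zmin nab zz; split.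
    by apply/indecomposableP; exact: epi_iso_minimal (epi_iso_sym zz) zmin.
  by move=> ab; apply: nab; exact: epi_iso_abelian zz ab.
(* The coordinate q i, constrained by the representative of its class. *)
have q_ex i : exists q : epi H (K i), [/\ forall h, eta i (q h) = p h,
    forall z, ~ abelian_ker (eta i) -> fz (na_class (eta i)) = Some z ->
      kerN q = nof z i &
    forall A, abelian_ker (eta i) -> fA (ab_class (eta i)) = Some A ->
      exists k : kiso (eta i) A,
        forall x, p x = 1 -> kerval k (q x) = pullback (tot A i) x].
  have [ab|nab] := pselect (abelian_ker (eta i)).
    have [A iA fAi] := fAP _ (minimal_abelian_simple (eta_min i) ab).
    have [d dE] := @set_type_ex _ (I_ab eta A) i iA; subst i.
    have [k kE] := phi_class d.
    have phi0 : phi d != 0%R.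
      apply/eqP => e0; apply: (@extend_free _ _ _ _ _ [::] (fun=> 0%R) d
        (gend_neq0 A) (proj1 (phi_basis A))) => //.
      by rewrite big_nil.
    have [q [etaq qE]] := morphism_of_SA phi0 kE.
    exists q; split => // B _; rewrite fAi => -[<-]; exists k => x px.
    by rewrite /tot extend_val qE.
  have [z iz fzi] := fzP _ (ex_intro (na_class (eta i)) (existT _ (K i) (eta i))
    (epi_iso_refl (eta i))).
  have [zi zab] := zind _ _ _ (eta_min i) nab iz.
  have [nz _ _] := nofP z zi zab.
  have [Np Niso] := nz i iz.
  have [f fiso fE] := epi_iso_trans Niso (epi_iso_sym iz).
  have [r rE] := top_group_iso_epi fiso.
  have etar h : eta i (epi_comp (coset_epi (nof z i)) r h) = p h.
    by rewrite /= rE -fE [LHS](quot_fun_coset Np).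
  exists (epi_comp (coset_epi (nof z i)) r); split => //.
  move=> z' _; rewrite fzi => -[<-]; apply: nset_eq; apply/seteqP; split => x.
    move=> rx; suff : coset (nof z i) 1 = coset (nof z i) x.
      by move/coset_eq; rewrite invg1 mul1g.
    by apply: (iso_inj fiso); rewrite -rE; apply: etrans (esym rx); rewrite -[RHS](epi1 r).
  move=> Nx; suff : coset (nof z i) 1 = coset (nof z i) x.
    by move=> e; rewrite /= /ker /= -e; exact: epi1.
  by apply/coset_eq; rewrite invg1 mul1g.
pose q i := projT1 (cid (q_ex i)).
have qP i := projT2 (cid (q_ex i)).
have etaq i h : eta i (q i h) = p h by have [] := qP i.
exists q; split => //.
- move=> i j nab e.
  have kN : kerN (q i) = kerN (q j) by apply: nset_eq; rewrite !kerNE.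
  have ij : epi_iso (eta i) (eta j).
    apply: epi_iso_trans (epi_iso_sym (quot_epi_iso (etaq i))) _.
    move: (kerq_ker (etaq i)); rewrite kN => Np'.
    by rewrite (Prop_irrelevance Np' (kerq_ker (etaq j))); exact: quot_epi_iso.
  have nabi : ~ abelian_ker (eta i).
    by move=> ab; apply: nab; exact: epi_iso_abelian (epi_iso_sym ij) ab.
  have [z jz fzj] := fzP _ (ex_intro (na_class (eta j)) (existT _ (K j) (eta j))
    (epi_iso_refl (eta j))).
  have [zi zab] := zind _ _ _ (eta_min j) nab jz.
  have [_ ninj _] := nofP z zi zab.
  have [_ qj _] := qP j; have [_ qi _] := qP i.
  apply: ninj; [exact: epi_iso_trans ij jz | exact: jz|].
  have fzi : fz (na_class (eta i)) = Some z by rewrite (na_class_eq ij).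
  exact: etrans (esym (qi z nabi fzi)) (etrans kN (qj z nab fzj)).
- move=> j ab.
  have [A jA fAj] := fAP _ (minimal_abelian_simple (eta_min j) ab).
  apply: (independent_at etaq eta_min (phi := tot A)) => //.
    move=> i iA; have [k0] := iA; have [_ _ qi] := qP i.
    by apply: qi; [exact: kiso_abelian k0 | rewrite (ab_class_eq iA jA)].
  move=> F c uF jF c0; have [d dE] := @set_type_ex _ (I_ab eta A) j jA.
  rewrite /tot -{1}dE extend_val.
  apply: extend_free => //; [exact: gend_neq0 | exact: (proj1 (phi_basis A))|].
  by rewrite dE.
move=> N Nmax x px qx; have [[Np _] _] := Nmax.
have Nmin := maximal_normal_minimal Np Nmax.
have [ab|nab] := pselect (abelian_ker (quot_epi Np)).
  have [A NA fAN] := fAP _ (minimal_abelian_simple Nmin ab).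
  have [k] := NA; have cE h : quot_epi Np (coset_epi N h) = p h by exact: (quot_fun_coset Np).
  have [psi psiE] := BA_ghom_exists k cE.
  suff : coset N 1 = coset N x by move/coset_eq; rewrite invg1 mul1g.
  apply/esym; apply: (kerval_inj (k := k)); first exact: etrans (cE x) px.
  rewrite -psiE //; have [f _ <-] : lin_span (@phi A) psi.
    by rewrite (proj2 (phi_basis A)).
  have [s us sf] := fcover_ex f; rewrite (lincombE _ us sf) pullback_sum //.
  rewrite big1 // => d _; have dA : ker_iso (eta (set_val d)) A by exact: (set_valP d).
  have [k0] := dA; have [_ _ qd] := qP (set_val d).
  have [|k' k'E] := qd A (kiso_abelian k0); first by rewrite (ab_class_eq dA NA).
  move: (k'E x px); rewrite /tot extend_val => <-.
  by rewrite -/(q _) qx (kerhom1 (kerval_kerhom k')) ghom0.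
have [z Nz fzN] := fzP _ (ex_intro (na_class (quot_epi Np))
  (existT _ (quot N : profGroupType) (quot_epi Np))
  (epi_iso_refl (quot_epi Np))).
have [zi zab] := zind _ _ _ Nmin nab Nz.
have [_ _ nsurj] := nofP z zi zab.
have [|i iz iN] := nsurj N; first by exists Np.
have Ni : epi_iso (quot_epi Np) (eta i) := epi_iso_trans Nz (epi_iso_sym iz).
have [_ qi _] := qP i.
have nabi : ~ abelian_ker (eta i).
  by move=> abi; apply: nab; exact: epi_iso_abelian Ni abi.
have fzi : fz (na_class (eta i)) = Some z by rewrite -(na_class_eq Ni).
have <- : kerN (q i) = N := etrans (qi z nabi fzi) iN.
exact: qx.
Qed.

End Backward.

Theorem theorem8p7 (G H : profGroupType) (p : epi H G)
  (p_fundamental : fundamental p)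
  (I : Type) (K : I -> profGroupType) (eta : forall i, epi (K i) G)
  (eta_indecomposable : forall i, indecomposable (eta i))
  (kappa : forall (A : simpleModule G) (i : I_ab eta A), kiso (eta (set_val i)) A) :
  epi_iso p (fprod_epi eta) <->
  [/\ (forall (E : profGroupType) (zeta : epi E G),
         indecomposable zeta -> ~ abelian_ker zeta ->
         I_na eta zeta #= mult_na_set p zeta),
      (forall A : simpleModule G,
         lin_span (fun i : I_ab eta A => kiso_class (kappa A i)) = supp_ab p A) &
      (forall A : simpleModule G,
         eq_dim (mult_ab_space p A)
                (relations (fun i : I_ab eta A => kiso_class (kappa A i))))].
Proof.
have eta_min i : minimal_ker (eta i) by apply/indecomposableP.
split=> [iso|[na_card supp_eq mult_eq]].
  have [q [etaq onto inj]] := fprod_projections iso.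
  have basis (A : simpleModule G) :
      lin_span (fun i : I_ab eta A => kiso_class (kappa A i)) = supp_ab p A /\
      eq_dim (mult_ab_space p A)
        (relations (fun i : I_ab eta A => kiso_class (kappa A i))).
    have [phi [phi_basis phi_class]] := dual_basis etaq eta_min onto inj (kappa A).
    have -> : (fun i : I_ab eta A => kiso_class (kappa A i)) = @SA _ _ p A \o phi.
      by apply/funext => d; rewrite /= phi_class.
    exact: (basis_image (@gend_div G A) (@SA_lin _ _ p A) phi_basis).
  split; [exact: nonabelian_card etaq eta_min onto inj | |].
    by move=> A; exact: (proj1 (basis A)).
  by move=> A; exact: (proj2 (basis A)).
have phi_ex (A : simpleModule G) : exists phi : I_ab eta A -> ghom (BA p A) A,
    is_basis phi setT /\ forall d, SA (phi d) = kiso_class (kappa A d).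
  exact: (basis_lift (@gend_div G A) (@SA_lin _ _ p A) (supp_eq A) (mult_eq A)).
pose phi (A : simpleModule G) := projT1 (cid (phi_ex A)).
have phi_basis A : is_basis (phi A) setT by have [] := projT2 (cid (phi_ex A)).
have phi_class (A : simpleModule G) (d : I_ab eta A) :
    exists k : kiso (eta (set_val d)) A, SA (phi A d) = kiso_class k.
  by exists (kappa A d); have [_] := projT2 (cid (phi_ex A)); exact.
have [q [etaq sep ind qmax]] := coordinates eta_min phi_basis phi_class na_card.
exists (to_fprod etaq); last by move=> h; rewrite [RHS]fbaseK.
apply: to_fprod_iso; first exact: profinite_compact.
  apply: (fprod_onto etaq) => F uF.
  exact: (onto_on_independent etaq eta_min sep ind uF).
move=> x px qx; suff : fundament_kernel p x by rewrite p_fundamental.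
by split => // N Nmax; exact: qmax.
Qed.
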